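(* Let $n\ge 2$ and let $L$ and $L'$ be oriented $n$-component virtual links. Then the following are equivalent. (i) $L$ and $L'$ are $v\Delta^\circ$-equivalent. (ii) $L$ and $L'$ are $vp$-equivalent. (iii) $\lambda_i(L)=\lambda_i(L')$ holds for any $i=1,\dots,n$.
   Context: Virtual links. An oriented $n$-component virtual link diagram is a generic immersion of $n$ oriented circles, ordered as $1,\dots,n$, into the plane, each double point of which is either a real crossing (with over/under information) or a virtual crossing. The generalized Reidemeister moves are: the Reidemeister moves I, II, III for real crossings; their analogues in which all crossings are virtual; and the mixed move in which a strand having two virtual crossings is passed across a real crossing. An oriented virtual link is an equivalence class of diagrams under generalized Reidemeister moves (and planar isotopy). $v\Delta^\circ$-moves. Consider a disk meeting the diagram in three oriented strands, any two of which cross exactly once, so that the three crossings are the vertices of a triangle whose sides, with the orientations of the strands, form a coherently oriented cycle. A $v\Delta^\circ$-move replaces three real crossings, where each of the three strands passes over at one of its two crossings and under at the other (the three crossings then have the same sign), by three virtual crossings, or is the inverse of this replacement. Virtualized pass-moves. Consider a disk meeting the diagram in a pair of parallel, disjoint strands oriented in opposite directions and another pair of parallel, disjoint strands oriented in opposite directions, where each strand of the first pair crosses each strand of the second pair exactly once. A $vp$-move replaces four real crossings at which both strands of the first pair pass over both strands of the second pair by four virtual crossings, or is the inverse of this replacement. For a local move $X$, two oriented virtual links are $X$-equivalent if their diagrams are related by a finite sequence of $X$-moves and generalized Reidemeister moves. Intersection numbers. For an oriented $n$-component virtual link $L=\bigcup_{i=1}^n K_i$ with a diagram $D$, the linking number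 ${\rm Lk}(K_i,K_j)$ ($i\neq j$) is the sum of the signs of the real crossings of $D$ at which $K_i$ passes over $K_j$; it is an invariant of $L$. The $i$th intersection number of $L$ is $$\lambda_i(L)=\sum_{1\leq j\ne i\leq n} {\rm Lk}(K_j,K_i)-\sum_{1\leq j\ne i\leq n}{\rm Lk}(K_i,K_j)\in\mathbb{Z}.$$ *)

(* Defs.v *)
From mathcomp Require Import all_boot all_order all_algebra.
From Stdlib Require Import Relations ClassicalEpsilon.

Set Implicit Arguments.
Unset Strict Implicit.
Unset Printing Implicit Defensive.

Import Order.TTheory GRing.Theory Num.Theory.
Local Open Scope ring_scope.

(** * Oriented virtual link diagrams

    A plane diagram is put in general position with respect to the height
    function and recorded, from bottom to top, as the word of its singular
    levels: local minima (cups), local maxima (caps) and crossings, each of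
    them given with the number of strands to its left.  Between two singular
    levels the diagram is a sequence of vertical strands, listed from left to
    right, each carrying the component it belongs to and its orientation.
    General-position diagrams are planar isotopic if and only if their words
    are related by the moves [isotopy] below. *)

(* Every crossing is drawn as an X.  [Over] (resp. [Under]) is the real
   crossing at which the branch going from lower left to upper right passes
   over (resp. under) the other branch.                                       *)
Inductive crossing := Over | Under | Virtual.

Definition is_real (x : crossing) : bool :=
  if x is Virtual then false else true.

(* The same crossing information once the two branches have exchanged their
   slopes.                                                                    *)
Definition flip (x : crossing) : crossing :=
  match x with Over => Under | Under => Over | Virtual => Virtual end.

(* Component, and orientation: [true] is upwards, [false] is downwards.       *)
Definition strand (n : nat) : Type := ('I_n * bool)%type.

(* [Cup c d] is a local minimum of component [c] whose left leg has
   orientation [d].                                                           *)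
Inductive piece (n : nat) :=
  | Cup of 'I_n & bool
  | Cap
  | Cross of crossing.

Arguments Cap {n}.
Arguments Cross {n} x.

Definition word (n : nat) : Type := seq (nat * piece n).

Section Words.

Variable n : nat.
Implicit Types (s : seq (strand n)) (w : word n).

Definition inputs (e : piece n) : nat := if e is Cup _ _ then 0%N else 2%N.
Definition outputs (e : piece n) : nat := if e is Cap then 0%N else 2%N.

Definition act (e : piece n) s : option (seq (strand n)) :=
  match e, s with
  | Cup c d, [::] => Some [:: (c, d); (c, ~~ d)]
  | Cap, [:: (c, d); (c', d')] =>
      if (c == c') && (d != d') then Some [::] else None
  | Cross _, [:: a; b] => Some [:: b; a]
  | _, _ => None
  end.

Definition step s (pe : nat * piece n) : option (seq (strand n)) :=
  let: (p, e) := pe in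
  if (p <= size s)%N then
    omap (fun t => take p s ++ t ++ drop (p + inputs e) s)
         (act e (take (inputs e) (drop p s)))
  else None.

Fixpoint run s w : option (seq (strand n)) :=
  if w is pe :: w' then obind (fun t => run t w') (step s pe) else Some s.

(* The strands just above the word [w], starting from the empty level. *)
Definition strands w : seq (strand n) := odflt [::] (run [::] w).

(* The point [(k, q)] is the [q]-th strand between the [k]-th and the
   [k.+1]-st singular levels. *)
Definition on_component w (i : 'I_n) (x : nat * nat) : Prop :=
  exists d, onth (strands (take x.1 w)) x.2 = Some (i, d).

Inductive joined w : nat * nat -> nat * nat -> Prop :=
  | joined_left k p e q :
      onth w k = Some (p, e) -> (q < p)%N -> joined w (k, q) (k.+1, q)
  | joined_right k p e q :
      onth w k = Some (p, e) ->
      joined w (k, (p + inputs e + q)%N) (k.+1, (p + outputs e + q)%N)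
  | joined_cup k p c d :
      onth w k = Some (p, Cup c d) -> joined w (k.+1, p) (k.+1, p.+1)
  | joined_cap k p :
      onth w k = Some (p, Cap) -> joined w (k, p) (k, p.+1)
  | joined_cross_up k p x :
      onth w k = Some (p, Cross x) -> joined w (k, p) (k.+1, p.+1)
  | joined_cross_down k p x :
      onth w k = Some (p, Cross x) -> joined w (k, p.+1) (k.+1, p).

(* A closed diagram in which, for every [i], the strands labelled [i] form
   exactly one circle.                                                        *)
Definition is_diagram w : Prop :=
  run [::] w = Some [::] /\
  forall i : 'I_n,
    (exists x, on_component w i x) /\
    (forall x y, on_component w i x -> on_component w i y ->
       clos_refl_sym_trans _ (joined w) x y).

End Words.

Record diagram (n : nat) := Diagram {
  diagram_word :> word n;
  diagramP : is_diagram diagram_word }.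

(** * Local moves *)

(* A local move relates two words read from the same level, whose strands are
   the first argument.                                                        *)
Definition local_move (n : nat) : Type :=
  seq (strand n) -> word n -> word n -> Prop.

Definition performs (n : nat) (M : local_move n) (D D' : diagram n) : Prop :=
  exists u a b v : word n,
    [/\ diagram_word D = u ++ a ++ v,
        diagram_word D' = u ++ b ++ v
      & M (strands u) a b].

Section Moves.

Variable n : nat.
Implicit Types (s : seq (strand n)) (p q : nat) (x y z : crossing).

Inductive isotopy s : word n -> word n -> Prop :=
  (* two pieces side by side exchange their heights *)
  | iso_exchange p q (e f : piece n) :
      isotopy s [:: (p, e); ((p + outputs e + q)%N, f)]
                [:: ((p + inputs e + q)%N, f); (p, e)]
  (* a local minimum and a local maximum are cancelled *)
  | iso_zigzag_right p c d : isotopy s [:: (p, Cup c d); (p.+1, Cap)] [::]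
  | iso_zigzag_left p c d : isotopy s [:: (p.+1, Cup c d); (p, Cap)] [::]
  (* a crossing slides through a local maximum or minimum *)
  | iso_slide_cap p x :
      isotopy s [:: (p, Cross x); (p.+1, Cap)]
                [:: (p.+1, Cross (flip x)); (p, Cap)]
  | iso_slide_cup p x c d :
      isotopy s [:: (p.+1, Cup c d); (p, Cross x)]
                [:: (p, Cup c d); (p.+1, Cross (flip x))].

(* The crossing of a strand at height [h] coming from the left with one at
   height [h'] coming from the right, the higher one passing over.            *)
Definition layered (h h' : nat) : crossing := if (h' < h)%N then Over else Under.

(* Crossings of the first and second, first and third, second and third of
   three strands (counted from the left at the bottom) admitting a move of type
   III.  In the last three cases one strand has two virtual crossings: this is
   the mixed move if [x] is real and the virtual move III otherwise.          *)
Inductive third : crossing -> crossing -> crossing -> Prop :=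
  | third_real h1 h2 h3 : uniq [:: h1; h2; h3] ->
      third (layered h1 h2) (layered h1 h3) (layered h2 h3)
  | third_virtual3 x : third x Virtual Virtual
  | third_virtual2 x : third Virtual x Virtual
  | third_virtual1 x : third Virtual Virtual x.

(* Types I and II with [x] real are Reidemeister's, with [x] virtual the virtual
   ones.                                                                      *)
Inductive reidemeister s : word n -> word n -> Prop :=
  | RI_right p x c d :
      reidemeister s [:: (p.+1, Cup c d); (p, Cross x); (p.+1, Cap)] [::]
  | RI_left p x c d :
      reidemeister s [:: (p, Cup c d); (p.+1, Cross x); (p, Cap)] [::]
  | RII p x :
      reidemeister s [:: (p, Cross x); (p, Cross (flip x))] [::]
  | RIII p x y z : third x y z ->
      reidemeister s [:: (p, Cross x); (p.+1, Cross y); (p, Cross z)]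
                     [:: (p.+1, Cross z); (p, Cross y); (p.+1, Cross x)].

Definition orientations s p m : seq bool :=
  [seq a.2 | a <- take m (drop p s)].

(* Three strands any two of which cross once bound a triangle with coherently
   oriented sides if and only if the middle one (at the bottom) is oriented
   against the two others.  Each strand passes over exactly once if and only
   if the crossings are [x], [flip x], [x] from bottom to top.                *)
Inductive vdelta s : word n -> word n -> Prop :=
  | vdelta_right p x d :
      is_real x -> orientations s p 3 = [:: d; ~~ d; d] ->
      vdelta s [:: (p, Cross x); (p.+1, Cross (flip x)); (p, Cross x)]
               [:: (p, Cross Virtual); (p.+1, Cross Virtual);
                   (p, Cross Virtual)]
  | vdelta_left p x d :
      is_real x -> orientations s p 3 = [:: d; ~~ d; d] ->
      vdelta s [:: (p.+1, Cross x); (p, Cross (flip x)); (p.+1, Cross x)]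
               [:: (p.+1, Cross Virtual); (p, Cross Virtual);
                   (p.+1, Cross Virtual)].

(* The strands [p], [p + 1] cross the strands [p + 2], [p + 3]. *)
Definition pass p x : word n :=
  [:: (p.+1, Cross x); (p, Cross x); (p.+2, Cross x); (p.+1, Cross x)].

(* The left pair passes over the right one if [x] is [Over], and under it if
   [x] is [Under].                                                            *)
Inductive vpass s : word n -> word n -> Prop :=
  | vpass_intro p x d d' :
      is_real x -> orientations s p 4 = [:: d; ~~ d; d'; ~~ d'] ->
      vpass s (pass p x) (pass p Virtual).

End Moves.

Definition generalized_reidemeister (n : nat) (D D' : diagram n) : Prop :=
  performs (@isotopy n) D D' \/ performs (@reidemeister n) D D'.

(** * Oriented virtual links *)

Definition same_link (n : nat) : diagram n -> diagram n -> Prop :=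
  clos_refl_sym_trans _ (@generalized_reidemeister n).

Record vlink (n : nat) := VLink {
  diagram_of :> diagram n -> Prop;
  diagram_ofP : exists D, forall D', diagram_of D' <-> same_link D D' }.

Definition equivalent_by (n : nat) (M : local_move n) (L L' : vlink n) : Prop :=
  exists D D' : diagram n,
    [/\ L D, L' D'
      & clos_refl_sym_trans _
          (fun E E' => performs M E E' \/ generalized_reidemeister E E') D D'].

Definition vdelta_equivalent (n : nat) : vlink n -> vlink n -> Prop :=
  equivalent_by (@vdelta n).

Definition vp_equivalent (n : nat) : vlink n -> vlink n -> Prop :=
  equivalent_by (@vpass n).

(** * Intersection numbers *)

(* The sign of a real crossing whose branches coming from the lower left and
   the lower right are oriented by [d] and [d'].                              *)
Definition sign (x : crossing) (d d' : bool) : int :=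
  match x with
  | Over => if d == d' then 1 else -1
  | Under => if d == d' then -1 else 1
  | Virtual => 0
  end.

Section Linking.

Variable n : nat.

(* The contribution to Lk(K_i, K_j) of a piece met at the level [s]. *)
Definition lk_at (i j : 'I_n) (s : seq (strand n)) (pe : nat * piece n) : int :=
  match pe.2, take 2 (drop pe.1 s) with
  | Cross x, [:: (a, d); (b, d')] =>
      let over_under := if x is Over then (a, b) else (b, a) in
      if over_under == (i, j) then sign x d d' else 0
  | _, _ => 0
  end.

Definition diagram_lk (D : diagram n) (i j : 'I_n) : int :=
  let w : seq _ := diagram_word D in
  \sum_(k < size w) lk_at i j (strands (take k w)) (tnth (in_tuple w) k).

Lemma vlink_inhabited (L : vlink n) : exists D, L D.
Proof. by case: L => C [D HD]; exists D; apply/HD; apply: rst_refl. Qed.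

Definition some_diagram (L : vlink n) : diagram n :=
  proj1_sig (constructive_indefinite_description _ (vlink_inhabited L)).

Definition lk (L : vlink n) (i j : 'I_n) : int := diagram_lk (some_diagram L) i j.

Definition intersection_number (L : vlink n) (i : 'I_n) : int :=
  \sum_(j < n | j != i) lk L j i - \sum_(j < n | j != i) lk L i j.

End Linking.

(* Main.v *)
(* A real crossing is a virtual crossing followed by a chord: a real crossing of
   two strands, one of which comes back virtually.  Virtual crossings obey the
   Coxeter relations, so a word of crossings is determined by its chords and its
   permutation.  Write c_ab for the chord at which strand a passes over strand b.
   The v-Delta move says c_ca = c_ab c_bc = c_bc c_ab when a and c are oriented
   alike and b oppositely.  The vp-move gives the same relations: bending one
   strand into a zigzag turns one of its four chords into a kink, which a type I
   move removes.  As soon as there are two strands of each orientation, these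
   relations make all chords commute.

   In plat form (minima, then crossings, then maxima) a chord at one leg of a
   minimum slides to the other leg.  If a maximum joins two different minima, the
   chords slide off the legs that it joins and the zigzag is cancelled; so one
   minimum per component remains.  Chords then reduce to powers of c_{0 i} between
   the left legs of the first minimum and of the i-th one, and the exponents are
   the intersection numbers. *)

Require Import Defs.
From HB Require Import structures.
From mathcomp Require Import all_boot all_order all_algebra.
From Stdlib Require Import Relations ClassicalEpsilon Classical_Prop.
From mathcomp Require Import zify ring.

Set Implicit Arguments.
Unset Strict Implicit.
Unset Printing Implicit Defensive.

(** * Running a word *)

(** The moves of the theorem relate diagrams, but the algebra of chords needs words that are neither
    closed nor connected. Moves are therefore read as an equivalence [teq] of words above an
    arbitrary level. To return to diagrams, every word met on the way must again have one circle per
    component; the condition is rephrased as the absence of a finer labelling ([conn]), which can be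
    carried through a move by relabelling.

    The minima bound a product of chords on one side only, so what holds modulo the minima is at
    first a statement about cosets. Commutativity of the chords turns the cosets into a quotient
    group, in which relations at the minima may be used anywhere in a product. Commutativity needs
    spare strands of both orientations, and $n\ge 2$ supplies them: of two minima, one avoids any
    given strand, and it has a leg of each orientation.

    The intersection numbers are invariant because exchanging over and under changes both the sign
    of a crossing and the roles of its strands: the contribution of a real crossing depends only on
    its strands and their orientations. *)

Arguments step : simpl never.

Section Running.

Variable n : nat.
Implicit Types (s r t l : seq (strand n)) (w u v a b : word n) (e : piece n).

Definition shift (k : nat) w : word n := [seq (k + pe.1, pe.2) | pe <- w].

Lemma step_cat l r p e :
  step (l ++ r) (size l + p, e) = omap (cat l) (step r (p, e)).
Proof.
rewrite /step size_cat leq_add2l; case: leqP => // hp.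
have -> : take (inputs e) (drop (size l + p) (l ++ r)) =
          take (inputs e) (drop p r).
  by rewrite addnC -drop_drop drop_size_cat.
have -> : drop (size l + p + inputs e) (l ++ r) = drop (p + inputs e) r.
  by rewrite -addnA addnC -drop_drop drop_size_cat.
have -> : take (size l + p) (l ++ r) = l ++ take p r.
  by rewrite take_cat ltnNge leq_addr /= addKn.
by case: (act _ _) => [x|] //=; rewrite -catA.
Qed.

Lemma run_cat s u v : run s (u ++ v) = obind (fun t => run t v) (run s u).
Proof. by elim: u s => //= pe u IH s; case: (step s pe). Qed.

Lemma run_shift l r w :
  run (l ++ r) (shift (size l) w) = omap (cat l) (run r w).
Proof.
elim: w r => //= -[p e] w IH r.
by rewrite [X in obind _ X]step_cat; case: (step r _) => //= t; rewrite -IH.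
Qed.

Lemma shift_cat k u v : shift k (u ++ v) = shift k u ++ shift k v.
Proof. exact: map_cat. Qed.

Lemma shift0 w : shift 0 w = w.
Proof. by elim: w => //= -[p e] w ->. Qed.

Lemma shift_shift j k w : shift j (shift k w) = shift (j + k) w.
Proof. by elim: w => //= pe w ->; rewrite addnA. Qed.

Lemma act_size e s t : act e s = Some t -> size s = inputs e /\ size t = outputs e.
Proof.
case: e => [c d| |x]; case: s => [|[c1 d1] [|[c2 d2] []]] //=.
- by case=> <-.
- by case: ifP => // _ [<-].
by case=> <-.
Qed.

Lemma step_some s p e t : step s (p, e) = Some t ->
  exists l x y r, [/\ s = l ++ x ++ r, t = l ++ y ++ r, size l = p
                    & act e x = Some y].
Proof.
rewrite /step; case: leqP => // hp.
case E: act => [y|] //= [<-].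
exists (take p s), (take (inputs e) (drop p s)), y, (drop (p + inputs e) s).
split=> //; last by rewrite size_takel.
by rewrite addnC -drop_drop cat_take_drop cat_take_drop.
Qed.

Lemma step_act l x y r e :
  act e x = Some y -> step (l ++ x ++ r) (size l, e) = Some (l ++ y ++ r).
Proof.
move=> E; have [h _] := act_size E.
rewrite -[size l]addn0 step_cat /step leq0n drop0 take0 add0n.
by rewrite -h take_size_cat // E /= drop_size_cat.
Qed.

End Running.

(** * Moves in explicit form *)

Section LocalMoves.

Variables (n : nat) (k : bool).
Implicit Types (s r t l : seq (strand n)) (w u v : word n) (e f : piece n).

(** The boolean [k] selects one of the two moves, so that both equivalences of the theorem are
    treated by the same proof. *)
Definition extra_move : local_move n :=
  if k then @vdelta n else @vpass n.

(* The moves applied at the left end of a level on which they are valid. *)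
Inductive lmove : seq (strand n) -> word n -> word n -> Prop :=
  | lm_exchange x y r r' q e f :
      act e x = Some y -> step r (q, f) = Some r' ->
      lmove (x ++ r) [:: (0, e); (outputs e + q, f)] [:: (inputs e + q, f); (0, e)]
  | lm_zigzag_right c d r :
      lmove ((c, d) :: r) [:: (0, Cup c d); (1, Cap)] [::]
  | lm_zigzag_left c d r :
      lmove ((c, ~~ d) :: r) [:: (1, Cup c d); (0, Cap)] [::]
  | lm_slide_cap c d b x r :
      lmove [:: (c, d), b, (c, ~~ d) & r]
        [:: (0, Cross x); (1, Cap)] [:: (1, Cross (flip x)); (0, Cap)]
  | lm_slide_cup c d b x r :
      lmove (b :: r)
        [:: (1, Cup c d); (0, Cross x)] [:: (0, Cup c d); (1, Cross (flip x))]
  | lm_RI_right c d x r :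
      lmove ((c, d) :: r) [:: (1, Cup c d); (0, Cross x); (1, Cap)] [::]
  | lm_RI_left c d x r :
      lmove ((c, ~~ d) :: r) [:: (0, Cup c d); (1, Cross x); (0, Cap)] [::]
  | lm_RII a b x r :
      lmove [:: a, b & r] [:: (0, Cross x); (0, Cross (flip x))] [::]
  | lm_RIII a b c x y z r : third x y z ->
      lmove [:: a, b, c & r]
        [:: (0, Cross x); (1, Cross y); (0, Cross z)]
        [:: (1, Cross z); (0, Cross y); (1, Cross x)]
  | lm_delta_right a b c x d r : k -> is_real x ->
      lmove [:: (a, d), (b, ~~ d), (c, d) & r]
        [:: (0, Cross x); (1, Cross (flip x)); (0, Cross x)]
        [:: (0, Cross Virtual); (1, Cross Virtual); (0, Cross Virtual)]
  | lm_delta_left a b c x d r : k -> is_real x ->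
      lmove [:: (a, d), (b, ~~ d), (c, d) & r]
        [:: (1, Cross x); (0, Cross (flip x)); (1, Cross x)]
        [:: (1, Cross Virtual); (0, Cross Virtual); (1, Cross Virtual)]
  | lm_pass a b c d x o o' r : ~~ k -> is_real x ->
      lmove [:: (a, o), (b, ~~ o), (c, o'), (d, ~~ o') & r]
        (pass n 0 x) (pass n 0 Virtual).

Definition any_move s a b :=
  isotopy s a b \/ reidemeister s a b \/ extra_move s a b.

Lemma split_level p s : p <= size s -> exists l r, s = l ++ r /\ size l = p.
Proof.
by move=> h; exists (take p s), (drop p s); rewrite cat_take_drop size_takel.
Qed.

Lemma step_le s p e t : step s (p, e) = Some t -> p <= size s.
Proof. by rewrite /step; case: leqP. Qed.

Lemma run_head s p e w : run s ((p, e) :: w) <> None -> p <= size s.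
Proof. by rewrite /= /step; case: leqP. Qed.

Lemma any_move_lmove l r a b :
  lmove r a b -> any_move (l ++ r) (shift (size l) a) (shift (size l) b).
Proof.
case=> [x y r0 r' q e f _ _|c d r0|c d r0|c d b0 x r0|c d b0 x r0|c d x r0
  |c d x r0|a0 b0 x r0|a0 b0 c x y z r0 h|a0 b0 c x d r0 hk hx
  |a0 b0 c x d r0 hk hx|a0 b0 c d x o o' r0 hk hx]; rewrite /shift /= ?addn0 ?addn1.
- left; rewrite !addnA; exact: iso_exchange.
- left; exact: iso_zigzag_right.
- left; exact: iso_zigzag_left.
- left; exact: iso_slide_cap.
- left; exact: iso_slide_cup.
- right; left; exact: RI_right.
- right; left; exact: RI_left.
- right; left; exact: RII.
- right; left; exact: RIII.
- right; right; rewrite /extra_move hk; apply: (vdelta_right (d := d)) => //.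
  by rewrite /orientations drop_size_cat //= take0.
- right; right; rewrite /extra_move hk; apply: (vdelta_left (d := d)) => //.
  by rewrite /orientations drop_size_cat //= take0.
- right; right; rewrite /extra_move (negbTE hk) addn2.
  apply: (vpass_intro (d := o) (d' := o')) => //.
  by rewrite /orientations drop_size_cat //= take0.
Qed.


Lemma step0 r e : step r (0, e) =
  match e, r with
  | Cup c d, r => Some [:: (c, d), (c, ~~ d) & r]
  | Cap, [:: a, b & r'] =>
      if (a.1 == b.1) && (a.2 != b.2) then Some r' else None
  | Cross _, [:: a, b & r'] => Some [:: b, a & r']
  | _, _ => None
  end.
Proof.
rewrite /step leq0n drop0 take0 /=.
by case: e r => [c d| |x] [|[c1 d1] [|[c2 d2] r]] //=; rewrite ?take0 ?drop0 //;
  case: ifP.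
Qed.

Lemma stepS a r p e : step (a :: r) (p.+1, e) = omap (cons a) (step r (p, e)).
Proof. exact: (@step_cat n [:: a]). Qed.

Lemma step_nil p e : step [::] (p.+1, e) = None.
Proof. by []. Qed.

Definition stepE := (step0, stepS, step_nil).

Lemma partner_orientation (d d' : bool) : d != d' -> d' = ~~ d.
Proof. by case: d; case: d'. Qed.

(** The moves are given for all positions and labels, even where a word cannot be read. That [a]
    runs forces the strands at the site to have the number, labels and orientations listed in
    [lmove]. *)
Lemma lmove_any_move s a b : any_move s a b -> run s a <> None ->
  exists l r a0 b0, [/\ s = l ++ r, a = shift (size l) a0,
    b = shift (size l) b0 & lmove r a0 b0].
Proof.
(* Reduces every case to a site at the left end of the level. *)
have wrap p a0 b0 a1 b1 : p <= size s -> a1 = shift p a0 -> b1 = shift p b0 ->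
    (forall r, run r a0 <> None ->
       (exists l, s = l ++ r /\ size l = p) -> lmove r a0 b0) ->
    run s a1 <> None ->
    exists l r a0 b0, [/\ s = l ++ r, a1 = shift (size l) a0,
      b1 = shift (size l) b0 & lmove r a0 b0].
  move=> /split_level[l [r [E <-]]] -> -> H hr; exists l, r, a0, b0; split=> //.
  by apply: H; [move: hr; rewrite E run_shift; case: (run r a0) | exists l].
case=> [|[]].
- case=> [p q e f|p c d|p c d|p x|p x c d] /[dup] /run_head hp.
  + apply: (wrap p [:: (0, e); (outputs e + q, f)]
                   [:: (inputs e + q, f); (0, e)]) => //.
    all: try by rewrite /shift /= ?addn0 ?addnA.
    move=> r /= + _; case E: (step r (0, e)) => [t|] //=.
    have [l [x [y [r1 [-> -> /size0nil -> hx]]]]] := step_some E.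
    rewrite /= -{1}(act_size hx).2 step_cat.
    by case F: (step r1 (q, f)) => [r'|] //= _; apply: lm_exchange hx F.
  + apply: (wrap p [:: (0, Cup c d); (1, Cap)] [::]) => //.
    all: try by rewrite /shift /= addn0 addn1.
    move=> r; rewrite /= step0 /= stepS step0; case: r => [|[c1 d1] r] //=.
    case: ifP => // /andP[/eqP <- /partner_orientation ->] _ _.
    by rewrite negbK; apply: lm_zigzag_right.
  + apply: (wrap p [:: (1, Cup c d); (0, Cap)] [::]); first exact: ltnW.
    all: try by rewrite /shift /= ?addn0 ?addn1.
    move=> [|[c1 d1] r] //=; rewrite !stepE /= ?stepE /=.
    case: ifP => // /andP[/eqP -> /partner_orientation ->] _ _.
    by rewrite -{1}[d1]negbK; apply: lm_zigzag_left.
  + apply: (wrap p [:: (0, Cross x); (1, Cap)]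
       [:: (1, Cross (flip x)); (0, Cap)]) => //.
    all: try by rewrite /shift /= ?addn0 ?addn1.
    move=> [|[c1 d1] [|b0 r]] //=; rewrite !stepE //= ?stepE /=.
    case: r => [|[c2 d2] r] //=.
    case: ifP => // /andP[/eqP <- /partner_orientation ->] _ _.
    exact: lm_slide_cap.
  + apply: (wrap p [:: (1, Cup c d); (0, Cross x)]
       [:: (0, Cup c d); (1, Cross (flip x))]); first exact: ltnW.
    all: try by rewrite /shift /= ?addn0 ?addn1.
    move=> [|b0 r] //= _ _; exact: lm_slide_cup.
- case=> [p x c d|p x c d|p x|p x y z h] /[dup] /run_head hp.
  + apply: (wrap p [:: (1, Cup c d); (0, Cross x); (1, Cap)] [::]);
      first exact: ltnW.
    all: try by rewrite /shift /= ?addn0 ?addn1.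
    move=> [|[c1 d1] r] //=; rewrite !stepE /= ?stepE /= ?stepE /=.
    case: ifP => // /andP[/eqP -> /partner_orientation E] _ _.
    by rewrite -[d1]negbK -E negbK; apply: lm_RI_right.
  + apply: (wrap p [:: (0, Cup c d); (1, Cross x); (0, Cap)] [::]) => //.
    all: try by rewrite /shift /= ?addn0 ?addn1.
    move=> [|[c1 d1] r] //=; rewrite !stepE /= ?stepE /= ?stepE /=.
    case: ifP => // /andP[/eqP <- /partner_orientation ->] _ _.
    exact: lm_RI_left.
  + apply: (wrap p [:: (0, Cross x); (0, Cross (flip x))] [::]) => //.
    all: try by rewrite /shift /= ?addn0 ?addn1.
    move=> [|a1 [|a2 r]] //=; rewrite ?stepE // => _ _; exact: lm_RII.
  + apply: (wrap p [:: (0, Cross x); (1, Cross y); (0, Cross z)]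
        [:: (1, Cross z); (0, Cross y); (1, Cross x)]) => //.
    all: try by rewrite /shift /= ?addn0 ?addn1.
    move=> [|a1 [|a2 [|a3 r]]] //=; rewrite ?stepE //= ?stepE //= => _ _.
    exact: lm_RIII.
rewrite /extra_move; case: ifPn => hk.
  case=> [p x d hx ho|p x d hx ho] /[dup] /run_head hp.
  + apply: (wrap p [:: (0, Cross x); (1, Cross (flip x)); (0, Cross x)]
       [:: (0, Cross Virtual); (1, Cross Virtual); (0, Cross Virtual)]) => //.
    all: try by rewrite /shift /= ?addn0 ?addn1.
    move=> r _ [l [E F]]; move: ho; rewrite E /orientations drop_size_cat //.
    case: r E => [|[c1 d1] [|[c2 d2] [|[c3 d3] r]]] //= _ [-> -> -> _].
    exact: lm_delta_right.
  + apply: (wrap p [:: (1, Cross x); (0, Cross (flip x)); (1, Cross x)]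
       [:: (1, Cross Virtual); (0, Cross Virtual); (1, Cross Virtual)]);
      first exact: ltnW.
    all: try by rewrite /shift /= ?addn0 ?addn1.
    move=> r _ [l [E F]]; move: ho; rewrite E /orientations drop_size_cat //.
    case: r E => [|[c1 d1] [|[c2 d2] [|[c3 d3] r]]] //= _ [-> -> -> _].
    exact: lm_delta_left.
case=> [p x d d' hx ho] /[dup] /run_head hp.
apply: (wrap p (pass n 0 x) (pass n 0 Virtual)); first exact: ltnW.
all: try by rewrite /shift /= ?addn0 ?addn1 ?addn2.
move=> r _ [l [E F]]; move: ho; rewrite E /orientations drop_size_cat //.
case: r E => [|[c1 d1] [|[c2 d2] [|[c3 d3] [|[c4 d4] r]]]] //= _ [-> -> -> -> _].
exact: lm_pass.
Qed.

End LocalMoves.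

(** * Tangle equivalence *)

Section TangleEquivalence.

Variables (n : nat) (k : bool).
Implicit Types (s r t l : seq (strand n)) (w u v a b : word n) (e f : piece n).

Lemma lmove_run r a b : lmove k r a b ->
  exists t, run r a = Some t /\ run r b = Some t.
Proof.
have neqN (d : bool) : (d != ~~ d) * (~~ d != d) by case: d.
case=> [x y r0 r' q e f hx hf|c d r0|c d r0|c d b0 x r0|c d b0 x r0|c d x r0
  |c d x r0|a0 b0 x r0|a0 b0 c x y z r0 h|a0 b0 c x d r0 hk hx
  |a0 b0 c x d r0 hk hx|a0 b0 c d x o o' r0 hk hx].
- exists (y ++ r'); have [sx sy] := act_size hx.
  have hs r1 : step (x ++ r1) (0, e) = Some (y ++ r1) := step_act [::] r1 hx.
  by rewrite /= !hs /= -sy -sx !step_cat hf /= hs.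
all: rewrite /= ?stepE /= ?stepE /= ?stepE /= ?stepE /= ?eqxx ?neqN /=.
all: by eexists; split.
Qed.

(** Words may start at any level [s], need not close up and need not have one circle per component;
    only the site of the move must be readable. This makes the relation compatible with composition
    on either side. *)
Inductive tstep s : word n -> word n -> Prop :=
  Tstep u v l r a b : run s u = Some (l ++ r) -> lmove k r a b ->
    tstep s (u ++ shift (size l) a ++ v) (u ++ shift (size l) b ++ v).

Definition teq s := clos_refl_sym_trans _ (tstep s).

Lemma tstep_run s w w' : tstep s w w' -> run s w = run s w'.
Proof.
case=> u v l r a b hu /lmove_run[t [ha hb]].
by rewrite !run_cat hu /= !run_cat !run_shift ha hb.
Qed.

Lemma teq_run s w w' : teq s w w' -> run s w = run s w'.
Proof. by elim=> [x y /tstep_run//| |x y _ ->|x y z _ -> _ ->]. Qed.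

Lemma teq_refl s w : teq s w w. Proof. exact: rst_refl. Qed.
Lemma teq_sym s w w' : teq s w w' -> teq s w' w. Proof. exact: rst_sym. Qed.
Lemma teq_trans s w2 w1 w3 : teq s w1 w2 -> teq s w2 w3 -> teq s w1 w3.
Proof. exact: rst_trans. Qed.

Lemma teq_catr s w w' v : teq s w w' -> teq s (w ++ v) (w' ++ v).
Proof.
elim=> [x y []|||] => [u v0 l r a b hu h|x|x y _|x y z _ h1 _ h2].
- by apply: rst_step; rewrite -!catA; apply: Tstep hu h.
- exact: teq_refl.
- exact: teq_sym.
exact: teq_trans h1 h2.
Qed.

Lemma teq_catl s t u w w' : run s u = Some t -> teq t w w' ->
  teq s (u ++ w) (u ++ w').
Proof.
move=> hu; elim=> [x y []|||] => [u0 v0 l r a b hu0 h|x|x y _|x y z _ h1 _ h2].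
- apply: rst_step; rewrite !(catA u); apply: Tstep h.
  by rewrite run_cat hu.
- exact: teq_refl.
- exact: teq_sym.
exact: teq_trans h1 h2.
Qed.

Lemma teq_mid s t u v w w' : run s u = Some t -> teq t w w' ->
  teq s (u ++ w ++ v) (u ++ w' ++ v).
Proof. by move=> hu h; apply: teq_catl hu _; apply: teq_catr. Qed.

Lemma teq_cat s t u u' w w' : run s u = Some t -> teq s u u' -> teq t w w' ->
  teq s (u ++ w) (u' ++ w').
Proof.
move=> hu h1 h2; apply: (teq_trans (teq_catl hu h2)); exact: teq_catr.
Qed.

Lemma teq_shift l r w w' : teq r w w' ->
  teq (l ++ r) (shift (size l) w) (shift (size l) w').
Proof.
elim=> [x y []|||] => [u v0 l0 r0 a b hu h|x|x y _|x y z _ h1 _ h2].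
- rewrite !shift_cat !shift_shift -size_cat; apply: rst_step.
  by apply: Tstep h; rewrite run_shift hu /= catA.
- exact: teq_refl.
- exact: teq_sym.
exact: teq_trans h1 h2.
Qed.

Lemma teq_lmove r a b : lmove k r a b -> teq r a b.
Proof.
move=> h; apply: rst_step.
by have := @Tstep r [::] [::] [::] r a b erefl h; rewrite /= !cats0 !shift0.
Qed.

End TangleEquivalence.

(** * One circle per component *)

Definition map_piece m n (f : 'I_m -> 'I_n) (e : piece m) : piece n :=
  match e with Cup c d => Cup (f c) d | Cap => Cap | Cross x => Cross x end.

Definition map_word m n (f : 'I_m -> 'I_n) (w : word m) : word n :=
  [seq (pe.1, map_piece f pe.2) | pe <- w].

Definition map_level m n (f : 'I_m -> 'I_n) (s : seq (strand m)) :
  seq (strand n) := [seq (f a.1, a.2) | a <- s].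

Section Labels.

Variable n : nat.
Implicit Types (s r t l : seq (strand n)) (w u v a b : word n) (e f : piece n).

Definition labels w : seq 'I_n :=
  pmap (fun pe => if pe.2 is Cup c _ then Some c else None) w.

Lemma labels_cat u v : labels (u ++ v) = labels u ++ labels v.
Proof. exact: pmap_cat. Qed.

Lemma labels_shift j w : labels (shift j w) = labels w.
Proof. by elim: w => //= -[p [c d| |x]] w /= ->. Qed.

Lemma act_labels e s t c : act e s = Some t -> c \in [seq x.1 | x <- t] ->
  c \in [seq x.1 | x <- s] \/ c \in labels [:: (0, e)].
Proof.
case: e => [c0 d| |x]; case: s => [|[c1 d1] [|[c2 d2] []]] //=.
- by case=> <- /=; rewrite !inE orbb; right.
- by case: ifP => // _ [<-].
by case=> <- /=; rewrite !inE orbC; left.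
Qed.

Lemma run_labels s w t c : run s w = Some t -> c \in [seq x.1 | x <- t] ->
  c \in [seq x.1 | x <- s] \/ c \in labels w.
Proof.
elim: w s => [|[p e] w IH] s /=; first by case=> ->; left.
case E: (step s (p, e)) => [s'|] //= h /(IH _ h)[]; last first.
  by case: e E => *; right; rewrite // inE; apply/orP; right.
have [l [x [y [r [-> -> _ hx]]]]] := step_some E.
rewrite !map_cat !mem_cat => /or3P[->||->]; rewrite ?orbT; [by left| |by left].
move=> /(act_labels hx)[->|]; rewrite ?orbT; first by left.
by case: e {E hx} => //= c0 d; rewrite !inE => ->; right.
Qed.

(** The right side of a move has no minimum with a new label. A label lost from the left side
    belongs to a strand entering the site, and so to an earlier minimum: moves between closed words
    keep the set of labels. *)
Lemma lmove_labels k r a b c : lmove k r a b ->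
  (c \in labels b -> c \in labels a) /\
  (c \in labels a -> c \in labels b \/ c \in [seq x.1 | x <- r]).
Proof.
case=> [x y r0 r' q [? ?| |?] [? ?| |?] hx hf|c0 d r0|c0 d r0|c0 d b0 x r0|c0 d b0 x r0|c0 d x r0
  |c0 d x r0|a0 b0 x r0|a0 b0 c0 x y z r0 h|a0 b0 c0 x d r0 hk hx
  |a0 b0 c0 x d r0 hk hx|a0 b0 c0 d x o o' r0 hk hx];
  rewrite /= ?inE; (split; [|]); try by auto.
all: try (by move=> ->; right); try (by rewrite orbC; auto).
Qed.

End Labels.

(** * Lifting moves along a change of labels *)

Section Lifting.

Variables (m n : nat) (g : 'I_m -> 'I_n) (k : bool).
Implicit Types (s r t l : seq (strand m)) (w u v a b : word m) (e f : piece m).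

Lemma map_word_cat u v : map_word g (u ++ v) = map_word g u ++ map_word g v.
Proof. exact: map_cat. Qed.

Lemma map_word_shift j w : map_word g (shift j w) = shift j (map_word g w).
Proof. by rewrite /map_word /shift -!map_comp. Qed.

Lemma map_act e s t : act e s = Some t ->
  act (map_piece g e) (map_level g s) = Some (map_level g t).
Proof.
case: e => [c0 d| |x]; case: s => [|[c1 d1] [|[c2 d2] []]] //=.
- by case=> <-.
- by case: ifP => // /andP[/eqP -> ->] [<-]; rewrite eqxx.
by case=> <-.
Qed.

Lemma map_step s pe t : step s pe = Some t ->
  step (map_level g s) (pe.1, map_piece g pe.2) = Some (map_level g t).
Proof.
case: pe => p e /step_some[l [x [y [r [-> -> <- hx]]]]] /=.
rewrite /map_level !map_cat; have := step_act (map_level g l) (map_level g r) (map_act hx).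
by rewrite size_map.
Qed.

Lemma map_run s w t : run s w = Some t ->
  run (map_level g s) (map_word g w) = Some (map_level g t).
Proof.
elim: w s => [|pe w IH] s /=; first by case=> ->.
by case E: step => [s'|] //= /IH; rewrite (map_step E).
Qed.

Lemma map_word_cons a p (e0 : piece n) (w0 : word n) : map_word g a = (p, e0) :: w0 ->
  exists e a', [/\ a = (p, e) :: a', map_piece g e = e0 & map_word g a' = w0].
Proof. by case: a => // -[q e] a' [<- <- <-]; exists e, a'. Qed.

Lemma map_piece_cup e (c : 'I_n) d : map_piece g e = Cup c d -> exists2 c', e = Cup c' d & g c' = c.
Proof. by case: e => //= c' d' [<- ->]; exists c'. Qed.
Lemma map_piece_cap e : map_piece g e = Cap -> e = Cap.
Proof. by case: e. Qed.
Lemma map_piece_cross e x : map_piece g e = Cross x -> e = Cross x.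
Proof. by case: e => //= y [->]. Qed.
Lemma map_word_nil a : map_word g a = [::] -> a = [::].
Proof. by case: a. Qed.

Lemma map_piece_arity e :
  (inputs (map_piece g e) = inputs e) * (outputs (map_piece g e) = outputs e).
Proof. by case: e. Qed.

Ltac unmap := repeat match goal with
  | H : map_word g _ = _ :: _ |- _ =>
      let e := fresh "e" in let a := fresh "a" in let E := fresh "E" in
      move/map_word_cons: H => [e [a [E]]]; subst; move=> ? ?
  | H : map_word g _ = [::] |- _ => move/map_word_nil: H => H; subst
  | H : map_piece g _ = Cup _ _ |- _ =>
      let c := fresh "c" in move/map_piece_cup: H => [c]; (move=> ? ?); subst
  | H : map_piece g _ = Cap |- _ => move/map_piece_cap: H => H; subst
  | H : map_piece g _ = Cross _ |- _ => move/map_piece_cross: H => H; subst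
  end.

(** The minima on the right side of a move all occur on its left side, so their finer labels are
    already chosen. *)
Lemma lift_forward s a (b0 : word n) : any_move k (map_level g s) (map_word g a) b0 ->
  exists b, map_word g b = b0 /\ any_move k s a b.
Proof.
have orE p q : orientations (map_level g s) p q = orientations s p q.
  by rewrite /orientations /map_level -map_drop -map_take -map_comp.
move E: (map_word g a) => a0; case=> [h|[h|h]].
- case: h E => [p q e f|p c d|p c d|p x|p x c d] E; unmap.
  + exists [:: (p + inputs e0 + q, e1); (p, e0)]; split.
      by rewrite /= !map_piece_arity.
    by left; rewrite !map_piece_arity; constructor.
  + by exists [::]; split=> //; left; constructor.
  + by exists [::]; split=> //; left; constructor.
  + exists [:: (p.+1, Cross (flip x)); (p, Cap)]; split=> //.
    by left; constructor.
  + exists [:: (p, Cup c0 d); (p.+1, Cross (flip x))]; split=> //.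
    by left; constructor.
- case: h E => [p x c d|p x c d|p x|p x y z h] E; unmap.
  + by exists [::]; split=> //; right; left; constructor.
  + by exists [::]; split=> //; right; left; constructor.
  + by exists [::]; split=> //; right; left; constructor.
  + exists [:: (p.+1, Cross z); (p, Cross y); (p.+1, Cross x)]; split=> //.
    by right; left; constructor.
move: h; rewrite /any_move /extra_move; case: k => h.
  case: h E => [p x d hx|p x d hx]; rewrite orE => ho E; unmap.
  + eexists; split; last by right; right; apply: vdelta_right ho.
    by [].
  + eexists; split; last by right; right; apply: vdelta_left ho.
    by [].
case: h E => p x d d' hx; rewrite orE => ho E.
rewrite /pass in E; unmap; exists (pass m p Virtual); split=> //.
by right; right; apply: vpass_intro ho.
Qed.


Lemma map_level_cons r (a : strand n) (r0 : seq (strand n)) :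
  map_level g r = a :: r0 ->
  exists c d r', [/\ r = (c, d) :: r', g c = a.1, d = a.2 & map_level g r' = r0].
Proof. by case: r => // -[c d] r' [<- <-]; exists c, d, r'. Qed.

Lemma map_level_size r : size (map_level g r) = size r.
Proof. exact: size_map. Qed.

Ltac unlevel H c d r Hc := move/map_level_cons: H => [c [d [r [? /= Hc ? H]]]]; subst.

(** In this direction zigzags and kinks create minima, which take the finer label of the strand
    running through the site. Readability of [b] is needed where a maximum must join two strands
    with the same finer label, not merely the same image under [g]. *)
Lemma lift_backward (r0 : seq (strand n)) (a0 b0 : word n) r b :
  lmove k r0 a0 b0 -> r0 = map_level g r -> b0 = map_word g b -> run r b <> None ->
  exists a, map_word g a = a0 /\ lmove k r a b.
Proof.
case=> [x y r1 r' q e f hx hf|c d r1|c d r1|c d b1 x r1|c d b1 x r1|c d x r1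
  |c d x r1|a1 b1 x r1|a1 b1 c x y z r1 h|a1 b1 c x d r1 hk hx
  |a1 b1 c x d r1 hk hx|a1 b1 c d x o o' r1 hk hx] /esym Er /esym Eb hrun.
- unmap; rewrite !map_piece_arity in hf hx *.
  exists [:: (0, e1); (outputs e1 + q, e0)]; split=> //.
  have [sx _] := act_size hx; rewrite map_piece_arity in sx.
  have sr : inputs e1 <= size r.
    by rewrite -(map_level_size r) Er size_cat sx leq_addr.
  move: hrun; rewrite /= map_piece_arity.
  rewrite -{1 2}[r](cat_take_drop (inputs e1)).
  set x' := take _ r; set r'' := drop _ r.
  have sx' : size x' = inputs e1 by rewrite size_takel.
  rewrite -sx' step_cat; case F: (step r'' (q, e0)) => [r3|] //=.
  case G: (step _ (0, e1)) => [t|] //= _.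
  have [l [x2 [y2 [r4 [E2 _ /size0nil El hx2]]]]] := step_some G.
  move: E2; rewrite El /= => /eqP; rewrite eqseq_cat; last first.
    by rewrite sx' (act_size hx2).1.
  case/andP => /eqP Ex _; rewrite -Ex in hx2; rewrite sx'.
  exact: lm_exchange hx2 F.
all: unlevel Er c' d' r2 Hc.
- unmap; exists [:: (0, Cup c' d); (1, Cap)]; split=> //; constructor.
- unmap; exists [:: (1, Cup c' d); (0, Cap)]; split=> //; constructor.
- unlevel Er c2 d2 r3 Hc2; unlevel Er c3 d3 r4 Hc3; unmap.
  exists [:: (0, Cross x); (1, Cap)]; split=> //.
  move: hrun; rewrite /= !stepE /= ?stepE /=; case: eqP => //= -> _; constructor.
- unmap; exists [:: (1, Cup c0 d); (0, Cross x)]; split=> //; constructor.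
- unmap; exists [:: (1, Cup c' d); (0, Cross x); (1, Cap)]; split=> //; constructor.
- unmap; exists [:: (0, Cup c' d); (1, Cross x); (0, Cap)]; split=> //; constructor.
- unlevel Er c2 d2 r3 Hc2; unmap.
  exists [:: (0, Cross x); (0, Cross (flip x))]; split=> //; constructor.
- unlevel Er c2 d2 r3 Hc2; unlevel Er c3 d3 r4 Hc3; unmap.
  exists [:: (0, Cross x); (1, Cross y); (0, Cross z)]; split=> //.
  by constructor.
- unlevel Er c2 d2 r3 Hc2; unlevel Er c3 d3 r4 Hc3; unmap.
  exists [:: (0, Cross x); (1, Cross (flip x)); (0, Cross x)]; split=> //.
  by constructor.
- unlevel Er c2 d2 r3 Hc2; unlevel Er c3 d3 r4 Hc3; unmap.
  exists [:: (1, Cross x); (0, Cross (flip x)); (1, Cross x)]; split=> //.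
  by constructor.
- unlevel Er c2 d2 r3 Hc2; unlevel Er c3 d3 r4 Hc3; unlevel Er c4 d4 r5 Hc4.
  rewrite /pass in Eb; unmap; exists (pass m 0 x); split=> //.
  by constructor.
Qed.

End Lifting.

Section LabelPositions.

Variable n : nat.
Implicit Types (s r t l : seq (strand n)) (w u v : word n) (e f : piece n).

(** Says that each label occupies at most one circle, without speaking of points: no finer
    consistent labelling separates two minima with the same label. In this form the property passes
    through moves by lifting. *)
Definition conn w : Prop := forall m (g : 'I_m -> 'I_n) (w' : word m),
  map_word g w' = w -> run [::] w' = Some [::] -> {in labels w' &, injective g}.

Lemma map_word_cat_inv m (g : 'I_m -> 'I_n) (w' : word m) u v :
  map_word g w' = u ++ v ->
  exists u' v' : word m, [/\ w' = u' ++ v', map_word g u' = u & map_word g v' = v].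
Proof.
move=> E; exists (take (size u) w'), (drop (size u) w').
by rewrite cat_take_drop /map_word map_take map_drop -/(map_word g w') E
  take_size_cat // drop_size_cat.
Qed.

Lemma map_level_cat_inv m (g : 'I_m -> 'I_n) (s' : seq (strand m)) l r :
  map_level g s' = l ++ r ->
  exists l' r' : seq (strand m), [/\ s' = l' ++ r', map_level g l' = l & map_level g r' = r].
Proof.
move=> E; exists (take (size l) s'), (drop (size l) s').
by rewrite cat_take_drop /map_level map_take map_drop -/(map_level g s') E
  take_size_cat // drop_size_cat.
Qed.

Lemma map_word_shift_inv m (g : 'I_m -> 'I_n) (w' : word m) j (b : word n) :
  map_word g w' = shift j b ->
  exists2 b' : word m, w' = shift j b' & map_word g b' = b.
Proof.
elim: b w' => [|[p e] b IH] [|[p' e'] w'] //=; first by exists [::].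
case=> -> He /IH[b' -> <-]; exists ((p, e') :: b') => //=.
by rewrite He.
Qed.

Lemma any_move_tstep k s u l r v (a b : word n) :
  any_move k r a b -> run r a <> None -> run s u = Some (l ++ r) ->
  tstep k s (u ++ shift (size l) a ++ v) (u ++ shift (size l) b ++ v).
Proof.
move=> hm ha hu; have [l1 [r1 [a1 [b1 [Er -> -> h]]]]] := lmove_any_move hm ha.
rewrite !shift_shift -size_cat; apply: Tstep h; by rewrite hu Er catA.
Qed.

Lemma tstep_labels k w w' c :
  tstep k [::] w w' -> (c \in labels w) = (c \in labels w').
Proof.
case=> u v l r a b hu h; have [h1 h2] := lmove_labels c h.
rewrite !labels_cat !labels_shift !mem_cat.
apply/idP/idP => /or3P[->//|/[dup] hc|->]; rewrite ?orbT //; last first.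
  by move=> /h1->; rewrite orbT.
case/h2 => [->|hr]; rewrite ?orbT //.
have [|//|->//] := @run_labels _ _ _ _ c hu.
by rewrite map_cat mem_cat hr orbT.
Qed.

Lemma run_onth s w t k p e : run s w = Some t -> onth w k = Some (p, e) ->
  exists l x y r, [/\ run s (take k w) = Some (l ++ x ++ r),
    run s (take k.+1 w) = Some (l ++ y ++ r), size l = p & act e x = Some y].
Proof.
elim: w s k => [|[p' e'] w IH] s [|k] //=.
- case E: (step s _) => [s'|] //= _ [Ep Ee]; subst.
  have [l [x [y [r [-> -> hl hx]]]]] := step_some E.
  by rewrite take0; exists l, x, y, r.
by case E: (step s _) => [s'|] //=; apply: IH.
Qed.

Lemma labelsP w c : reflect (exists k p d, onth w k = Some (p, Cup c d)) (c \in labels w).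
Proof.
elim: w => [|[p e] w IH] /=; first by constructor=> -[[|k] [? []]].
case: e => [c' d| |x] /=; last first.
- by apply: (iffP IH) => [[k [p' [d h]]]|[[|k] [p' [d h]]]] //;
   [exists k.+1, p', d | exists k, p', d].
- by apply: (iffP IH) => [[k [p' [d h]]]|[[|k] [p' [d h]]]] //;
   [exists k.+1, p', d | exists k, p', d].
rewrite inE; apply: (iffP orP) => [[/eqP->|/IH[k [p' [d' h]]]]|].
- by exists 0, p, d.
- by exists k.+1, p', d'.
case=> -[|k] [p' [d' h]]; first by left; case: h => _ ->.
by right; apply/IH; exists k, p', d'.
Qed.

Lemma onth_cup_label w k p c d : run [::] w = Some [::] ->
  onth w k = Some (p, Cup c d) -> onth (strands (take k.+1 w)) p = Some (c, d).
Proof.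
move=> hw /(run_onth hw)[l [x [y [r [_ h2 hl hx]]]]].
rewrite /strands h2 /= onth_cat -hl ltnn subnn.
by case: x hx => //= -[<-].
Qed.

Lemma onth_mapE (T U : Type) (g : T -> U) (s : seq T) i :
  onth (map g s) i = omap g (onth s i).
Proof. by elim: s i => [|x s IH] [|i] /=. Qed.

End LabelPositions.

(** * Moves preserve the condition of one circle per component *)

Section Connectivity.

Variable n : nat.
Implicit Types (s r t l : seq (strand n)) (w u v : word n) (e f : piece n).

Lemma tstep_lift_backward k m (g : 'I_m -> 'I_n) w w1 (w1' : word m) :
  tstep k [::] w w1 -> map_word g w1' = w1 -> run [::] w1' <> None ->
  exists2 w' : word m, map_word g w' = w & tstep k [::] w' w1'.
Proof.
case=> u v l r a b hu h /map_word_cat_inv[u' [v0 [-> Eu]]].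
case/map_word_cat_inv => [b0 [v' [-> /map_word_shift_inv[b' -> Eb] Ev]]].
rewrite run_cat; case hu': (run [::] u') => [t'|] //=.
have := map_run g hu'; rewrite Eu hu => -[/esym].
case/map_level_cat_inv => l' [r' [Et El Er]] ; subst t'.
have sl : size l = size l' by rewrite -El map_level_size.
rewrite run_cat sl run_shift; case hb': (run r' b') => [t1|] //= _.
have [|a' [Ea h']] := lift_backward h (esym Er) (esym Eb); first by rewrite hb'.
exists (u' ++ shift (size l') a' ++ v'); last exact: Tstep h'.
by rewrite !map_word_cat map_word_shift Eu Ea Ev.
Qed.

Lemma tstep_lift_forward k m (g : 'I_m -> 'I_n) w w1 (w' : word m) :
  tstep k [::] w w1 -> map_word g w' = w -> run [::] w' <> None ->
  exists2 w1' : word m, map_word g w1' = w1 & tstep k [::] w' w1'.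
Proof.
case=> u v l r a b hu h /map_word_cat_inv[u' [v0 [-> Eu]]].
case/map_word_cat_inv => [a0 [v' [-> /map_word_shift_inv[a' -> Ea] Ev]]].
rewrite run_cat; case hu': (run [::] u') => [t'|] //=.
have := map_run g hu'; rewrite Eu hu => -[/esym].
case/map_level_cat_inv => l' [r' [Et El Er]] ; subst t'.
have sl : size l = size l' by rewrite -El map_level_size.
rewrite run_cat sl run_shift; case ha': (run r' a') => [t1|] //= _.
have [|b' [Eb h']] := @lift_forward _ _ g k r' a' b.
  by have := any_move_lmove [::] h; rewrite /= !shift0 Er Ea.
exists (u' ++ shift (size l') b' ++ v').
  by rewrite !map_word_cat map_word_shift Eu Eb Ev.
by apply: any_move_tstep h' _ hu'; rewrite ha'.
Qed.

(** A refinement of one word is carried by the lifted move to a refinement of the other with the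
    same labels, so a refinement that separates two minima exists for both words or for neither. *)
Lemma tstep_conn k w w1 : run [::] w = Some [::] -> tstep k [::] w w1 ->
  conn w <-> conn w1.
Proof.
move=> hw h; have hw1 := hw; rewrite (tstep_run h) in hw1.
split=> hc m g w' Ew hr.
- have [|w0 E0 h0] := tstep_lift_backward h Ew; first by rewrite hr.
  have hi := hc _ _ _ E0; rewrite (tstep_run h0) in hi.
  by move=> x y hx hy; apply: (hi hr); rewrite (tstep_labels _ h0).
have [|w0 E0 h0] := tstep_lift_forward h Ew; first by rewrite hr.
have hi := hc _ _ _ E0; rewrite -(tstep_run h0) in hi.
by move=> x y hx hy; apply: (hi hr); rewrite -(tstep_labels _ h0).
Qed.

Lemma joined_label m (g : 'I_m -> 'I_n) (w' : word m) x y :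
  run [::] w' = Some [::] -> joined (map_word g w') x y ->
  onth [seq a.1 | a <- strands (take x.1 w')] x.2 =
  onth [seq a.1 | a <- strands (take y.1 w')] y.2.
Proof.
have onth_inv (w1 : word m) k p e : onth (map_word g w1) k = Some (p, e) ->
    exists2 e', onth w1 k = Some (p, e') & e = map_piece g e'.
  elim: w1 k => [|[p' e'] w1 IH] [|k] //=; last exact: IH.
  by case=> <- <-; exists e'.
have onth_addn (T : Type) (s1 s2 : seq T) i :
    onth (s1 ++ s2) (size s1 + i) = onth s2 i.
  by rewrite onth_cat ltnNge leq_addr addKn.
have onth0 (T : Type) (s1 s2 : seq T) : onth (s1 ++ s2) (size s1) = onth s2 0.
  by rewrite -(onth_addn _ s1 s2 0) addn0.
have onth1 (T : Type) (s1 s2 : seq T) : onth (s1 ++ s2) (size s1).+1 = onth s2 1.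
  by rewrite -(onth_addn _ s1 s2 1) addn1.
move=> hw; case=> [k p e q|k p e q|k p c d|k p|k p z|k p z] /onth_inv[e' he' Ee].
all: have [l [x0 [y0 [r [h1 h2 hl hx]]]]] := run_onth hw he'.
all: rewrite /strands ![(_, _).1]/= ![(_, _).2]/= ?h1 ?h2 ![odflt _ _]/= -hl; have [sx sy] := act_size hx.
- by move=> hq; rewrite !map_cat !onth_cat !size_map hq.
- rewrite Ee !map_piece_arity -sx -sy !map_cat -!addnA.
  by rewrite -!(size_map fst) !onth_addn.
all: rewrite !map_cat -!(size_map fst l) onth0 onth1.
all: case: e' Ee hx {he' sx sy} => //; clear h1.
- by move=> c' d' _; case: x0 => // -[<-].
- move=> _; case: x0 => [|[c1 d1] [|[c2 d2] []]] //=.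
  by case: ifP => // /andP[/eqP<- _] _.
- by move=> z' _; case: x0 => [|c1 [|c2 []]] //= [<-].
by move=> z' _; case: x0 => [|c1 [|c2 []]] //= [<-].
Qed.

Lemma map_strands m (g : 'I_m -> 'I_n) (w' : word m) k (t : seq (strand m)) :
  run [::] w' = Some t ->
  strands (take k (map_word g w')) = map_level g (strands (take k w')).
Proof.
move=> h; rewrite /strands /map_word -map_take -/(map_word g _).
move: h; rewrite -{1}(cat_take_drop k w') run_cat.
by case E: (run _ (take k w')) => [t1|] //= _; rewrite (map_run g E).
Qed.

(** A finer label is constant along joined points, hence along the single circle of each
    component. *)
Lemma is_diagram_conn w : is_diagram w -> conn w.
Proof.
case=> hw hD m g w' E hw' c1 c2 /labelsP[k1 [p1 [d1 h1]]] /labelsP[k2 [p2 [d2 h2]]] Eg.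
have o1 := onth_cup_label hw' h1; have o2 := onth_cup_label hw' h2.
have a1 : on_component w (g c1) (k1.+1, p1).
  by exists d1; rewrite /= -E (map_strands _ _ hw') onth_mapE o1.
have a2 : on_component w (g c1) (k2.+1, p2).
  by exists d2; rewrite /= -E (map_strands _ _ hw') onth_mapE o2 /= Eg.
have joined_clos x y : clos_refl_sym_trans _ (joined w) x y ->
    onth [seq a.1 | a <- strands (take x.1 w')] x.2 =
    onth [seq a.1 | a <- strands (take y.1 w')] y.2.
  elim=> [x1 y1|//|x1 y1 _ ->//|x1 y1 z1 _ -> _ ->//].
  by rewrite -E; apply: joined_label.
by move/joined_clos: ((hD (g c1)).2 _ _ a1 a2); rewrite !onth_mapE o1 o2 => -[].
Qed.

(** * Splitting a component that has several circles *)

Section Recolouring.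

Variables (w : word n) (i : 'I_n) (B : nat * nat -> bool).
Hypothesis hw : run [::] w = Some [::].
Hypothesis hB : forall x y, joined w x y -> B x = B y.

(** If a set [B] of points is closed under joining, the part of component [i] inside [B] can receive
    the additional label [ord_max]. Merging that label with [i] recovers the given word. *)
Definition merge_colours (c : 'I_n.+1) : 'I_n := odflt i (unlift ord_max c).

Definition colour (x : nat * nat) (c : 'I_n) : 'I_n.+1 :=
  if B x && (c == i) then ord_max else lift ord_max c.

Lemma merge_colour x c : merge_colours (colour x c) = c.
Proof.
by rewrite /merge_colours /colour; case: ifP => [/andP[_ /eqP->]|_];
  rewrite ?unlift_none ?liftK.
Qed.

(** The colour of a minimum is read at its left leg, which lies in the level above the piece, whence
    [j.+1]; the right leg has the same colour because the legs are joined. *)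
Definition colour_piece j p e : piece n.+1 :=
  match e with
  | Cup c d => Cup (colour (j.+1, p) c) d
  | Cap => Cap
  | Cross x => Cross x
  end.

Fixpoint colour_word j v : word n.+1 :=
  if v is (p, e) :: v' then (p, colour_piece j p e) :: colour_word j.+1 v'
  else [::].

Fixpoint colour_level j q s : seq (strand n.+1) :=
  if s is a :: s' then (colour (j, q) a.1, a.2) :: colour_level j q.+1 s'
  else [::].

Lemma map_colour_word j v : map_word merge_colours (colour_word j v) = v.
Proof.
elim: v j => // -[p e] v IH j; congr (_ :: _); last exact: IH.
by case: e => //= c d; rewrite merge_colour.
Qed.

Lemma onth_colour_word j v k p e : onth v k = Some (p, e) ->
  onth (colour_word j v) k = Some (p, colour_piece (j + k) p e).
Proof.
elim: v j k => [|[p' e'] v IH] j [|k] //=.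
  by case=> -> ->; rewrite addn0.
by move/IH->; rewrite addSnnS.
Qed.

Lemma colour_level_cat j q s t :
  colour_level j q (s ++ t) = colour_level j q s ++ colour_level j (q + size s) t.
Proof. by elim: s q => [|a s IH] q /=; rewrite ?addn0 // IH addSnnS. Qed.

Lemma eq_colour_level j j' q q' s :
  (forall h, h < size s -> B (j, q + h) = B (j', q' + h)) ->
  colour_level j q s = colour_level j' q' s.
Proof.
elim: s q q' => //= a s IH q q' H; rewrite (IH q.+1 q'.+1); last first.
  by move=> h hh; rewrite !addSnnS; apply: H.
by have := H 0 isT; rewrite !addn0 /colour => ->.
Qed.

Lemma onth_colour_level j q s h a : onth s h = Some a ->
  onth (colour_level j q s) h = Some (colour (j, q + h) a.1, a.2).
Proof.
elim: s q h => [|b s IH] q [|h] //=; first by case=> ->; rewrite addn0.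
by move/IH->; rewrite addSnnS.
Qed.

Lemma size_colour_level j q s : size (colour_level j q s) = size s.
Proof. by elim: s q => //= a s IH q; rewrite IH. Qed.

Lemma take_onth (T : Type) (v : seq T) k x : onth v k = Some x ->
  take k.+1 v = rcons (take k v) x.
Proof. by elim: v k => [|y v IH] [|k] //=; [case=> ->; rewrite take0|move/IH->]. Qed.

Lemma colour_run k : k <= size w ->
  run [::] (take k (colour_word 0 w)) = Some (colour_level k 0 (strands (take k w))).
Proof.
elim: k => [|k IH] hk; first by rewrite !take0.
case E: (onth w k) => [[p e]|]; last by move: hk; rewrite -onthTE E.
have E' := onth_colour_word 0 E; rewrite (take_onth E') -cats1 run_cat IH ?(ltnW hk) //=.
have [l [x [y [r [h1 h2 hl hx]]]]] := run_onth hw E.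
rewrite /strands h1 h2 /= !colour_level_cat add0n.
have -> : colour_level k 0 l = colour_level k.+1 0 l.
  apply: eq_colour_level => h hh; apply: hB; apply: joined_left E _.
  by rewrite -hl.
have [sx sy] := act_size hx.
have -> : colour_level k (size l + size x) r = colour_level k.+1 (size l + size y) r.
  apply: eq_colour_level => h hh; apply: hB; rewrite sx sy hl.
  exact: joined_right E.
have hx' : act (colour_piece (0 + k) p e) (colour_level k (size l) x) =
    Some (colour_level k.+1 (size l) y).
  rewrite hl add0n; case: e E hx {E' sx sy h1 h2} => [c d| |z] E.
  - case: x => // -[<-] /=; congr (Some [:: _; (_, _)]).
    by rewrite /colour (hB (joined_cup E)).
  - case: x => [|[c1 d1] [|[c2 d2] []]] //=.
    case: ifP => // /andP[/eqP <- hd] [<-].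
    by rewrite /colour (hB (joined_cap E)) eqxx hd.
  - case: x => [|[c1 d1] [|[c2 d2] []]] //= [<-] /=.
    by rewrite /colour (hB (joined_cross_up E)) (hB (joined_cross_down E)).
have := step_act (colour_level k.+1 0 l) (colour_level k.+1 (size l + size y) r) hx'.
by rewrite size_colour_level -hl => ->.
Qed.

End Recolouring.

(** Take for [B] the points joined to [x0]. If [y0] were outside, recolouring would give two labels
    above [i], both carried by minima since every strand of a closed word starts at one; this
    contradicts [conn]. *)
Lemma conn_is_diagram w : run [::] w = Some [::] -> (forall i, i \in labels w) ->
  conn w -> is_diagram w.
Proof.
move=> hw hl hc; split=> // i; split.
  have /labelsP[k [p [d h]]] := hl i.
  by exists (k.+1, p), d; rewrite /= (onth_cup_label hw h).
move=> x0 y0 [dx hx] [dy hy].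
pose P := clos_refl_sym_trans _ (joined w) x0.
pose B z : bool := excluded_middle_informative (P z).
have BP z : reflect (P z) (B z).
  by rewrite /B; case: excluded_middle_informative => h; constructor.
have hB x y : joined w x y -> B x = B y.
  move=> h; apply/BP/BP => hP.
    by apply: rst_trans hP _; apply: rst_step.
  by apply: rst_trans hP _; apply: rst_sym; apply: rst_step.
apply/BP; case: (boolP (B y0)) => // hBy.
have lab z c d : onth (strands (take z.1 w)) z.2 = Some (c, d) ->
    colour i B z c \in labels (colour_word i B 0 w).
  case: z => k q /= hz.
  have [hk|hk] := leqP (size w) k.
    by move: hz; rewrite take_oversize // /strands hw /= onth0n.
  have hr := colour_run i hw hB (ltnW hk).
  have := onth_colour_level i B k 0 hz; rewrite add0n => ho.
  have hin : colour i B (k, q) c \in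
      [seq a.1 | a <- colour_level i B k 0 (strands (take k w))].
    apply/mapP; exists (colour i B (k, q) c, d) => //.
    rewrite /= in ho; rewrite -(@onth_nth _ (colour i B (k, q) c, d) _ _ _ ho) mem_nth //.
    by rewrite -onthTE ho.
  rewrite -(cat_take_drop k (colour_word i B 0 w)) labels_cat mem_cat.
  by case: (run_labels hr hin) => // ->.
have E := map_colour_word i B 0 w.
have hr : run [::] (colour_word i B 0 w) = Some [::].
  have := colour_run i hw hB (leqnn _); rewrite take_size /strands hw /=.
  suff <- : size (colour_word i B 0 w) = size w by rewrite take_size.
  by rewrite -{2}E size_map.
have := hc _ _ _ E hr _ _ (lab _ _ _ hx) (lab _ _ _ hy).
rewrite !merge_colour /colour eqxx (negbTE hBy) => /(_ erefl).
have -> : B x0 by apply/BP; apply: rst_refl.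
by move/eqP; rewrite (negbTE (neq_lift _ _)).
Qed.

End Connectivity.

(** * From words back to diagrams *)

Section Diagrams.

Variables (n : nat) (k : bool).
Implicit Types (s r t l : seq (strand n)) (w u v : word n) (D E : diagram n).

Definition diagram_move D E : Prop :=
  performs (@extra_move n k) D E \/ generalized_reidemeister D E.

Lemma is_diagramP w : is_diagram w <->
  [/\ run [::] w = Some [::], forall i, i \in labels w & conn w].
Proof.
split=> [h|[]]; last exact: conn_is_diagram.
split; [by case: h| |exact: is_diagram_conn].
case: h => hw hD i; have [[[j q] [d /= hx]] _] := hD i.
move: hx; rewrite /strands; case E: (run [::] (take j w)) => [t|]; last first.
  by rewrite onth0n.
move=> /= ho; rewrite -(cat_take_drop j w) labels_cat mem_cat.
have [||->//] := @run_labels _ _ _ _ i E; last by [].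
apply/mapP; exists (i, d) => //.
by rewrite -(@onth_nth _ (i, d) _ _ _ ho) mem_nth // -onthTE ho.
Qed.

Lemma tstep_is_diagram w w' : tstep k [::] w w' -> is_diagram w <-> is_diagram w'.
Proof.
move=> h; have er := tstep_run h; have el c := tstep_labels c h.
split=> /is_diagramP[h1 h2 h3]; apply/is_diagramP; split.
- by rewrite -er.
- by move=> i; rewrite -el.
- exact/(tstep_conn h1 h).
- by rewrite er.
- by move=> i; rewrite el.
- by apply/(tstep_conn _ h) => //; rewrite er.
Qed.

Lemma tstep_diagram_move D E : tstep k [::] D E -> diagram_move D E.
Proof.
case: D E => [w hw] [w' hw'] /= h.
have : exists u v a b, [/\ w = u ++ a ++ v, w' = u ++ b ++ v & any_move k (strands u) a b].
  case: h => u v l r a b hu h; exists u, v, (shift (size l) a), (shift (size l) b).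
  by split=> //; rewrite /strands hu; apply: any_move_lmove.
case=> u [v [a [b [E1 E2 [|[|]] hm]]]].
- by right; left; exists u, a, b, v.
- by right; right; exists u, a, b, v.
- by left; exists u, a, b, v.
Qed.

(** Being a diagram is invariant under each single move, so every intermediate word of a chain is a
    diagram and the chain lifts. Diagrams with the same word are identified by proof irrelevance. *)
Lemma teq_diagram w w' : teq k [::] w w' ->
  (is_diagram w <-> is_diagram w') /\
  (forall D E, diagram_word D = w -> diagram_word E = w' ->
     clos_refl_sym_trans _ diagram_move D E).
Proof.
elim=> [x y h|x|x y _ [h1 h2]|x y z _ [h1 h2] _ [h3 h4]].
- split; first exact: tstep_is_diagram.
  move=> D E hD hE; apply: rst_step; apply: tstep_diagram_move.
  by rewrite hD hE.
- split=> // -[w1 p1] [w2 p2] /= E1 E2; subst w1; subst w2.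
  by rewrite (proof_irrelevance _ p1 p2); apply: rst_refl.
- by split=> [|D E hD hE]; [split=> /h1 | apply: rst_sym; apply: h2].
split=> [|D E hD hE]; first by split=> [/h1 /h3|/h3 /h1].
have hy : is_diagram y by apply/h1; rewrite -hD; apply: diagramP.
apply: (@rst_trans _ _ _ (Diagram hy)); [exact: h2 | exact: h4].
Qed.

End Diagrams.

(** * Intersection numbers as sums over crossings *)

Section Lambda.

Import GRing.Theory.
Local Open Scope ring_scope.

Variables (n : nat) (i : 'I_n).
Implicit Types (s r t l : seq (strand n)) (w u v : word n) (D E : diagram n).

Definition direction (d : bool) : int := if d then 1 else -1.

Lemma directionN d : direction (~~ d) = - direction d.
Proof. by case: d; rewrite ?opprK. Qed.

(** The contribution of a crossing to the intersection number of [i]. For [Over] it is the sign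
    times (under minus over); for [Under] both factors are negated, so the two formulas coincide. *)
Definition crossing_index x (a b : strand n) : int :=
  if is_real x then direction a.2 * direction b.2 * ((b.1 == i)%:Z - (a.1 == i)%:Z)
  else 0.

Definition piece_index s (pe : nat * piece n) : int :=
  match pe.2, drop pe.1 s with
  | Cross x, [:: a, b & _] => crossing_index x a b
  | _, _ => 0
  end.

Fixpoint word_index s w : int :=
  if w is pe :: w' then piece_index s pe + word_index (odflt [::] (step s pe)) w'
  else 0.

Lemma piece_index_cat l r p e :
  piece_index (l ++ r) ((size l + p)%N, e) = piece_index r (p, e).
Proof.
rewrite /piece_index /= drop_cat ltnNge leq_addr /=.
by rewrite addKn.
Qed.

Lemma word_index_cat s t u v : run s u = Some t ->
  word_index s (u ++ v) = word_index s u + word_index t v.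
Proof.
elim: u s => [|pe u IH] s /=; first by case=> ->; rewrite add0r.
by case: (step s pe) => //= s' /IH ->; rewrite addrA.
Qed.

Lemma word_index_shift l r w : run r w <> None ->
  word_index (l ++ r) (shift (size l) w) = word_index r w.
Proof.
elim: w r => //= -[p e] w IH r; rewrite piece_index_cat step_cat.
by case: (step r (p, e)) => //= t /IH ->.
Qed.

Lemma piece_index0 r e : piece_index r (0%N, e) =
  if e is Cross x then if r is [:: a, b & _] then crossing_index x a b else 0 else 0.
Proof. by rewrite /piece_index drop0; case: e. Qed.

Lemma piece_indexS a r p e : piece_index (a :: r) (p.+1, e) = piece_index r (p, e).
Proof. by []. Qed.

Lemma is_real_flip x : is_real (flip x) = is_real x. Proof. by case: x. Qed.

Lemma piece_index_left x r r' (e : piece n) : size x = inputs e ->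
  piece_index (x ++ r) (0%N, e) = piece_index (x ++ r') (0%N, e).
Proof.
rewrite !piece_index0; case: e => //= z.
by case: x => [|a [|b []]].
Qed.

(** A kink involves a single component and contributes 0, and the two crossings of a type II move
    cancel. In the two extra moves each strand at the site meets two antiparallel strands, so its
    two contributions cancel. The other moves keep the list of real crossings up to order. *)
Lemma lmove_index k r a b : lmove k r a b -> word_index r a = word_index r b.
Proof.
case=> [x y r0 r' q e f hx hf|c d r0|c d r0|c d b0 x r0|c d b0 x r0|c d x r0
  |c d x r0|a0 b0 x r0|a0 b0 c x y z r0 h|a0 b0 c x d r0 hk hx
  |a0 b0 c x d r0 hk hx|a0 b0 c d x o o' r0 hk hx].
- have [sx sy] := act_size hx.
  have hs r1 : step (x ++ r1) (0%N, e) = Some (y ++ r1) := step_act [::] r1 hx.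
  rewrite /= !hs /= -sy -sx !piece_index_cat !step_cat hf /=.
  by rewrite (piece_index_left r0 r' sx) !addr0 addrC.
all: rewrite /word_index /= ?stepE /= ?stepE /= ?stepE /= ?stepE /= ?piece_indexS ?piece_index0 ?piece_indexS ?piece_index0 //=.
all: rewrite ?add0r ?addr0.
all: try by [].
all: rewrite /crossing_index ?is_real_flip ?hx /= ?eqxx ?directionN.
all: try by case: (is_real _) => //; ring.
Qed.

Lemma tstep_index k s w w' : tstep k s w w' -> word_index s w = word_index s w'.
Proof.
case=> u v l r a b hu h; have [t [ha hb]] := lmove_run h.
have ea : run (l ++ r) (shift (size l) a) = Some (l ++ t) by rewrite run_shift ha.
have eb : run (l ++ r) (shift (size l) b) = Some (l ++ t) by rewrite run_shift hb.
rewrite !(word_index_cat _ hu) (word_index_cat _ ea) (word_index_cat _ eb).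
by rewrite !word_index_shift ?ha ?hb // (lmove_index h).
Qed.

Lemma teq_index k s w w' : teq k s w w' -> word_index s w = word_index s w'.
Proof. by elim=> [x y /tstep_index|x|x y _ ->|x y z _ -> _ ->]. Qed.

Lemma diagram_move_index k D E : diagram_move k D E -> word_index [::] D = word_index [::] E.
Proof.
move=> h; have : exists u a b v, [/\ diagram_word D = u ++ a ++ v,
    diagram_word E = u ++ b ++ v & any_move k (strands u) a b].
  case: h => [|[]] [u [a [b [v [h1 h2 h3]]]]]; exists u, a, b, v; split=> //.
  - by right; right.
  - by left.
  - by right; left.
case=> u [a [b [v [h1 h2 h3]]]].
have [hD _] := diagramP D; rewrite h1 run_cat in hD.
case hu: (run [::] u) hD => [t|] //=; rewrite run_cat /= => hD.
have ha : run t a <> None by case: (run t a) hD.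
have := @any_move_tstep n k [::] u [::] t v a b; rewrite !shift0 /=.
rewrite /strands hu /= in h3; move/(_ h3 ha hu)/tstep_index.
by rewrite h1 h2.
Qed.

Lemma diagram_moves_index k D E :
  clos_refl_sym_trans _ (diagram_move k) D E -> word_index [::] D = word_index [::] E.
Proof. by elim=> [x y /diagram_move_index|x|x y _ ->|x y z _ -> _ ->]. Qed.

Lemma word_indexE s w : word_index s w =
  \sum_(j < size w) piece_index (odflt [::] (run s (take j w))) (nth (0%N, Cap) w j)
  \/ run s w = None.
Proof.
elim: w s => [|pe w IH] s; first by left; rewrite big_ord0.
rewrite /=; case E: (step s pe) => [t|] /=; last by right.
have [->|] := IH t; last by right.
left; rewrite big_ord_recl /=; congr (_ + _); apply: eq_bigr => j _.
by rewrite /= E.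
Qed.

Lemma piece_index_lk s pe :
  piece_index s pe = \sum_(j < n | j != i) lk_at j i s pe
                   - \sum_(j < n | j != i) lk_at i j s pe.
Proof.
case: pe => p e; rewrite /piece_index /lk_at /=.
have zero : (0 : int) = \sum_(j < n | j != i) 0 - \sum_(j < n | j != i) 0.
  by rewrite !big1 ?subr0.
case: e => // x; case: (drop p s) => [|[a d] [|[b d'] r]] //=; rewrite take0.
have one (c1 c2 : 'I_n) (z : int) : \sum_(j < n | j != i) (if (c1, c2) == (j, i) then z else 0)
   - \sum_(j < n | j != i) (if (c1, c2) == (i, j) then z else 0)
   = z * ((c2 == i)%:Z - (c1 == i)%:Z).
  have -> : \sum_(j < n | j != i) (if (c1, c2) == (j, i) then z else 0) =
            if (c1 != i) && (c2 == i) then z else 0.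
    case: ifP => [/andP[h1 /eqP h2]|h].
      rewrite (bigD1 c1) //= h2 eqxx big1 ?addr0 // => j /andP[_ hj].
      by rewrite xpair_eqE eq_sym (negbTE hj).
    rewrite big1 // => j hj; rewrite xpair_eqE; case: eqP => //= hc.
    by rewrite hc hj /= in h; rewrite h.
  have -> : \sum_(j < n | j != i) (if (c1, c2) == (i, j) then z else 0) =
            if (c2 != i) && (c1 == i) then z else 0.
    case: ifP => [/andP[h1 /eqP h2]|h].
      rewrite (bigD1 c2) //= h2 eqxx big1 ?addr0 // => j /andP[_ hj].
      by rewrite xpair_eqE andbC eq_sym (negbTE hj).
    rewrite big1 // => j hj; rewrite xpair_eqE andbC; case: eqP => //= hc.
    by rewrite hc hj /= in h; rewrite h.
  by case: (c1 == i); case: (c2 == i) => /=; ring.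
by case: x => //=; rewrite one /crossing_index /=; case: d; case: d' => /=; ring.
Qed.

Lemma diagram_index D : word_index [::] D =
  \sum_(j < n | j != i) diagram_lk D j i - \sum_(j < n | j != i) diagram_lk D i j.
Proof.
have [hD _] := diagramP D.
have [->|] := word_indexE [::] D; last by rewrite hD.
rewrite /diagram_lk [X in X - _]exchange_big [X in _ - X]exchange_big /= -sumrB.
apply: eq_bigr => j _; rewrite piece_index_lk.
by rewrite (tnth_nth (0%N, Cap)).
Qed.

Lemma intersection_number_index (L : vlink n) D :
  L D -> intersection_number L i = word_index [::] D.
Proof.
move=> hD; rewrite /intersection_number /lk -diagram_index.
rewrite /some_diagram; case: constructive_indefinite_description => E hE /=.
case: L hD hE => C [F HF] /= /HF h1 /HF h2.
(* The chosen diagram and [D] represent the same link, so Reidemeister moves relate them; these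
   belong to [diagram_move k] for both values of [k]. *)
apply: (@diagram_moves_index true).
have inc x y : same_link x y -> clos_refl_sym_trans _ (diagram_move true) x y.
  elim=> [a b h|a|a b _|a b c _ h3 _ h4].
  - by apply: rst_step; right.
  - exact: rst_refl.
  - exact: rst_sym.
  - exact: rst_trans h3 h4.
by apply: (rst_trans _ _ E F D); [apply: rst_sym|]; apply: inc.
Qed.

End Lambda.

(** * Permutations induced by crossings *)

Section Permuting.

Variable T : Type.
Implicit Types (t u : seq T) (l m : seq nat).

Fixpoint swap p t : seq T :=
  match p, t with
  | 0, [:: a, b & r] => [:: b, a & r]
  | q.+1, a :: r => a :: swap q r
  | _, _ => t
  end.

Definition permute l t := foldl (fun t p => swap p t) t l.

Lemma size_swap p t : size (swap p t) = size t.
Proof. by elim: p t => [|p IH] [|a t] //=; [case: t | rewrite IH]. Qed.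

Lemma size_permute l t : size (permute l t) = size t.
Proof. by elim: l t => //= p l IH t; rewrite IH size_swap. Qed.

Lemma permute_cat l m t : permute (l ++ m) t = permute m (permute l t).
Proof. exact: foldl_cat. Qed.

Lemma swapK p t : swap p (swap p t) = t.
Proof. by elim: p t => [|p IH] [|a t] //=; [case: t | rewrite IH]. Qed.

Lemma swapC p q t : p.+1 < q -> swap p (swap q t) = swap q (swap p t).
Proof.
elim: p q t => [|p IH] [|q] [|a t] //= h; last by rewrite IH.
by case: q t h => [|q] [|b t].
Qed.

Lemma swap_braid p t : p.+2 < size t ->
  swap p (swap p.+1 (swap p t)) = swap p.+1 (swap p (swap p.+1 t)).
Proof.
elim: p t => [|p IH] [|a t] //=; first by case: t => [|b [|c t]].
by move=> h; congr (_ :: _); apply: IH.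
Qed.

Lemma permuteK l t : permute (rev l) (permute l t) = t.
Proof.
elim: l t => //= p l IH t.
by rewrite rev_cons -cats1 permute_cat IH /= swapK.
Qed.

Lemma permuteVK l t : permute l (permute (rev l) t) = t.
Proof. by rewrite -{1}[l]revK permuteK. Qed.

Lemma permute_cons l a t : permute (map S l) (a :: t) = a :: permute l t.
Proof. by elim: l t => /=. Qed.

Lemma permute_shift j l u t : size u = j ->
  permute (map (addn j) l) (u ++ t) = u ++ permute l t.
Proof.
move=> <-; elim: l t => //= p l IH t; rewrite -IH; congr permute.
by elim: u {IH} => //= a u ->.
Qed.

(** These words carry the first entry to place [j]; they represent the cosets of the stabiliser of
    the first entry in the symmetric group. *)
Lemma permute_iota j a t : j <= size t ->
  permute (iota 0 j) (a :: t) = take j t ++ a :: drop j t.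
Proof.
elim: j t => [|j IH] [|b t] //= h.
rewrite -[1]addn0 iotaDl (_ : map _ _ = map S (iota 0 j)); last exact: eq_map.
by rewrite permute_cons IH.
Qed.

End Permuting.

Lemma nth_swap (T : Type) (x0 : T) i j (t : seq T) : i.+1 < size t ->
  nth x0 (swap i t) j =
  nth x0 t (if j == i then i.+1 else if j == i.+1 then i else j).
Proof.
elim: i j t => [|i IH] j [|a t] //=; first by case: t j => [|b t] [|[|j]].
by case: j => [|j] //= hi; rewrite !eqSS; move: hi; rewrite ltnS => /(IH j) ->; do 2 (case: ifP => //).
Qed.

Lemma map_swap (T U : Type) (g : T -> U) p t : map g (swap p t) = swap p (map g t).
Proof. by elim: p t => [|p IH] [|a t] //=; [case: t | rewrite IH]. Qed.

Lemma map_permute (T U : Type) (g : T -> U) l t :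
  map g (permute l t) = permute l (map g t).
Proof. by elim: l t => //= p l IH t; rewrite IH map_swap. Qed.

Lemma perm_swap (T : eqType) p (t : seq T) : perm_eq (swap p t) t.
Proof.
elim: p t => [|p IH] [|a t] //=; last by rewrite perm_cons.
by case: t => [|b t] //; apply/permP => q /=; rewrite addnCA.
Qed.

Lemma perm_permute (T : eqType) l (t : seq T) : perm_eq (permute l t) t.
Proof.
elim: l t => //= p l IH t; apply: perm_trans (IH _) _; exact: perm_swap.
Qed.

Definition below N l := all (fun p => p.+1 < N) l.

Lemma below_cat N l m : below N (l ++ m) = below N l && below N m.
Proof. exact: all_cat. Qed.

Lemma below_rev N l : below N (rev l) = below N l.
Proof. exact: all_rev. Qed.

Lemma below_leq N M l : N <= M -> below N l -> below M l.
Proof. by move=> h; apply: sub_all => p hp; apply: leq_trans h. Qed.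

Lemma below_shift j N l : below (j + N) (map (addn j) l) = below N l.
Proof. by rewrite /below all_map; apply: eq_all => p /=; rewrite -addnS ltn_add2l. Qed.

Lemma below_S N l : below N.+1 (map S l) = below N l.
Proof. exact: (below_shift 1). Qed.

Lemma below_iota j N : j < N -> below N (iota 0 j).
Proof. by move=> h; apply/allP => p; rewrite mem_iota /= add0n; lia. Qed.

Lemma permute_exists (T : eqType) (t u : seq T) : perm_eq t u ->
  exists2 l, below (size u) l & permute l u = t.
Proof.
elim: u t => [|a u IH] t h; first by rewrite (perm_nilP h); exists [::].
have ha : a \in t by rewrite (perm_mem h) mem_head.
pose j := index a t; pose t1 := take j t; pose t2 := drop j.+1 t.
have Et : t = t1 ++ a :: t2.
  by rewrite -{1}(cat_take_drop j t) (drop_nth a) ?index_mem // nth_index.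
have h2 : perm_eq (t1 ++ t2) u.
  rewrite -(perm_cons a); apply: perm_trans h; rewrite Et.
  by apply/permP => q; rewrite /= !count_cat /= addnCA.
have [l hl El] := IH _ h2.
have sj : size t1 = j by rewrite size_takel // ltnW // index_mem.
have hj : j <= size u by rewrite -(perm_size h2) size_cat sj leq_addr.
exists (map S l ++ iota 0 j).
  by rewrite below_cat below_S hl below_iota.
rewrite permute_cat permute_cons El permute_iota; last by rewrite (perm_size h2).
by rewrite -sj take_size_cat // drop_size_cat.
Qed.

Lemma permute_prefix N (t : seq nat) : uniq t -> all (fun p => p < N) t ->
  exists l r, below N l /\ permute l (iota 0 N) = t ++ r.
Proof.
move=> hu /allP ha; pose r := [seq p <- iota 0 N | p \notin t].
have h : perm_eq (t ++ r) (iota 0 N).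
  apply: uniq_perm; rewrite ?iota_uniq //.
    rewrite cat_uniq hu filter_uniq ?iota_uniq // andbT.
    by apply/hasPn => p; rewrite mem_filter => /andP[].
  move=> p; rewrite mem_cat mem_filter mem_iota /= add0n.
  by case hp: (p \in t) => //=; rewrite ha.
have [l hl El] := permute_exists h; exists l, r; split=> //.
by rewrite size_iota in hl.
Qed.

(** * Words of crossings *)

Notation xword := (seq (nat * crossing)).

Definition virtual (l : seq nat) : xword := [seq (p, Virtual) | p <- l].
Definition positions (l : xword) : seq nat := unzip1 l.
Definition xshift j (l : xword) : xword := [seq (j + pz.1, pz.2) | pz <- l].

Lemma positions_virtual l : positions (virtual l) = l.
Proof. by rewrite /positions /unzip1 -map_comp map_id. Qed.

Lemma positions_cat l m : positions (l ++ m) = positions l ++ positions m.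
Proof. exact: map_cat. Qed.

Lemma positions_xshift j l : positions (xshift j l) = map (addn j) (positions l).
Proof. by rewrite /positions /unzip1 -!map_comp. Qed.

Lemma virtual_cat l m : virtual (l ++ m) = virtual l ++ virtual m.
Proof. exact: map_cat. Qed.

Lemma xshift_virtual j l : xshift j (virtual l) = virtual (map (addn j) l).
Proof. by rewrite /virtual /xshift -!map_comp. Qed.

Section CrossingWords.

Variables (n : nat) (k : bool).
Implicit Types (s r t : seq (strand n)) (w u v : word n) (l m : xword).

Definition cross l : word n := [seq (pz.1, Cross pz.2) | pz <- l].

Lemma cross_cat l m : cross (l ++ m) = cross l ++ cross m.
Proof. exact: map_cat. Qed.

Lemma cross_xshift j l : cross (xshift j l) = shift j (cross l).
Proof. by rewrite /cross /shift /xshift -!map_comp. Qed.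

Lemma step_cross s p z : p.+1 < size s -> step s (p, Cross z) = Some (swap p s).
Proof.
elim: p s => [|p IH] [|a s] //=; rewrite ?stepE //; first by case: s.
by move=> h; rewrite IH.
Qed.

Lemma run_cross s l : below (size s) (positions l) ->
  run s (cross l) = Some (permute (positions l) s).
Proof.
elim: l s => //= -[p z] l IH s /= /andP[h1 h2].
by rewrite step_cross //= IH // size_swap.
Qed.

(** Equivalence on every level with at least [N] strands, for all labels and orientations; relations
    that depend on orientation cannot be stated this way and use [ceq] below. *)
Definition xeq N l m := forall s, N <= size s -> teq k s (cross l) (cross m).

Lemma xeq_refl N l : xeq N l l. Proof. by move=> *; apply: teq_refl. Qed.
Lemma xeq_sym N l m : xeq N l m -> xeq N m l.
Proof. by move=> h s hs; apply: teq_sym; apply: h. Qed.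
Lemma xeq_trans N l2 l1 l3 : xeq N l1 l2 -> xeq N l2 l3 -> xeq N l1 l3.
Proof. by move=> h1 h2 s hs; apply: teq_trans (h1 s hs) (h2 s hs). Qed.

Lemma xeq_leq N M l m : N <= M -> xeq N l m -> xeq M l m.
Proof. by move=> h1 h2 s hs; apply: h2; apply: leq_trans hs. Qed.

Lemma xeq_cat N l1 l2 m1 m2 : below N (positions l1) ->
  xeq N l1 l2 -> xeq N m1 m2 -> xeq N (l1 ++ m1) (l2 ++ m2).
Proof.
move=> hb h1 h2 s hs; rewrite !cross_cat.
apply: (teq_cat (t := permute (positions l1) s)); last 2 first.
- exact: h1.
- by apply: h2; rewrite size_permute.
by rewrite run_cross // (below_leq hs).
Qed.

Lemma xeq_catl N l m1 m2 : below N (positions l) ->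
  xeq N m1 m2 -> xeq N (l ++ m1) (l ++ m2).
Proof. by move=> hb; apply: xeq_cat => //; apply: xeq_refl. Qed.

Lemma xeq_catr N l1 l2 m : xeq N l1 l2 -> xeq N (l1 ++ m) (l2 ++ m).
Proof. by move=> h s hs; rewrite !cross_cat; apply: teq_catr; apply: h. Qed.

Lemma xeq_mid N l m1 m2 l' : below N (positions l) ->
  xeq N m1 m2 -> xeq N (l ++ m1 ++ l') (l ++ m2 ++ l').
Proof. by move=> hb h; apply: xeq_catl => //; apply: xeq_catr. Qed.

Lemma xeq_shift j N l m : xeq N l m -> xeq (j + N) (xshift j l) (xshift j m).
Proof.
move=> h s hs; have hj : j <= size s by apply: leq_trans hs; apply: leq_addr.
have [a [b [E ej]]] := split_level hj; subst s j; rewrite !cross_xshift.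
by apply: teq_shift; apply: h; move: hs; rewrite size_cat leq_add2l.
Qed.

Lemma xeq_RII N p z : p.+1 < N -> xeq N [:: (p, z); (p, flip z)] [::].
Proof.
move=> hp; apply: (@xeq_leq (p + 2)); first by rewrite addn2.
have H : xeq 2 [:: (0, z); (0, flip z)] [::].
  by move=> [|a [|b s]] // _; apply: teq_lmove; constructor.
by have := @xeq_shift p _ _ _ H; rewrite /xshift /= addn0.
Qed.

Lemma xeq_far N p q y z : p.+1 < q -> q.+1 < N ->
  xeq N [:: (p, y); (q, z)] [:: (q, z); (p, y)].
Proof.
move=> hpq hq; apply: (@xeq_leq (p + (q - p).+2)); first lia.
set q' := q - p - 2.
have H : xeq (q - p).+2 [:: (0, y); (2 + q', z)] [:: (2 + q', z); (0, y)].
  move=> [|a [|b s]] // hs; apply: teq_lmove.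
  apply: (@lm_exchange n k [:: a; b] [:: b; a] s _ q' (Cross y) (Cross z)) => //.
  by apply: step_cross; move: hs => /=; rewrite /q'; lia.
have := @xeq_shift p _ _ _ H; rewrite /xshift /= addn0.
by have -> : p + (2 + q') = q by rewrite /q'; lia.
Qed.

Lemma xeq_RIII N p x y z : third x y z -> p.+2 < N ->
  xeq N [:: (p, x); (p.+1, y); (p, z)] [:: (p.+1, z); (p, y); (p.+1, x)].
Proof.
move=> h hp; apply: (@xeq_leq (p + 3)); first by rewrite addn3.
have H : xeq 3 [:: (0, x); (1, y); (0, z)] [:: (1, z); (0, y); (1, x)].
  by move=> [|a [|b [|c s]]] // _; apply: teq_lmove; constructor.
by have := @xeq_shift p _ _ _ H; rewrite /xshift /= addn0 addn1.
Qed.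

End CrossingWords.

(** * Virtual crossings form a symmetric group *)

Section Coxeter.

Variables (n : nat) (k : bool).
Implicit Types (l m r : seq nat).
Notation xeq := (xeq n k).

(* The second component is not a consequence of the first when [n = 0]. *)
Definition veq N (l m : seq nat) := xeq N (virtual l) (virtual m) /\
  forall t : seq nat, N <= size t -> permute l t = permute m t.

Lemma veq_refl N l : veq N l l.
Proof. by split=> //; apply: xeq_refl. Qed.
Lemma veq_sym N l m : veq N l m -> veq N m l.
Proof. by case=> h1 h2; split=> [|t ht]; [apply: xeq_sym | rewrite h2]. Qed.
Lemma veq_trans N l2 l1 l3 : veq N l1 l2 -> veq N l2 l3 -> veq N l1 l3.
Proof.
move=> [h1 h2] [h3 h4]; split=> [|t ht]; first exact: xeq_trans h3.
by rewrite h2 // h4.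
Qed.

Lemma veq_cat N l1 l2 m1 m2 : below N l1 ->
  veq N l1 l2 -> veq N m1 m2 -> veq N (l1 ++ m1) (l2 ++ m2).
Proof.
move=> hb [h1 h2] [h3 h4]; split=> [|t ht].
  by rewrite !virtual_cat; apply: xeq_cat; rewrite ?positions_virtual.
by rewrite !permute_cat h4 ?size_permute // h2.
Qed.

Lemma veq_mid N l m1 m2 l' : below N l ->
  veq N m1 m2 -> veq N (l ++ m1 ++ l') (l ++ m2 ++ l').
Proof.
move=> hb [h1 h2]; split=> [|t ht].
  by rewrite !virtual_cat; apply: xeq_mid; rewrite ?positions_virtual.
by rewrite !permute_cat h2 ?size_permute.
Qed.

Lemma veq_RII N p : p.+1 < N -> veq N [:: p; p] [::].
Proof. by move=> hp; split=> [|t _]; [apply: xeq_RII | rewrite /= swapK]. Qed.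

Lemma veq_far N p q : p.+1 < q -> q.+1 < N -> veq N [:: p; q] [:: q; p].
Proof. by move=> h1 h2; split=> [|t _]; [apply: xeq_far | rewrite /= (swapC _ h1)]. Qed.

Lemma veq_braid N p : p.+2 < N -> veq N [:: p; p.+1; p] [:: p.+1; p; p.+1].
Proof.
move=> hp; split=> [|t ht]; first by apply: xeq_RIII => //; constructor.
by rewrite /= swap_braid // (leq_trans hp).
Qed.

Lemma veq_far_list N p l : all (fun i => i.+1 < p) l -> p.+1 < N ->
  veq N (l ++ [:: p]) (p :: l).
Proof.
move=> + hp; elim: l => [|i l IH] /=; first by move=> _; apply: veq_refl.
case/andP => h1 h2; apply: (@veq_trans _ ([:: i] ++ p :: l)).
  by apply: (@veq_cat _ [:: i] [:: i] _ _ _ (veq_refl _ _) (IH h2)); rewrite /= andbT; lia.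
by apply: (@veq_mid _ [::] [:: i; p] [:: p; i] l) => //; apply: veq_far.
Qed.

Lemma veq_far_list' N p l : all (fun i => p.+1 < i) l -> below N l ->
  veq N (l ++ [:: p]) (p :: l).
Proof.
elim: l => [|i l IH] /=; first by move=> *; apply: veq_refl.
case/andP => h1 h2 /andP[h3 h4]; apply: (@veq_trans _ ([:: i] ++ p :: l)).
  by apply: (@veq_cat _ [:: i] [:: i] _ _ _ (veq_refl _ _) (IH h2 h4)); rewrite /= h3.
apply: (@veq_mid _ [::] [:: i; p] [:: p; i] l) => //.
by apply: veq_sym; apply: veq_far.
Qed.

(** Coset normal form, by induction on the last letter [p] appended to the cycle [iota 0 j]. If
    [p > j] it commutes to the front; if [p = j] it lengthens the cycle; if [p = j - 1] it cancels;
    if [p < j - 1] a braid relation turns it into [p + 1] in front of the cycle. *)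
Lemma veq_factor N l : below N.+1 l ->
  exists l' j, [/\ below N l', j <= N & veq N.+1 l (map S l' ++ iota 0 j)].
Proof.
elim/last_ind: l => [|l p IH]; first by exists [::], 0; split=> //; apply: veq_refl.
rewrite -cats1 below_cat /= andbT => /andP[/IH[l' [j [hl' hj h]]] hp].
have hm : below N.+1 (map S l') by rewrite below_S.
have {h} h : veq N.+1 (l ++ [:: p]) (map S l' ++ (iota 0 j ++ [:: p])).
  by rewrite catA; apply: (@veq_mid _ [::]).
have push q r : q < N.-1 -> veq N.+1 (iota 0 j ++ [:: p]) (q.+1 :: r) ->
    veq N.+1 (l ++ [:: p]) (map S (l' ++ [:: q]) ++ r).
  move=> hq hr; apply: veq_trans h _; rewrite map_cat -catA.
  by apply: veq_cat => //; apply: veq_refl.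
have [hjp|hpj] := ltnP j p.
  exists (l' ++ [:: p.-1]), j; split=> //.
    by rewrite below_cat hl' /= andbT; lia.
  apply: push; first lia.
  rewrite prednK; last lia.
  by apply: veq_far_list => //; apply/allP => i; rewrite mem_iota; lia.
have [ejp|njp] := eqVneq j p.
  exists l', j.+1; split=> //; first lia.
  by apply: veq_trans h _; rewrite -[j.+1]addn1 iotaD add0n ejp; apply: veq_refl.
have [ejp|njp'] := eqVneq j p.+1.
  exists l', p; split=> //; first lia.
  apply: veq_trans h _; rewrite ejp -[p.+1]addn1 iotaD add0n -!catA /= catA.
  rewrite -{2}[_ ++ iota 0 p]cats0; apply: (@veq_mid _ _ [:: p; p] [::] [::]).
    by rewrite below_cat hm below_iota //; lia.
  by apply: veq_RII; lia.
exists (l' ++ [:: p]), j; split=> //; first by rewrite below_cat hl' /= andbT; lia.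
apply: push; first lia.
have -> : iota 0 j = iota 0 p ++ [:: p; p.+1] ++ iota p.+2 (j - p.+2).
  have {1}-> : j = p + (2 + (j - p.+2)) by lia.
  by rewrite !iotaD add0n addn2.
set r := iota p.+2 _; have hr : all (fun i => p.+1 < i) r.
  by apply/allP => i; rewrite mem_iota; lia.
have br : below N.+1 r by apply/allP => i; rewrite mem_iota; lia.
have bp : below N.+1 (iota 0 p) by apply: below_iota; lia.
apply: (@veq_trans _ (iota 0 p ++ [:: p; p.+1] ++ p :: r)).
  rewrite -!catA; apply: veq_cat bp (veq_refl _ _) _.
  apply: (@veq_cat _ [:: p; p.+1] [:: p; p.+1]); first by rewrite /=; lia.
    exact: veq_refl.
  exact: veq_far_list'.
apply: (@veq_trans _ (iota 0 p ++ [:: p.+1; p; p.+1] ++ r)).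
  by apply: (@veq_mid _ (iota 0 p) [:: p; p.+1; p]) => //; apply: veq_braid; lia.
apply: (@veq_trans _ ((iota 0 p ++ [:: p.+1]) ++ [:: p; p.+1] ++ r)).
  by rewrite -catA; apply: veq_refl.
apply: (@veq_mid _ [::] (iota 0 p ++ [:: p.+1]) (p.+1 :: iota 0 p) ([:: p; p.+1] ++ r)) => //.
by apply: veq_far_list; [apply/allP => i; rewrite mem_iota; lia | lia].
Qed.

(* The symmetric group is presented by the Coxeter relations. *)
Lemma veq_permute N l m : below N l -> below N m ->
  permute l (iota 0 N) = permute m (iota 0 N) -> veq N l m.
Proof.
elim: N l m => [|N IH] l m.
  by case: l => // _; case: m => // _ _; apply: veq_refl.
move=> hl hm E.
have [l' [j [hl' hj h1]]] := veq_factor hl.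
have [m' [i [hm' hi h2]]] := veq_factor hm.
have [_ p1] := h1; have [_ p2] := h2.
move: E; rewrite p1 ?p2 ?size_iota // !permute_cat /= !permute_cons.
rewrite !permute_iota ?size_permute ?size_iota //.
have n0 (u : seq nat) : 0 \notin permute u (iota 1 N).
  by rewrite (perm_mem (perm_permute _ _)) mem_iota.
set t1 := permute l' _; set t2 := permute m' _ => E.
(* The final place of strand 0 determines the coset, that is [j]; the order of the other strands
   then determines the remaining factor. *)
have idx (t : seq nat) q : 0 \notin t -> q <= size t -> index 0 (take q t ++ 0 :: drop q t) = q.
  move=> ht hq; rewrite index_cat.
  have -> : (0 \in take q t) = false.
    by apply/negbTE; apply: contra ht; apply: mem_take.
  by rewrite /= addn0 size_takel.
have st (u : seq nat) : size (permute u (iota 1 N)) = N.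
  by rewrite size_permute size_iota.
have eij : j = i.
  by rewrite -(idx t1 j) ?n0 ?st // E idx ?n0 ?st.
have e12 : t1 = t2.
  rewrite -(cat_take_drop j t1) -(cat_take_drop j t2).
  move/eqP: E; rewrite -eij eqseq_cat; last by rewrite !size_takel ?st // ?eij.
  by case/andP => /eqP-> /eqP[->].
have E' : permute l' (iota 0 N) = permute m' (iota 0 N).
  apply: (inj_map succn_inj); rewrite !map_permute.
  by have -> : map S (iota 0 N) = iota 1 N by rewrite -[1]addn0 iotaDl.
apply: veq_trans h1 _; apply: veq_trans (veq_sym h2).
have [h3 h4] := IH _ _ hl' hm' E'; rewrite -eij.
apply: (@veq_mid _ [::]) => //; split=> [|t ht].
  by have := xeq_shift (j := 1) h3; rewrite !xshift_virtual add1n.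
case: t ht => // a t; rewrite ltnS => ht.
by rewrite !permute_cons h4.
Qed.

Lemma xeq_virtual N l m : below N l -> below N m ->
  permute l (iota 0 N) = permute m (iota 0 N) -> xeq N (virtual l) (virtual m).
Proof. by move=> hl hm /(veq_permute hl hm)[]. Qed.

Lemma xeq_virtualK N l : below N l -> xeq N (virtual l ++ virtual (rev l)) [::].
Proof.
move=> hl; rewrite -virtual_cat; apply: (@xeq_virtual _ _ [::]) => //.
  by rewrite below_cat below_rev hl.
by rewrite permute_cat permuteK.
Qed.

Lemma xeq_virtualVK N l : below N l -> xeq N (virtual (rev l) ++ virtual l) [::].
Proof.
by move=> hl; rewrite -{2}[l]revK; apply: xeq_virtualK; rewrite below_rev.
Qed.

End Coxeter.

(** * Chords *)

Definition eq_crossing x y :=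
  match x, y with
  | Over, Over | Under, Under | Virtual, Virtual => true
  | _, _ => false
  end.

Lemma eq_crossingP : Equality.axiom eq_crossing.
Proof. by do 2 case; constructor. Qed.

HB.instance Definition _ := hasDecEq.Build crossing eq_crossingP.

Notation chord := (nat * nat * crossing)%type.

Definition to_front j := rev (iota 0 j).

(** Strand [b] goes to the front first; this pushes [a] one place to the right when [a < b]. *)
Definition chord_path a b := to_front b ++ to_front (if a < b then a.+1 else a).

(* The strands at [a] and [b] are brought to the left by virtual crossings; they
   cross there as [x] says, cross back virtually, and return to their places. *)
Definition chord_word (c : chord) : xword :=
  let: (a, b, x) := c in
  virtual (chord_path a b) ++ [:: (0, x); (0, Virtual)]
    ++ virtual (rev (chord_path a b)).

Lemma chord_wordE a b x : chord_word (a, b, x) =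
  virtual (chord_path a b) ++ [:: (0, x); (0, Virtual)]
    ++ virtual (rev (chord_path a b)).
Proof. by []. Qed.

Definition chords_word (ch : seq chord) : xword := flatten (map chord_word ch).

(** The Gauss data of a word: its real crossings in order, each with the names of its left and right
    strand in the current arrangement [t]. *)
Fixpoint chords (t : seq nat) (l : xword) : seq chord :=
  if l is (p, x) :: l' then
    (if is_real x then [:: (nth 0 t p, nth 0 t p.+1, x)] else [::])
      ++ chords (swap p t) l'
  else [::].

Definition chord_in N (c : chord) :=
  [&& c.1.1 != c.1.2, c.1.1 < N, c.1.2 < N & is_real c.2].

Definition relabel (t : seq nat) (c : chord) : chord :=
  (nth 0 t c.1.1, nth 0 t c.1.2, c.2).

Lemma permute_to_front (T : Type) j (x : T) (u v : seq T) : size u = j ->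
  permute (to_front j) (u ++ x :: v) = x :: u ++ v.
Proof.
move=> hu; rewrite -[RHS](permuteK (iota 0 j)) permute_iota; last first.
  by rewrite size_cat hu leq_addr.
by rewrite -hu take_size_cat // drop_size_cat.
Qed.

Lemma chord_path_spec N a b : a != b -> a < N -> b < N ->
  below N (chord_path a b) /\
  exists r, permute (chord_path a b) (iota 0 N) = [:: a, b & r].
Proof.
move=> hab ha hb; split.
  rewrite /chord_path below_cat !below_rev below_iota //=; apply: below_iota.
  by case: ifP; lia.
have split3 i j : i < j -> j < N -> iota 0 N =
    iota 0 i ++ i :: (iota i.+1 (j - i.+1) ++ j :: iota j.+1 (N - j.+1)).
  move=> hij hj.
  have E a' b' c' : a' <= b' -> b' <= c' ->
      iota a' (c' - a') = iota a' (b' - a') ++ iota b' (c' - b').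
    move=> h1 h2; have -> : c' - a' = (b' - a') + (c' - b') by lia.
    by rewrite iotaD subnKC.
  have C a' b' : a' < b' -> iota a' (b' - a') = a' :: iota a'.+1 (b' - a'.+1).
    by move=> h; rewrite -(prednK (_ : 0 < b' - a')) ?subn_gt0 //= subnS.
  have := E 0 i N (leq0n i) (ltnW (ltn_trans hij hj)); rewrite !subn0 => ->.
  by rewrite (C i N (ltn_trans hij hj)) (E i.+1 j N hij (ltnW hj)) (C j N hj).
rewrite /chord_path permute_cat; case: ltnP => h.
  rewrite (split3 a b) // -cat_rcons catA permute_to_front; last first.
    by rewrite size_cat size_rcons !size_iota; lia.
  rewrite -catA cat_rcons -cat_cons permute_to_front; last by rewrite /= size_iota.
  by eexists.
have {}h : b < a by move: hab h; lia.
rewrite (split3 b a) // permute_to_front ?size_iota //.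
rewrite catA -cat_cons permute_to_front; first by eexists.
by rewrite /= size_cat !size_iota; lia.
Qed.

Lemma chords_cat t l m :
  chords t (l ++ m) = chords t l ++ chords (permute (positions l) t) m.
Proof. by elim: l t => //= -[p x] l IH t; rewrite IH -catA. Qed.

Lemma chords_virtual t l : chords t (virtual l) = [::].
Proof. by elim: l t => /=. Qed.

Lemma chords_relabel t u l : below (size u) (positions l) ->
  chords (map (nth 0 t) u) l = map (relabel t) (chords u l).
Proof.
elim: l u => //= -[p x] l IH u /= /andP[hp hl].
rewrite map_cat -map_swap IH ?size_swap //; congr (_ ++ _).
by case: is_real => //=; rewrite /relabel /= !(nth_map 0) // ltnW.
Qed.

Lemma nth_permute_gen (T : Type) (x0 : T) (t : seq T) l N : size t = N ->
  permute l t = map (nth x0 t) (permute l (iota 0 N)).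
Proof.
move=> <-; rewrite map_permute; congr permute.
by have := mkseq_nth x0 t; rewrite /mkseq => ->.
Qed.

Lemma nth_permute t l N : size t = N ->
  permute l t = map (nth 0 t) (permute l (iota 0 N)).
Proof. exact: nth_permute_gen. Qed.

Lemma chord_word_below N c : chord_in N c -> below N (positions (chord_word c)).
Proof.
case: c => [[a b] x] /and4P[h1 h2 h3 _]; rewrite /= in h1 h2 h3.
have [hb _] := chord_path_spec h1 h2 h3.
rewrite chord_wordE; move: (chord_path a b) hb => q hb.
rewrite !positions_cat !positions_virtual !below_cat below_rev hb /= andbT.
by move: h1 h2 h3; lia.
Qed.

Lemma chords_word_below N ch :
  all (chord_in N) ch -> below N (positions (chords_word ch)).
Proof.
elim: ch => //= c ch IH /andP[hc /IH h].
by rewrite positions_cat below_cat chord_word_below.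
Qed.

Lemma chords_word_cat c d : chords_word (c ++ d) = chords_word c ++ chords_word d.
Proof. by rewrite /chords_word map_cat flatten_cat. Qed.

Lemma permute_chord_word (T : Type) c (t : seq T) :
  permute (positions (chord_word c)) t = t.
Proof.
case: c => [[a b] x]; rewrite chord_wordE; move: (chord_path a b) => q.
have E (u : seq T) : permute (positions [:: (0, x); (0, Virtual)]) u = u := swapK 0 u.
by rewrite !positions_cat !positions_virtual !permute_cat E permuteK.
Qed.

Lemma permute_chords_word (T : Type) ch (t : seq T) :
  permute (positions (chords_word ch)) t = t.
Proof.
elim: ch => //= c ch IH.
by rewrite positions_cat permute_cat permute_chord_word.
Qed.

Lemma chords_chord_word N t c : chord_in N c -> size t = N ->
  chords t (chord_word c) = [:: relabel t c].
Proof.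
move=> hc ht.
have -> : t = map (nth 0 t) (iota 0 N) by rewrite -(nth_permute [::] ht).
rewrite chords_relabel ?size_iota ?chord_word_below //.
case: c hc => [[a b] x] /and4P[h1 h2 h3 hx]; rewrite /= in h1 h2 h3 hx.
rewrite chord_wordE !chords_cat !chords_virtual positions_virtual.
have [_ [r ->]] := chord_path_spec h1 h2 h3.
by rewrite /= hx cats0 -(nth_permute [::] ht).
Qed.

Lemma chords_chords_word N t ch : all (chord_in N) ch -> size t = N ->
  chords t (chords_word ch) = map (relabel t) ch.
Proof.
move=> + ht; elim: ch => //= c ch IH /andP[hc /IH <-].
by rewrite chords_cat permute_chord_word (chords_chord_word hc).
Qed.

Lemma relabel_iota N c : chord_in N c -> relabel (iota 0 N) c = c.
Proof. by case: c => [[a b] x] /and4P[/= _ h1 h2 _]; rewrite /relabel /= !nth_iota. Qed.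

Lemma chord_in_relabel N t c : perm_eq t (iota 0 N) -> chord_in N c ->
  chord_in N (relabel t c).
Proof.
case: c => [[a b] x] hp /and4P[/= h1 h2 h3 h4].
have st : size t = N by rewrite (perm_size hp) size_iota.
have hu : uniq t by rewrite (perm_uniq hp) iota_uniq.
have hlt i : i < N -> nth 0 t i < N.
  by move=> hi; have := mem_nth 0 (_ : i < size t); rewrite st (perm_mem hp) mem_iota; apply.
by apply/and4P; split; rewrite //= ?hlt // nth_uniq ?st.
Qed.

Lemma chords_in N t m : perm_eq t (iota 0 N) -> below N (positions m) ->
  all (chord_in N) (chords t m).
Proof.
elim: m t => //= -[p x] m IH t ht /= /andP[hp hm].
rewrite all_cat; apply/andP; split; last first.
  by apply: IH => //; apply: perm_trans (perm_swap _ _) ht.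
case hx : (is_real x) => //=; rewrite andbT.
apply: (@chord_in_relabel _ t (p, p.+1, x)) => //.
by apply/and4P; split=> //=; lia.
Qed.

(** * Chords and permutation determine a word of crossings *)

Section ChordWords.

Variables (n : nat) (k : bool).
Implicit Types (s r t : seq (strand n)) (l m : xword).
Notation xeq := (xeq n k).

(** The mixed move carries a real crossing from [p.+1] to [p] across a virtual strand. *)
Lemma xeq_conj_succ p x : xeq p.+3 [:: (p.+1, x); (p.+1, Virtual)]
  [:: (p, Virtual); (p.+1, Virtual); (p, x); (p, Virtual); (p.+1, Virtual);
      (p, Virtual)].
Proof.
have H : xeq 3 [:: (1, x); (1, Virtual)]
    [:: (0, Virtual); (1, Virtual); (0, x); (0, Virtual); (1, Virtual); (0, Virtual)].
  apply: (@xeq_trans _ _ _ ([:: (1, x)] ++ virtual [:: 0; 1; 0; 1; 0])).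
    by apply: (@xeq_catl _ _ _ [:: (1, x)] (virtual [:: 1])) => //; apply: xeq_virtual.
  apply: (@xeq_catr _ _ _ [:: (1, x); (0, Virtual); (1, Virtual)]
    [:: (0, Virtual); (1, Virtual); (0, x)]).
  by apply: xeq_sym; apply: xeq_RIII => //; constructor.
by have := xeq_shift (j := p) H; rewrite /xshift /= addn0 addn1 addn3.
Qed.

(** A chord does not depend on the virtual path that brings its strands together, nor on the place
    where they meet. At place 0 two paths differ by a permutation of the other strands, which
    commutes with the crossing; a meeting at [p.+1] is reduced to one at [p] by [xeq_conj_succ]. *)
Lemma xeq_chord_conj N (l : seq nat) p x : below N l -> p.+1 < N -> is_real x ->
  xeq N (virtual l ++ [:: (p, x); (p, Virtual)] ++ virtual (rev l))
    (chord_word (nth 0 (permute l (iota 0 N)) p, nth 0 (permute l (iota 0 N)) p.+1, x)).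
Proof.
move=> + + hx; elim: p l => [|p IH] l hl hp.
  have hperm : perm_eq (permute l (iota 0 N)) (iota 0 N) by apply: perm_permute.
  have /and4P[h1 h2 h3 _] : chord_in N (relabel (permute l (iota 0 N)) (0, 1, x)).
    by apply: chord_in_relabel => //; rewrite /chord_in /= hx (ltnW hp) hp.
  rewrite /relabel /= in h1 h2 h3.
  set a := nth 0 _ 0 in h1 h2 h3 *; set b := nth 0 _ 1 in h1 h2 h3 *.
  have [hb [r Er]] := chord_path_spec h1 h2 h3.
  rewrite chord_wordE; move: (chord_path a b) hb Er => P hb Er.
  have El : permute l (iota 0 N) = [:: a, b & drop 2 (permute l (iota 0 N))].
    rewrite /a /b; have : 1 < size (permute l (iota 0 N)) by rewrite size_permute size_iota.
    by case: (permute l _) => [|? [|? ?]] //= _; rewrite drop0.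
  set r' := drop 2 _ in El.
  have Nr : size r = N - 2.
    by have := congr1 size Er; rewrite size_permute size_iota /= => ->; rewrite subn2.
  have hr : perm_eq r' r.
    rewrite -(perm_cons b) -(perm_cons a) -El -Er.
    by apply: perm_trans hperm _; rewrite perm_sym; apply: perm_permute.
  (* Both [l] and [P] bring [a] and [b] to the front; [u], shifted past these two, corrects the
     order of the other strands. *)
  have [u hu Eu] := permute_exists hr.
  pose u2 := map (addn 2) u.
  have hu2 : below N u2 by rewrite (_ : N = 2 + (N - 2)) ?below_shift -?Nr //; lia.
  have hbu : below N (P ++ u2) by rewrite below_cat hb.
  have hV : xeq N (virtual l) (virtual (P ++ u2)).
    apply: xeq_virtual => //.
    by rewrite permute_cat Er El /u2 (@permute_shift _ 2 u [:: a; b]) ?Eu.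
  have hV' : xeq N (virtual (rev l)) (virtual (rev (P ++ u2))).
    apply: xeq_virtual; rewrite ?below_rev //.
    apply: (can_inj (permuteK l)); rewrite !permuteVK.
    have -> : permute l (permute (rev (P ++ u2)) (iota 0 N)) =
      permute (P ++ u2) (permute (rev (P ++ u2)) (iota 0 N)).
      rewrite [LHS](@nth_permute _ _ N) ?size_permute ?size_iota //.
      rewrite [RHS](@nth_permute _ _ N) ?size_permute ?size_iota //.
      congr map; rewrite El permute_cat Er /u2 (@permute_shift _ 2 u [:: a; b]) ?Eu //.
    by rewrite permuteVK.
  apply: (@xeq_trans _ _ _ (virtual (P ++ u2) ++ [:: (0, x); (0, Virtual)]
     ++ virtual (rev (P ++ u2)))).
    apply: xeq_cat; rewrite ?positions_virtual //.
    by apply: (@xeq_catl _ _ _ [:: (0, x); (0, Virtual)]) => //=; rewrite hp.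
  pose B := [:: (0, x); (0, Virtual)].
  apply: (@xeq_trans _ _ _ (virtual P ++ (virtual u2 ++ B ++ virtual (rev u2)) ++ virtual (rev P))).
    by rewrite rev_cat !virtual_cat -!catA; apply: xeq_refl.
  apply: xeq_mid; rewrite ?positions_virtual //.
  apply: (@xeq_trans _ _ _ (B ++ virtual u2 ++ virtual (rev u2))); last first.
    apply: (@xeq_catl _ _ _ B _ [::]); first by rewrite /= hp.
    exact: xeq_virtualK.
  rewrite !catA; apply: xeq_catr.
  (* The letters of [u2] avoid the two leftmost strands, so each of them passes the crossings at
     0. *)
  have far q : q \in u2 -> 1 < q /\ q.+1 < N.
    move=> hq; split; last exact: (allP hu2).
    by case/mapP: hq => i _ ->.
  elim: u2 {hu2 hV hV' hbu} far => [_|q u2 IHu far]; first exact: xeq_refl.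
  have [h4 h5] := far q (mem_head _ _).
  apply: (@xeq_trans _ _ _ ((q, Virtual) :: [:: (0, x); (0, Virtual)] ++ virtual u2)).
    apply: (@xeq_catl _ _ _ [:: (q, Virtual)]); first by rewrite /= h5.
    by apply: IHu => i hi; apply: far; rewrite inE hi orbT.
  apply: (@xeq_catr _ _ _ [:: (q, Virtual); (0, x); (0, Virtual)]
    [:: (0, x); (0, Virtual); (q, Virtual)]).
  apply: (@xeq_trans _ _ _ [:: (0, x); (q, Virtual); (0, Virtual)]).
    apply: (@xeq_catr _ _ _ [:: (q, Virtual); (0, x)] [:: (0, x); (q, Virtual)]).
    by apply: xeq_sym; apply: xeq_far.
  apply: (@xeq_catl _ _ _ [:: (0, x)]); first by rewrite /= hp.
  by apply: xeq_sym; apply: xeq_far.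
have hl' : below N (l ++ [:: p; p.+1]) by rewrite below_cat hl /=; lia.
have := IH _ hl' (ltnW hp).
set c := (_, _, x); set c' := (_, _, x).
have -> : c' = c.
  rewrite /c /c' permute_cat; set t := permute l _.
  rewrite -[permute [:: p; p.+1] t]/(swap p.+1 (swap p t)).
  have st : size t = N by rewrite size_permute size_iota.
  have hp1 := ltnW hp.
  have e1 := ltn_eqF (ltnSn p); have e2 := gtn_eqF (ltnSn p).
  have e3 := ltn_eqF (leqnSn p.+1).
  have e4 := gtn_eqF (ltnSn p.+1); have e5 := gtn_eqF (leqnSn p.+1).
  by rewrite !nth_swap ?size_swap ?st // ?eqxx ?e1 ?e2 ?e3 ?eqxx ?e2 ?e4 ?e5.
move=> h; apply: xeq_trans h; rewrite virtual_cat -!catA.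
apply: xeq_catl; rewrite ?positions_virtual // rev_cat virtual_cat !catA.
apply: xeq_catr; apply: (xeq_leq hp); exact: xeq_conj_succ.
Qed.

(** A real crossing at [p] after the virtual word [v] is a crossing and its virtual return,
    conjugated by [v], followed by [v] and a virtual crossing at [p]. The conjugate is a chord and
    goes to the front; [v] accumulates the virtual remainder. *)
Lemma xeq_factor N v l : below N v -> below N (positions l) ->
  xeq N (virtual v ++ l)
    (chords_word (chords (permute v (iota 0 N)) l) ++ virtual (v ++ positions l)).
Proof.
elim: l v => [|[p x] l IH] v hv /=; first by rewrite !cats0; move=> _; apply: xeq_refl.
case/andP => hp hl.
have hvp : below N (v ++ [:: p]) by rewrite below_cat hv /= hp.
have := IH _ hvp hl; rewrite permute_cat /= -catA /= => IHv.
rewrite chords_word_cat -catA; case hx: (is_real x); last first.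
  apply: xeq_trans IHv; rewrite virtual_cat -catA /=.
  by case: x hx => // _; apply: xeq_refl.
apply: (@xeq_trans _ _ _ ((virtual v ++ [:: (p, x); (p, Virtual)] ++ virtual (rev v))
   ++ virtual (v ++ [:: p]) ++ l)); last first.
  rewrite /chords_word [flatten _]/= cats0.
  apply: xeq_cat IHv; last exact: xeq_chord_conj.
  by rewrite !positions_cat !positions_virtual !below_cat below_rev hv /= hp.
have E : xeq N [:: (p, x)]
    ([:: (p, x); (p, Virtual)] ++ (virtual (rev v) ++ virtual v) ++ [:: (p, Virtual)]).
  apply: (@xeq_trans _ _ _ ([:: (p, x)] ++ [:: (p, Virtual); (p, Virtual)])).
    apply: (@xeq_catl _ _ _ [:: (p, x)] [::]); first by rewrite /= hp.
    by apply: xeq_sym; apply: xeq_RII.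
  apply: (@xeq_mid _ _ _ [:: (p, x); (p, Virtual)] [::] _ [:: (p, Virtual)]).
    by rewrite /= hp.
  by apply: xeq_sym; apply: xeq_virtualVK.
have := @xeq_mid _ _ N (virtual v) _ _ l _ E; rewrite positions_virtual => /(_ hv).
by rewrite virtual_cat -!catA.
Qed.

(* Words of crossings with the same Gauss data are equivalent. *)
Lemma xeq_chords N l m : below N (positions l) -> below N (positions m) ->
  chords (iota 0 N) l = chords (iota 0 N) m ->
  permute (positions l) (iota 0 N) = permute (positions m) (iota 0 N) ->
  xeq N l m.
Proof.
move=> hl hm E1 E2; have := @xeq_factor N [::] l isT hl.
rewrite /= E1 => /xeq_trans; apply.
have := @xeq_factor N [::] m isT hm => /xeq_sym; apply: xeq_trans => /=.
have hc : all (chord_in N) (chords (iota 0 N) m) by apply: chords_in.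
by apply: xeq_catl; [exact: chords_word_below | exact: xeq_virtual].
Qed.

End ChordWords.

(** The second crossing of a type II move, read after the strands have exchanged sides: the same
    strand is over, with the opposite sign. *)
Definition inv_chord (c : chord) : chord := (c.1.2, c.1.1, flip c.2).

Lemma flipK : involutive flip. Proof. by case. Qed.

Lemma inv_chordK : involutive inv_chord.
Proof. by case=> [[a b] x]; rewrite /inv_chord /= flipK. Qed.

Lemma chord_in_inv N c : chord_in N (inv_chord c) = chord_in N c.
Proof.
case: c => [[a b] x]; rewrite /chord_in /= is_real_flip (eq_sym b).
by case: (b < N); rewrite ?andbF.
Qed.

(** * Relations between chords on a given level *)

Section ChordCalculus.

Variables (n : nat) (k : bool).
Implicit Types (s : seq (strand n)) (c d : chord) (u v w : seq chord).
Notation xeq := (xeq n k).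

(** The level is fixed, since the relations coming from the extra moves depend on the orientations
    of its strands. *)
Definition ceq s u v : Prop :=
  [/\ all (chord_in (size s)) u, all (chord_in (size s)) v
    & teq k s (cross n (chords_word u)) (cross n (chords_word v))].

Lemma run_chords s u : all (chord_in (size s)) u ->
  run s (cross n (chords_word u)) = Some s.
Proof.
by move=> hu; rewrite run_cross ?permute_chords_word //; apply: chords_word_below.
Qed.

Lemma ceq_refl s u : all (chord_in (size s)) u -> ceq s u u.
Proof. by move=> hu; split=> //; apply: teq_refl. Qed.
Lemma ceq_sym s u v : ceq s u v -> ceq s v u.
Proof. by case=> h1 h2 h3; split=> //; apply: teq_sym. Qed.
Lemma ceq_trans s v u w : ceq s u v -> ceq s v w -> ceq s u w.
Proof. by case=> h1 h2 h3 [h4 h5 h6]; split=> //; apply: teq_trans h3 h6. Qed.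

Lemma ceq_cat s u u' v v' : ceq s u u' -> ceq s v v' -> ceq s (u ++ v) (u' ++ v').
Proof.
case=> h1 h2 h3 [h4 h5 h6]; split; rewrite ?all_cat ?h1 ?h2 ?h4 ?h5 //.
rewrite !chords_word_cat !cross_cat; apply: teq_cat h3 h6; exact: run_chords.
Qed.

Lemma ceq_xeq s u v : all (chord_in (size s)) u -> all (chord_in (size s)) v ->
  xeq (size s) (chords_word u) (chords_word v) -> ceq s u v.
Proof. by move=> h1 h2 h3; split=> //; apply: h3. Qed.

(** By its Gauss data the inverse chord can be drawn along the path of [c] with its virtual crossing
    first. The inner paths cancel, leaving a virtual type II move inside a type II move of kind
    [x]. *)
Lemma ceq_invr s c : chord_in (size s) c -> ceq s [:: c; inv_chord c] [::].
Proof.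
move=> hc; apply: ceq_xeq; rewrite /= ?chord_in_inv ?hc //.
rewrite /chords_word /= cats0; case: c hc => [[a b] x] hc.
have /and4P[h1 h2 h3 hx] := hc; rewrite /= in h1 h2 h3 hx.
have [hb [r Er]] := chord_path_spec h1 h2 h3.
set N := size s in hc h1 h2 h3 hb Er *.
have N1 : 1 < N by move: h1 h2 h3; lia.
have H : xeq N (chord_word (inv_chord (a, b, x)))
    (virtual (chord_path a b) ++ [:: (0, Virtual); (0, flip x)] ++
     virtual (rev (chord_path a b))).
  have hi : chord_in N (inv_chord (a, b, x)) by rewrite chord_in_inv.
  move: (chord_path a b) hb Er => P hb Er.
  apply: xeq_chords; first exact: chord_word_below.
  - by rewrite !positions_cat !positions_virtual !below_cat below_rev hb /= N1.
  - rewrite (chords_chord_word hi) ?size_iota // relabel_iota //.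
    rewrite !chords_cat !chords_virtual positions_virtual Er /=.
    by rewrite is_real_flip hx.
  - rewrite permute_chord_word !positions_cat !positions_virtual !permute_cat.
    by rewrite [X in permute _ X]swapK permuteK.
apply: (@xeq_trans _ _ _ (chord_word (a, b, x) ++ (virtual (chord_path a b) ++
    [:: (0, Virtual); (0, flip x)] ++ virtual (rev (chord_path a b))))).
  by apply: xeq_catl => //; apply: chord_word_below.
rewrite chord_wordE {hc H}; move: (chord_path a b) hb Er => P hb Er.
have bx z y : below N (positions [:: (0, z); (0, y)]) by rewrite /= N1.
apply: (@xeq_trans _ _ _ (virtual P ++ ([:: (0, x); (0, Virtual)] ++
    [:: (0, Virtual); (0, flip x)]) ++ virtual (rev P))).
  rewrite -!catA; apply: xeq_catl; rewrite ?positions_virtual //.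
  apply: xeq_catl; rewrite ?bx //; rewrite catA -[X in xeq _ _ X]cat0s.
  by apply: xeq_catr; apply: xeq_virtualVK.
apply: (@xeq_trans _ _ _ (virtual P ++ [::] ++ virtual (rev P))); last exact: xeq_virtualK.
apply: xeq_mid; rewrite ?positions_virtual //.
apply: (@xeq_trans _ _ _ ([:: (0, x)] ++ [:: (0, flip x)])); last exact: xeq_RII.
apply: (@xeq_mid _ _ _ [:: (0, x)] [:: (0, Virtual); (0, Virtual)] [::]).
  by rewrite /= N1.
exact: xeq_RII.
Qed.

Lemma ceq_invl s c : chord_in (size s) c -> ceq s [:: inv_chord c; c] [::].
Proof.
by move=> hc; have := @ceq_invr s (inv_chord c); rewrite inv_chordK chord_in_inv; apply.
Qed.

(** Conjugating a relation by the virtual word [l] renames its strands by their places before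
    [l]. *)
Lemma ceq_conj s (l : seq nat) u v : below (size s) l -> ceq (permute l s) u v ->
  ceq s (map (relabel (permute l (iota 0 (size s)))) u)
        (map (relabel (permute l (iota 0 (size s)))) v).
Proof.
move=> hl [h1 h2 h3]; set N := size s in hl *; set t := permute l _.
rewrite size_permute -/N in h1 h2.
have pt : perm_eq t (iota 0 N) by apply: perm_permute.
have hin w : all (chord_in N) w -> all (chord_in N) (map (relabel t) w).
  by rewrite all_map => /allP h; apply/allP => c /h; apply: chord_in_relabel.
have H w : all (chord_in N) w -> xeq N (chords_word (map (relabel t) w))
    (virtual l ++ chords_word w ++ virtual (rev l)).
  move=> hw; apply: xeq_chords.
  - by apply: chords_word_below; apply: hin.
  - by rewrite !positions_cat !positions_virtual !below_cat below_rev hl chords_word_below.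
  - rewrite (@chords_chords_word N) ?size_iota // ?hin // !chords_cat !chords_virtual.
    rewrite cats0 positions_virtual (@chords_chords_word N) ?size_permute ?size_iota //=.
    rewrite -map_comp; apply/eq_in_map => c hc /=.
    by rewrite relabel_iota //; apply: chord_in_relabel => //; apply: (allP hw).
  - by rewrite !positions_cat !positions_virtual !permute_cat !permute_chords_word permuteK.
split; try exact: hin.
apply: teq_trans (H _ h1 _ (leqnn _)) _.
apply: teq_trans (teq_sym (H _ h2 _ (leqnn _))).
rewrite !cross_cat; apply: teq_mid h3.
by rewrite run_cross positions_virtual.
Qed.

Definition orient s p := nth false (map snd s) p.

(* A relation between chords on the leftmost strands holds for any choice of
   strands with the same orientations. *)
Lemma ceq_place s (t : seq nat) u v : uniq t -> all (fun p => p < size s) t ->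
  (forall s', size s' = size s ->
     (forall i, i < size t -> orient s' i = orient s (nth 0 t i)) -> ceq s' u v) ->
  all (chord_in (size t)) u -> all (chord_in (size t)) v ->
  ceq s (map (relabel t) u) (map (relabel t) v).
Proof.
move=> hu ha H hcu hcv; have [l [r [hl El]]] := permute_prefix hu ha.
have E w : all (chord_in (size t)) w ->
    map (relabel t) w = map (relabel (permute l (iota 0 (size s)))) w.
  move=> /allP h; apply/eq_in_map => -[[a b] x] /h /and4P[/= _ h1 h2 _].
  by rewrite /relabel El /= !nth_cat h1 h2.
rewrite !E //; apply: ceq_conj => //; apply: H; first by rewrite size_permute.
move=> i hi; rewrite /orient map_permute (@nth_permute_gen _ false _ _ (size s)).
  rewrite El (nth_map 0) ?nth_cat ?hi //.
  by rewrite size_cat ltn_addr.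
by rewrite size_map.
Qed.

End ChordCalculus.

(** * Distant pieces, kinks and chords at one minimum *)

Section Interchange.

Variables (n : nat) (k : bool).
Implicit Types (s r t : seq (strand n)) (w u v : word n) (e f : piece n).
Notation xeq := (xeq n k).
Notation teq := (@teq n k).

Lemma interchange_piece s1 t1 s2 s2' w q e :
  run s1 w = Some t1 -> step s2 (q, e) = Some s2' ->
  teq (s1 ++ s2) (w ++ [:: (size t1 + q, e)]) ((size s1 + q, e) :: w).
Proof.
elim: w s1 => [|[p f] w IH] s1 /=; first by case=> -> _; apply: teq_refl.
case E: (step s1 (p, f)) => [s1'|] //= hw he.
have [a [x [y [b [Es Es' hp hx]]]]] := step_some E.
apply: (@teq_trans _ _ _ ([:: (p, f)] ++ (size s1' + q, e) :: w)).
  apply: (@teq_catl _ _ _ (s1' ++ s2) [:: (p, f)]); last exact: IH.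
  by rewrite /= Es -!catA -hp (step_act _ _ hx) Es' -!catA.
have H : lmove k (x ++ (b ++ s2)) [:: (0, f); (outputs f + (size b + q), e)]
    [:: (inputs f + (size b + q), e); (0, f)].
  by apply: lm_exchange hx _; rewrite step_cat he.
have := teq_shift a (teq_lmove H); rewrite /shift /= addn0 hp.
have -> : a ++ x ++ b ++ s2 = s1 ++ s2 by rewrite Es -!catA.
have [sx sy] := act_size hx.
have -> : p + (outputs f + (size b + q)) = size s1' + q.
  by rewrite Es' !size_cat -hp sy !addnA.
have -> : p + (inputs f + (size b + q)) = size s1 + q.
  by rewrite Es !size_cat -hp sx !addnA.
by move/(teq_catr w).
Qed.

Lemma interchange_words s1 t1 s2 t2 w v :
  run s1 w = Some t1 -> run s2 v = Some t2 ->
  teq (s1 ++ s2) (w ++ shift (size t1) v) (shift (size s1) v ++ w).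
Proof.
move=> hw; elim: v s2 => [|[q e] v IH] s2 /=.
  by rewrite cats0 => _; apply: teq_refl.
case E: (step s2 (q, e)) => [s2'|] //= hv.
rewrite -cat1s catA; apply: (teq_trans (teq_catr _ (interchange_piece hw E))).
apply: (@teq_catl _ _ _ (s1 ++ s2') [:: _]); last exact: IH.
by rewrite /= step_cat E.
Qed.

Ltac eval_run := rewrite /= ?stepE /= ?stepE /= ?stepE /= ?stepE /= ?stepE /=
  ?eqxx /= ?negbK.

Lemma partner_neq (d : bool) : (d != ~~ d) * (~~ d != d).
Proof. by case: d. Qed.

Lemma teq_local s u v l r a b : run s u = Some (l ++ r) -> lmove k r a b ->
  teq s (u ++ shift (size l) a ++ v) (u ++ shift (size l) b ++ v).
Proof. by move=> h1 h2; apply: rst_step; exact: Tstep h1 h2. Qed.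

Lemma teq_local_sym s u v l r a b : run s u = Some (l ++ r) -> lmove k r a b ->
  teq s (u ++ shift (size l) b ++ v) (u ++ shift (size l) a ++ v).
Proof. by move=> h1 h2; apply: teq_sym; apply: teq_local h1 h2. Qed.

(** Type I moves are given for a kink on a vertical strand. A zigzag inserted below the twisted
    maximum creates such a kink once the crossing has slid through the maximum. *)
Lemma kink_cap0 c d x r :
  teq [:: (c, d), (c, ~~ d) & r] [:: (0, Cross x); (0, Cap)] [:: (0, Cap)].
Proof.
have neq := partner_neq.
apply: (@teq_trans _ _ _ [:: (0, Cross x); (0, Cup c (~~ d)); (1, Cap); (0, Cap)]).
  apply: (@teq_local_sym _ [:: (0, Cross x)] [:: (0, Cap)] [::]
    [:: (c, ~~ d), (c, d) & r] [:: (0, Cup c (~~ d)); (1, Cap)] [::]).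
    by eval_run.
  exact: lm_zigzag_right.
apply: (@teq_trans _ _ _ [:: (0, Cup c (~~ d)); (2, Cross x); (1, Cap); (0, Cap)]).
  apply: (@teq_local_sym _ [::] [:: (1, Cap); (0, Cap)] [::] _
    [:: (0, Cup c (~~ d)); (2 + 0, Cross x)] [:: (0 + 0, Cross x); (0, Cup c (~~ d))]) => //.
  by apply: (@lm_exchange _ _ [::] _ _ _ 0 (Cup c (~~ d)) (Cross x)); rewrite ?step0.
apply: (@teq_trans _ _ _ [:: (0, Cup c (~~ d)); (1, Cross (flip x)); (2, Cap); (0, Cap)]).
  rewrite -{1}[x]flipK.
  apply: (@teq_local_sym _ [:: (0, Cup c (~~ d))] [:: (0, Cap)] [:: (c, ~~ d)]
    [:: (c, d), (c, d), (c, ~~ d) & r] [:: (0, Cross (flip x)); (1, Cap)]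
    [:: (1, Cross (flip (flip x))); (0, Cap)]); last exact: lm_slide_cap.
  by eval_run.
apply: (@teq_trans _ _ _ [:: (0, Cup c (~~ d)); (1, Cross (flip x)); (0, Cap); (0, Cap)]).
  apply: (@teq_local_sym _ [:: (0, Cup c (~~ d)); (1, Cross (flip x))] [::] [::]
    [:: (c, ~~ d), (c, d), (c, d), (c, ~~ d) & r]
    [:: (0, Cap); (0 + 0, Cap)] [:: (2 + 0, Cap); (0, Cap)]); first by eval_run.
  apply: (@lm_exchange _ _ [:: (c, ~~ d); (c, d)] [::] [:: (c, d), (c, ~~ d) & r] r 0 Cap Cap);
    by rewrite /= ?step0 /= eqxx ?neq.
apply: (@teq_local _ [::] [:: (0, Cap)] [::] _
  [:: (0, Cup c (~~ d)); (1, Cross (flip x)); (0, Cap)] [::]) => //.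
by have := @lm_RI_left n k c (~~ d) (flip x) ((c, ~~ d) :: r); rewrite negbK.
Qed.

(** The argument for maxima upside down, starting from the untwisted side. Removing the twist
    exchanges the legs, hence the negated orientation. *)
Lemma kink_cup0 c d x r :
  teq r [:: (0, Cup c d); (0, Cross x)] [:: (0, Cup c (~~ d))].
Proof.
have neq := partner_neq.
apply: teq_sym; set y := flip x.
apply: (@teq_trans _ _ _ [:: (0, Cup c (~~ d)); (0, Cup c d); (1, Cross y); (0, Cap)]).
  apply: (@teq_local_sym _ [:: (0, Cup c (~~ d))] [::] [::] [:: (c, ~~ d), (c, d) & r]
    [:: (0, Cup c d); (1, Cross y); (0, Cap)] [::]).
    by eval_run.
  exact: lm_RI_left.
apply: (@teq_trans _ _ _ [:: (0, Cup c d); (2, Cup c (~~ d)); (1, Cross y); (0, Cap)]).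
  apply: (@teq_local_sym _ [::] [:: (1, Cross y); (0, Cap)] [::] _
    [:: (0, Cup c d); (2 + 0, Cup c (~~ d))] [:: (0 + 0, Cup c (~~ d)); (0, Cup c d)]) => //.
  by apply: (@lm_exchange _ _ [::] _ _ _ 0 (Cup c d) (Cup c (~~ d))); rewrite ?step0.
apply: (@teq_trans _ _ _ [:: (0, Cup c d); (1, Cup c (~~ d)); (2, Cross (flip y)); (0, Cap)]).
  apply: (@teq_local _ [:: (0, Cup c d)] [:: (0, Cap)] [:: (c, d)] ((c, ~~ d) :: r)
    [:: (1, Cup c (~~ d)); (0, Cross y)] [:: (0, Cup c (~~ d)); (1, Cross (flip y))]).
    by eval_run.
  exact: lm_slide_cup.
apply: (@teq_trans _ _ _ [:: (0, Cup c d); (1, Cup c (~~ d)); (0, Cap); (0, Cross (flip y))]).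
  apply: (@teq_local_sym _ [:: (0, Cup c d); (1, Cup c (~~ d))] [::] [::]
    [:: (c, d), (c, ~~ d), (c, d), (c, ~~ d) & r]
    [:: (0, Cap); (0 + 0, Cross (flip y))] [:: (2 + 0, Cross (flip y)); (0, Cap)]).
    by eval_run.
  apply: (@lm_exchange _ _ [:: (c, d); (c, ~~ d)] [::] [:: (c, d), (c, ~~ d) & r] _ 0 Cap
    (Cross (flip y))); by rewrite /= ?step0 /= ?eqxx ?neq.
rewrite /y flipK.
apply: (@teq_local _ [:: (0, Cup c d)] [:: (0, Cross x)] [::] [:: (c, d), (c, ~~ d) & r]
  [:: (1, Cup c (~~ d)); (0, Cap)] [::]); first by eval_run.
by have := @lm_zigzag_left n k c (~~ d) ((c, ~~ d) :: r); rewrite negbK.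
Qed.

Lemma kink_cup s p c d x : p <= size s ->
  teq s [:: (p, Cup c d); (p, Cross x)] [:: (p, Cup c (~~ d))].
Proof.
move=> /split_level[l [r [-> <-]]].
by have := teq_shift l (@kink_cup0 c d x r); rewrite /shift /= addn0.
Qed.

Lemma slide_cup s p c d x : p < size s ->
  teq s [:: (p.+1, Cup c d); (p, Cross x)] [:: (p, Cup c d); (p.+1, Cross (flip x))].
Proof.
move=> hp; have [l [r [E ep]]] := split_level (ltnW hp); subst p.
case: r E => [|b r] E; first by move: hp; rewrite E cats0 ltnn.
have := teq_shift l (teq_lmove (@lm_slide_cup n k c d b x r)).
by rewrite /shift /= addn0 addn1 -E.
Qed.

Lemma step_cup s p c d : p <= size s ->
  step s (p, Cup c d) = Some (take p s ++ [:: (c, d), (c, ~~ d) & drop p s]).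
Proof. by move=> hp; rewrite /step hp take0 /= addn0. Qed.

Lemma size_step_cup s p c d t : step s (p, Cup c d) = Some t -> size t = (size s).+2.
Proof.
case/step_some=> l [x [y [r [-> -> _]]]] /act_size[sx sy].
by rewrite !size_cat sx sy /= add0n !addnS.
Qed.

Lemma chord_via N (l : seq nat) p a b x : below N l -> p.+1 < N -> is_real x ->
  nth 0 (permute l (iota 0 N)) p = a -> nth 0 (permute l (iota 0 N)) p.+1 = b ->
  xeq N (chord_word (a, b, x))
        (virtual l ++ [:: (p, x); (p, Virtual)] ++ virtual (rev l)).
Proof. by move=> h1 h2 h3 <- <-; apply: xeq_sym; apply: xeq_chord_conj. Qed.

Lemma cup_kink_chord s p c d x : p <= size s -> is_real x ->
  teq s ((p, Cup c d) :: cross n (chord_word (p, p.+1, x))) [:: (p, Cup c d)] /\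
  teq s ((p, Cup c d) :: cross n (chord_word (p.+1, p, x))) [:: (p, Cup c d)].
Proof.
move=> hp hx; have hs := step_cup c d hp; set t := (X in Some X) in hs.
have st := size_step_cup hs.
have two y z : teq s [:: (p, Cup c d); (p, Cross y); (p, Cross z)] [:: (p, Cup c d)].
  apply: teq_trans (teq_catr [:: (p, Cross z)] (@kink_cup s p c d y hp)) _.
  by rewrite -{2}[d]negbK; apply: kink_cup.
have N1 : p.+1 < size t by rewrite st.
have via (u : xword) y z : xeq (size t) u [:: (p, y); (p, z)] ->
    teq s ((p, Cup c d) :: cross n u) [:: (p, Cup c d)].
  move=> h; apply: teq_trans (two y z).
  apply: (@teq_catl _ _ _ t [:: (p, Cup c d)]); first by rewrite /= hs.
  exact: h.
split; [apply: (via _ x Virtual)|apply: (via _ Virtual x)].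
  apply: (@xeq_trans _ _ _ (virtual [::] ++ [:: (p, x); (p, Virtual)] ++ virtual (rev [::]))).
    by apply: chord_via; rewrite //= nth_iota // ltnW.
  exact: xeq_refl.
apply: (@xeq_trans _ _ _ (virtual [:: p] ++ [:: (p, x); (p, Virtual)] ++ virtual (rev [:: p]))).
  by apply: chord_via; rewrite /= ?N1 ?nth_swap ?size_iota ?eqxx
    ?(gtn_eqF (ltnSn _)) ?nth_iota // ltnW.
apply: (@xeq_catl _ _ _ [:: (p, Virtual); (p, x)] [:: (p, Virtual); (p, Virtual)] [::]).
  by rewrite /= N1.
exact: xeq_RII.
Qed.

End Interchange.

(** * Chords slide across a minimum *)

Section CupChords.

Variables (n : nat) (k : bool).
Implicit Types (s r t : seq (strand n)) (w u v : word n) (e f : piece n).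
Notation xeq := (xeq n k).
Notation teq := (@teq n k).

Lemma teq_after_cup s p c d t l m : step s (p, Cup c d) = Some t ->
  xeq (size t) l m ->
  teq s ((p, Cup c d) :: cross n l) ((p, Cup c d) :: cross n m).
Proof.
move=> hs h; apply: (@teq_catl n k _ t [:: (p, Cup c d)]); first by rewrite /= hs.
exact: h.
Qed.

Lemma teq_after_cup' s p c d t u v : step s (p, Cup c d) = Some t ->
  teq t u v -> teq s ((p, Cup c d) :: u) ((p, Cup c d) :: v).
Proof.
by move=> hs h; apply: (@teq_catl n k _ t [:: (p, Cup c d)]); rewrite //= hs.
Qed.

(** Once strand [b] stands next to the minimum, its crossing with the left leg slides through the
    minimum and becomes the flipped crossing with the right leg. The virtual path of [b] does not
    touch the minimum and can be drawn below it. *)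
Lemma cup_chord_left s p c d b y : b < p -> p <= size s -> is_real y ->
  teq s ((p, Cup c d) :: cross n (chord_word (b, p, y)))
        ((p, Cup c d) :: cross n (chord_word (p.+1, b, flip y))).
Proof.
case: p => // q hbq hp hy; have hs := step_cup c d hp; set t := (X in Some X) in hs.
have st := size_step_cup hs; set N := size t in st.
(* Carries strand [b] to place [q], immediately left of the minimum. *)
pose W := [seq b + i | i <- iota 0 (q - b)].
have hW : below q.+1 W.
  by rewrite /W -(_ : b + (q - b).+1 = q.+1) ?below_shift ?below_iota //; lia.
have hWN : below N W by apply: below_leq hW; rewrite st; lia.
have EW : permute W (iota 0 N) =
    iota 0 b ++ iota b.+1 (q - b) ++ b :: iota q.+1 (N - q.+1).
  have -> : iota 0 N = iota 0 b ++ b :: iota b.+1 (N - b.+1).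
    have -> : N = b + (N - b.+1).+1 by lia.
    by rewrite iotaD /= add0n; congr (_ ++ _ :: iota _ _); lia.
  rewrite permute_shift ?size_iota // permute_iota ?size_iota; last by lia.
  congr (_ ++ _); rewrite (_ : N - b.+1 = (q - b) + (N - q.+1)); last by lia.
  rewrite iotaD take_size_cat ?size_iota // drop_size_cat ?size_iota //.
  by rewrite (_ : b.+1 + (q - b) = q.+1) //; lia.
have nW i : nth 0 (permute W (iota 0 N)) i =
    if i < b then i else if i < q then i.+1 else if i == q then b else
      nth 0 (iota q.+1 (N - q.+1)) (i - q.+1).
  rewrite EW nth_cat size_iota; case: ltnP => hi; first by rewrite nth_iota.
  rewrite nth_cat size_iota; case: ltnP => hi'.
    by rewrite nth_iota //; case: ltnP; lia.
  case: ltnP; first lia; move=> hq; rewrite -subnDA subnKC; last lia.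
  case: eqP => [->|hne]; first by rewrite subnn.
  by have -> : i - q = (i - q.+1).+1 by lia.
(* Takes [b] further, past both legs, so that it meets the right leg at [q.+1]. *)
pose W2 := W ++ [:: q; q.+1].
have hW2 : below N W2 by rewrite below_cat hWN /= st; lia.
have H1 : xeq N (chord_word (b, q.+1, y))
    (virtual W ++ [:: (q, y); (q, Virtual)] ++ virtual (rev W)).
  apply: chord_via => //; first by rewrite st; lia.
    by rewrite nW; case: ltnP; first lia; rewrite ltnn eqxx.
  rewrite nW; case: ltnP; first lia; move=> _; case: ltnP; first lia; move=> _.
  by rewrite gtn_eqF // subnn nth_iota ?addn0 //; rewrite st; lia.
have H2 : xeq N (chord_word (q.+2, b, flip y))
    (virtual W2 ++ [:: (q.+1, flip y); (q.+1, Virtual)] ++ virtual (rev W2)).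
  have q1 : q.+1 < size (permute W (iota 0 N)).
    by rewrite size_permute size_iota st; lia.
  have q2 : q.+2 < size (permute W (iota 0 N)).
    by rewrite size_permute size_iota st; lia.
  apply: chord_via => //; first by rewrite st; lia.
  - by rewrite is_real_flip.
  - rewrite permute_cat -[permute [:: q; q.+1] _]/(swap q.+1 (swap q _)).
    rewrite !nth_swap ?size_swap // eqxx (gtn_eqF (leqnSn _)) (gtn_eqF (ltnSn q.+1)).
    rewrite nW; case: ltnP; first lia; move=> _; case: ltnP; first lia; move=> _.
    by rewrite gtn_eqF // subSnn nth_iota ?addn1 //; rewrite st; lia.
  - rewrite permute_cat -[permute [:: q; q.+1] _]/(swap q.+1 (swap q _)).
    rewrite !nth_swap ?size_swap // eqxx (gtn_eqF (ltnSn q.+1)).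
    rewrite (gtn_eqF (ltnSn q)) eqxx.
    by rewrite nW; case: ltnP; first lia; rewrite ltnn eqxx.
apply: (teq_trans (teq_after_cup hs H1)).
apply: teq_trans (teq_sym (teq_after_cup hs H2)).
have [s1 [s2 [Es hs1]]] := split_level hp.
have hcw : teq s ((q.+1, Cup c d) :: cross n (virtual W)) (cross n (virtual W) ++ [:: (q.+1, Cup c d)]).
  have := @interchange_piece n k s1 _ s2 _ (cross n (virtual W)) 0 (Cup c d)
    (run_cross (l := virtual W) _) (step0 _ _).
  rewrite positions_virtual hs1 -Es size_permute hs1 addn0 => H.
  by apply: teq_sym; apply: H.
have sp : size (permute W s) = size s by rewrite size_permute.
have rW : run s (cross n (virtual W)) = Some (permute W s).
  by rewrite run_cross positions_virtual // (below_leq hp).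
set s' := permute W s in sp rW; rewrite -sp in hp.
have hs' := step_cup c d hp; set t' := (X in Some X) in hs'.
have st' := size_step_cup hs'.
have qN : q.+2 < size t' by rewrite st' sp; lia.
have start z : teq s' [:: (q.+1, Cup c d); (q, Cross z)] [:: (q, Cup c d); (q.+1, Cross (flip z))].
  exact: slide_cup.
have hs'' := step_cup c d (ltnW hp); set t'' := (X in Some X) in hs''.
have st'' := size_step_cup hs''.
have loc : teq s' [:: (q.+1, Cup c d); (q, Cross y); (q, Cross Virtual)]
    [:: (q.+1, Cup c d); (q, Cross Virtual); (q.+1, Cross Virtual);
        (q.+1, Cross (flip y)); (q, Cross Virtual)].
  apply: (@teq_trans _ _ _ [:: (q, Cup c d); (q.+1, Cross (flip y)); (q, Cross Virtual)]).
    exact: (teq_catr [:: (q, Cross Virtual)] (start y)).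
  apply: (@teq_trans _ _ _ [:: (q, Cup c d); (q.+1, Cross Virtual); (q.+1, Cross Virtual);
        (q.+1, Cross (flip y)); (q, Cross Virtual)]); last first.
    apply: teq_sym; exact: (teq_catr [:: (q.+1, Cross Virtual); (q.+1, Cross (flip y)); (q, Cross Virtual)] (start Virtual)).
  apply: (@teq_after_cup _ _ _ _ _ [:: (q.+1, flip y); (q, Virtual)]
    [:: (q.+1, Virtual); (q.+1, Virtual); (q.+1, flip y); (q, Virtual)] hs'').
  apply: (@xeq_catr _ _ _ [::] [:: (q.+1, Virtual); (q.+1, Virtual)]).
  by apply: xeq_sym; apply: xeq_RII; rewrite st''; lia.
rewrite !cross_cat -!cat_cons.
apply: (@teq_trans _ _ _ ((cross n (virtual W) ++ [:: (q.+1, Cup c d)]) ++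
   (cross n [:: (q, y); (q, Virtual)] ++ cross n (virtual (rev W))))).
  exact: teq_catr.
apply: (@teq_trans _ _ _ ((cross n (virtual W) ++ [:: (q.+1, Cup c d)]) ++
   (cross n [:: (q, Virtual); (q.+1, Virtual); (q.+1, flip y); (q, Virtual)]
    ++ cross n (virtual (rev W))))).
  rewrite -!catA; apply: (teq_catl rW).
  exact: (teq_catr _ loc).
apply: teq_sym; rewrite /W2 rev_cat !virtual_cat !cross_cat.
apply: (@teq_trans _ _ _ ((cross n (virtual W) ++ [:: (q.+1, Cup c d)]) ++
   (cross n (virtual [:: q; q.+1]) ++ cross n [:: (q.+1, flip y); (q.+1, Virtual)]
    ++ cross n (virtual (rev [:: q; q.+1])) ++ cross n (virtual (rev W))))).
  rewrite -!catA -cat_cons [X in teq _ _ X]catA.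
  by rewrite -[X in teq _ X _]catA; apply: teq_catr.
rewrite -!catA; apply: (teq_catl rW); rewrite !catA; apply: teq_catr.
apply: (@teq_after_cup _ _ _ _ _ [:: (q, Virtual); (q.+1, Virtual); (q.+1, flip y);
   (q.+1, Virtual); (q.+1, Virtual); (q, Virtual)]
  [:: (q, Virtual); (q.+1, Virtual); (q.+1, flip y); (q, Virtual)] hs').
apply: (@xeq_mid _ _ _ [:: (q, Virtual); (q.+1, Virtual); (q.+1, flip y)]
  [:: (q.+1, Virtual); (q.+1, Virtual)] [::] [:: (q, Virtual)]).
  by rewrite /= !qN (ltnW qN).
exact: xeq_RII.
Qed.

(** A virtual twist of the minimum exchanges its legs and reduces the statement to [cup_chord_left]
    with the opposite orientation. *)
Lemma cup_chord_right s p c d b y : b < p -> p <= size s -> is_real y ->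
  teq s ((p, Cup c d) :: cross n (chord_word (b, p.+1, y)))
        ((p, Cup c d) :: cross n (chord_word (p, b, flip y))).
Proof.
move=> hb hp hy.
have hs := step_cup c d hp; have hs' := step_cup c (~~ d) hp.
set t := (X in Some X) in hs; set t' := (X in Some X) in hs'.
have st := size_step_cup hs; have st' := size_step_cup hs'.
have hk : teq s [:: (p, Cup c d)] [:: (p, Cup c (~~ d)); (p, Cross Virtual)].
  by apply: teq_sym; rewrite -{2}[d]negbK; apply: kink_cup.
set N := size t' in st'.
have e1 := gtn_eqF (ltnSn p); have e2 := ltn_eqF hb.
have e3 := ltn_eqF (ltn_trans hb (ltnSn p)).
have p1 : p.+1 < N by rewrite st'; lia.
have swapped c1 : chord_in N c1 -> xeq N ([:: (p, Virtual)] ++ chord_word c1)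
    (chord_word (relabel (swap p (iota 0 N)) c1) ++ [:: (p, Virtual)]).
  move=> hc; have hc' : chord_in N (relabel (swap p (iota 0 N)) c1).
    by apply: chord_in_relabel => //; apply: perm_swap.
  apply: xeq_chords.
  - by rewrite positions_cat below_cat chord_word_below //= p1.
  - by rewrite positions_cat below_cat chord_word_below //= p1.
  - rewrite (chords_cat _ [:: (p, Virtual)]) (chords_cat _ _ [:: (p, Virtual)]).
    rewrite (chords_chord_word hc') ?size_iota // relabel_iota //.
    by rewrite (chords_chord_word hc) // size_swap size_iota.
  rewrite (positions_cat [:: (p, Virtual)]) (positions_cat _ [:: (p, Virtual)]).
  by rewrite !permute_cat !permute_chord_word.
have c1 : chord_in N (b, p.+1, y) by apply/and4P; split=> //=; rewrite ?e3 // st'; lia.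
have c2 : chord_in N (p, b, flip y).
  by apply/and4P; split=> //=; rewrite ?is_real_flip ?gtn_eqF // st'; lia.
have r1 : relabel (swap p (iota 0 N)) (b, p.+1, y) = (b, p, y).
  rewrite /relabel /= !nth_swap ?size_iota // eqxx e1 e2 e3 !nth_iota //; first exact: ltnW.
  by rewrite st'; lia.
have r2 : relabel (swap p (iota 0 N)) (p, b, flip y) = (p.+1, b, flip y).
  rewrite /relabel /= !nth_swap ?size_iota // eqxx e2 e3 !nth_iota //.
  by rewrite st'; lia.
have via (c0 : chord) : chord_in N c0 ->
   teq s ((p, Cup c d) :: cross n (chord_word c0)) ((p, Cup c (~~ d)) ::
     cross n (chord_word (relabel (swap p (iota 0 N)) c0) ++ [:: (p, Virtual)])).
  move=> h0; apply: teq_trans (teq_catr _ hk) _.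
  exact: (teq_after_cup hs' (swapped _ h0)).
apply: (teq_trans (via _ c1)); apply: teq_trans (teq_sym (via _ c2)).
rewrite r1 r2 !(cross_cat _ _ [:: (p, Virtual)]) -!cat_cons; apply: teq_catr.
exact: cup_chord_left.
Qed.

End CupChords.

(** * Inverses and the triangle relation *)

Section ChordGroup.

Variables (n : nat) (k : bool).
Implicit Types (s : seq (strand n)) (x y z : chord) (u v w : seq chord).
Notation ceq := (@ceq n k).

Definition inv_chords u := rev (map inv_chord u).

Lemma inv_chords_cons x u : inv_chords (x :: u) = inv_chords u ++ [:: inv_chord x].
Proof. by rewrite /inv_chords /= rev_cons cats1. Qed.

Lemma inv_chordsK u : inv_chords (inv_chords u) = u.
Proof. by rewrite /inv_chords map_rev revK -map_comp (eq_map inv_chordK) map_id. Qed.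

Lemma chord_in_inv_chords N u : all (chord_in N) (inv_chords u) = all (chord_in N) u.
Proof.
by rewrite /inv_chords all_rev all_map; apply: eq_all => c; rewrite /= chord_in_inv.
Qed.

Lemma ceq_mid s u v w1 w2 : all (chord_in (size s)) w1 -> all (chord_in (size s)) w2 ->
  ceq s u v -> ceq s (w1 ++ u ++ w2) (w1 ++ v ++ w2).
Proof.
move=> h1 h2 h; apply: ceq_cat; first exact: ceq_refl.
by apply: ceq_cat => //; apply: ceq_refl.
Qed.

Lemma ceq_invs_r s u : all (chord_in (size s)) u -> ceq s (u ++ inv_chords u) [::].
Proof.
elim: u => [_|x u IH] /=; first exact: ceq_refl.
case/andP => hx /[dup] hu /IH h; rewrite inv_chords_cons.
apply: (@ceq_trans _ _ _ ([:: x] ++ [:: inv_chord x])); last exact: ceq_invr.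
have -> : x :: u ++ inv_chords u ++ [:: inv_chord x] =
    [:: x] ++ (u ++ inv_chords u) ++ [:: inv_chord x] by rewrite /= catA.
by apply: (@ceq_mid s _ [::]) => //=; rewrite ?chord_in_inv hx.
Qed.

Lemma ceq_invs_l s u : all (chord_in (size s)) u -> ceq s (inv_chords u ++ u) [::].
Proof.
move=> hu; have := @ceq_invs_r s (inv_chords u).
by rewrite chord_in_inv_chords inv_chordsK; apply.
Qed.

Lemma ceq_inv s u v : ceq s u v -> ceq s (inv_chords u) (inv_chords v).
Proof.
move=> h; have [hu hv _] := h.
have hu' : all (chord_in (size s)) (inv_chords u) by rewrite chord_in_inv_chords.
have hv' : all (chord_in (size s)) (inv_chords v) by rewrite chord_in_inv_chords.
apply: (@ceq_trans _ _ _ (inv_chords u ++ v ++ inv_chords v)).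
  have := @ceq_mid s [::] (v ++ inv_chords v) (inv_chords u) [::] hu' isT.
  by rewrite !cats0; apply; apply: ceq_sym; apply: ceq_invs_r.
apply: (@ceq_trans _ _ _ (inv_chords u ++ u ++ inv_chords v)).
  by apply: ceq_mid => //; apply: ceq_sym.
rewrite catA; apply: (@ceq_mid s _ [::] [::] (inv_chords v)) => //.
exact: ceq_invs_l.
Qed.

Lemma ceq_solve s x y z :
  ceq s [:: inv_chord x; y; inv_chord z] [::] -> ceq s [:: y] [:: x; z].
Proof.
move=> h; have [/and4P[hx hy hz _] _ _] := h.
rewrite !chord_in_inv in hx hz.
apply: (@ceq_trans _ _ _ ([:: x; inv_chord x] ++ [:: y] ++ [:: inv_chord z; z])).
  have := ceq_sym (ceq_cat (ceq_invr k hx) (ceq_cat (@ceq_refl n k s [:: y] _) (ceq_invl k hz))).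
  by apply; rewrite /= hy.
by apply: (@ceq_mid s [:: inv_chord x; y; inv_chord z] [::] [:: x] [:: z]) => //=;
  rewrite ?hx ?hz.
Qed.

Lemma ceq_solve' s x y z :
  ceq s [:: x; inv_chord y; z] [::] -> ceq s [:: y] [:: z; x].
Proof.
move=> h; apply: ceq_solve; have := ceq_inv h.
by rewrite /inv_chords /= /rev /= inv_chordK.
Qed.

Definition arrow a b : chord := (a, b, Over).

(* The form in which either extra move is used: it restates [vdelta], and
   is derived from [vpass] by bending a strand into a zigzag. *)
Definition triangle_relation s := forall a b c,
  uniq [:: a; b; c] -> all (fun p => p < size s) [:: a; b; c] ->
  orient s c = orient s a -> orient s b = ~~ orient s a ->
  ceq s [:: arrow c a] [:: arrow a b; arrow b c] /\
  ceq s [:: arrow c a] [:: arrow b c; arrow a b].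

(** The chords of the real side of the move, followed by the virtual inverse of its permutation: the
    move makes everything virtual, with trivial permutation. The two forms of the move give the two
    orders of the product. *)
Lemma vdelta_chords (a b c : 'I_n) d r : k ->
  ceq [:: (a, d), (b, ~~ d), (c, d) & r]
    [:: (0, 1, Over); (0, 2, Under); (1, 2, Over)] [::] /\
  ceq [:: (a, d), (b, ~~ d), (c, d) & r]
    [:: (1, 2, Over); (0, 2, Under); (0, 1, Over)] [::].
Proof.
move=> hk; set s := (X in ceq X).
have hs : 3 <= size s by [].
split; (split; [by []|by []|]).
  apply: (@teq_trans _ _ _ (cross n ([:: (0, Over); (1, Under); (0, Over)] ++ virtual [:: 0; 1; 0]))).
    by have /(_ s hs) := @xeq_chords n k 3 (chords_word [:: (0, 1, Over); (0, 2, Under); (1, 2, Over)])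
      ([:: (0, Over); (1, Under); (0, Over)] ++ virtual [:: 0; 1; 0]) isT isT erefl erefl.
  apply: (@teq_trans _ _ _ (cross n (virtual [:: 0; 1; 0; 0; 1; 0]))).
    apply: (@teq_catr _ _ _ (cross n [:: (0, Over); (1, Under); (0, Over)])
      (cross n (virtual [:: 0; 1; 0])) (cross n (virtual [:: 0; 1; 0]))); apply: teq_lmove.
    exact: (@lm_delta_right n k a b c Over d r).
  exact: (@xeq_virtual n k 3 [:: 0; 1; 0; 0; 1; 0] [::] isT isT erefl s hs).
apply: (@teq_trans _ _ _ (cross n ([:: (1, Over); (0, Under); (1, Over)] ++ virtual [:: 1; 0; 1]))).
  by have /(_ s hs) := @xeq_chords n k 3 (chords_word [:: (1, 2, Over); (0, 2, Under); (0, 1, Over)])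
    ([:: (1, Over); (0, Under); (1, Over)] ++ virtual [:: 1; 0; 1]) isT isT erefl erefl.
apply: (@teq_trans _ _ _ (cross n (virtual [:: 1; 0; 1; 1; 0; 1]))).
  apply: (@teq_catr _ _ _ (cross n [:: (1, Over); (0, Under); (1, Over)])
    (cross n (virtual [:: 1; 0; 1])) (cross n (virtual [:: 1; 0; 1]))); apply: teq_lmove.
  exact: (@lm_delta_left n k a b c Over d r).
exact: (@xeq_virtual n k 3 [:: 1; 0; 1; 1; 0; 1] [::] isT isT erefl s hs).
Qed.

Lemma triangle_relation_vdelta s : k -> triangle_relation s.
Proof.
move=> hk a b c hu ha oc ob.
have place u : all (chord_in 3) u -> (forall a' b' c' d r,
     ceq [:: (a', d), (b', ~~ d), (c', d) & r] u [::]) ->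
   ceq s (map (relabel [:: a; b; c]) u) [::].
  move=> hcu H; apply: (@ceq_place n k s [:: a; b; c] u [::]) => // s' hs' ho.
  have := size_map snd s'; have := ho 0 isT; have := ho 1 isT; have := ho 2 isT.
  rewrite /= oc ob; have : 3 <= size s'.
    rewrite hs'; move: hu ha => /=; rewrite !inE; lia.
  case: s' {hs' ho} => [|[a' d1] [|[b' d2] [|[c' d3] r]]] //= _.
  by rewrite /orient /= => -> -> <- _; apply: H.
split.
  by apply: ceq_solve'; apply: (place [:: (1, 2, Over); (0, 2, Under); (0, 1, Over)]) => // *;
    apply: (proj2 (vdelta_chords _ _ _ _ _ hk)).
by apply: ceq_solve'; apply: (place [:: (0, 1, Over); (0, 2, Under); (1, 2, Over)]) => // *;
  apply: (proj1 (vdelta_chords _ _ _ _ _ hk)).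
Qed.

End ChordGroup.

(** * The triangle relation from the pass move *)

Section PassMoves.

Variables (n : nat) (k : bool).
Hypothesis hk : ~~ k.
Implicit Types (s r : seq (strand n)) (u v : seq chord).
Notation ceq := (@ceq n k).
Notation teq := (@teq n k).
Notation xeq := (xeq n k).

(** The inverse of [arrow b a]. *)
Definition coarrow a b : chord := (a, b, Under).

Lemma pass_chords0 (a b c d : 'I_n) o o' r :
  ceq [:: (a, o), (b, ~~ o), (c, o'), (d, ~~ o') & r]
    [:: arrow 1 2; arrow 0 2; arrow 1 3; arrow 0 3] [::].
Proof.
set s := (X in ceq X); have hs : 4 <= size s by [].
split; [by []|by []|].
apply: (@teq_trans _ _ _ (cross n ([:: (1, Over); (0, Over); (2, Over); (1, Over)]
    ++ virtual [:: 1; 2; 0; 1]))).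
  by have /(_ s hs) := @xeq_chords n k 4
    (chords_word [:: arrow 1 2; arrow 0 2; arrow 1 3; arrow 0 3])
    ([:: (1, Over); (0, Over); (2, Over); (1, Over)] ++ virtual [:: 1; 2; 0; 1])
    isT isT erefl erefl.
apply: (@teq_trans _ _ _ (cross n (virtual [:: 1; 0; 2; 1; 1; 2; 0; 1]))).
  apply: (@teq_catr _ _ _ (pass n 0 Over) (pass n 0 Virtual)
    (cross n (virtual [:: 1; 2; 0; 1]))); apply: teq_lmove.
  exact: lm_pass.
exact: (@xeq_virtual n k 4 [:: 1; 0; 2; 1; 1; 2; 0; 1] [::] isT isT erefl s hs).
Qed.

Lemma pass_chords s a b c d : uniq [:: a; b; c; d] ->
  all (fun p => p < size s) [:: a; b; c; d] ->
  orient s b = ~~ orient s a -> orient s d = ~~ orient s c ->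
  ceq s [:: arrow b c; arrow a c; arrow b d; arrow a d] [::].
Proof.
move=> hu ha ob od.
apply: (@ceq_place n k s [:: a; b; c; d]
  [:: arrow 1 2; arrow 0 2; arrow 1 3; arrow 0 3] [::]) => // s' hs' ho.
have := ho 0 isT; have := ho 1 isT; have := ho 2 isT; have := ho 3 isT.
rewrite /= ob od; have : 4 <= size s'.
  by rewrite hs'; move: hu ha => /=; rewrite !inE; lia.
case: s' {hs' ho} => [|[a' d1] [|[b' d2] [|[c' d3] [|[d' d4] r]]]] //= _.
rewrite /orient /= => -> <- -> <-; exact: pass_chords0.
Qed.

Lemma cap_kink (c : 'I_n) d (a b : strand n) r :
  teq [:: a, b, (c, d), (c, ~~ d) & r]
    (cross n (chords_word [:: arrow 2 3]) ++ [:: (2, Cap)]) [:: (2, Cap)].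
Proof.
set s := (X in teq X); have hs : 4 <= size s by [].
apply: (@teq_trans _ _ _ (cross n [:: (2, Over); (2, Virtual)] ++ [:: (2, Cap)])).
  apply: teq_catr; exact: (@xeq_chords n k 4 (chords_word [:: arrow 2 3])
    [:: (2, Over); (2, Virtual)] isT isT erefl erefl s hs).
apply: (@teq_trans _ _ _ [:: (2, Cross Over); (2, Cap)]).
  apply: (@teq_catl n k s [:: a, b, (c, ~~ d), (c, d) & r] [:: (2, Cross Over)]).
    by rewrite /= ?stepE.
  have := @teq_shift n k [:: a; b] _ _ _ (@kink_cap0 n k c (~~ d) Virtual r).
  by rewrite negbK.
exact: (@teq_shift n k [:: a; b] _ _ _ (@kink_cap0 n k c d Over r)).
Qed.

(** The counterpart at a maximum of [cup_chord_right], in the one position that [bent_left] uses. *)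
Lemma cap_slide (c : 'I_n) d (a b : strand n) r :
  teq [:: a, b, (c, d), (c, ~~ d) & r]
    (cross n (chords_word [:: arrow 0 3]) ++ [:: (2, Cap)])
    (cross n (chords_word [:: coarrow 2 0]) ++ [:: (2, Cap)]).
Proof.
set s := (X in teq X); have hs : 4 <= size s by [].
pose s' := [:: b, (c, d), a, (c, ~~ d) & r].
have r1 : run s (cross n (virtual [:: 0; 1])) = Some s' by rewrite run_cross.
have sl x : teq s' [:: (1, Cross x); (2, Cap)] [:: (2, Cross (flip x)); (1, Cap)].
  exact: (@teq_shift n k [:: b] _ _ _ (teq_lmove (@lm_slide_cap n k c d a x r))).
have cm t : teq [:: t, a, (c, d), (c, ~~ d) & r]
    [:: (0, Cross Virtual); (2, Cap)] [:: (2, Cap); (0, Cross Virtual)].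
  apply: (@interchange_piece n k [:: t; a] [:: a; t] [:: (c, d), (c, ~~ d) & r] r [:: (0, Cross Virtual)] 0 Cap).
    by rewrite /= ?stepE.
  by rewrite step0 /= eqxx; case: (d).
apply: (@teq_trans _ _ _ (cross n (virtual [:: 0; 1]) ++
   [:: (2, Cross Over); (1, Cap); (0, Cross Virtual)])).
  apply: (@teq_trans _ _ _ (cross n (virtual [:: 0; 1]) ++
     [:: (2, Cross Over); (2, Cross Virtual); (1, Cross Virtual); (0, Cross Virtual); (2, Cap)])).
    apply: (@teq_catr _ _ _ _ (cross n (virtual [:: 0; 1] ++ [:: (2, Over); (2, Virtual)]
       ++ virtual [:: 1; 0]))).
    by apply: (@xeq_chords n k 4) => //.
  apply: (teq_catl r1).
  apply: (@teq_catl _ _ _ [:: b, (c, d), (c, ~~ d), a & r] [:: (2, Cross Over)]).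
    by rewrite /= ?stepE.
  set s2 := (X in teq X).
  apply: (@teq_trans _ _ _ [:: (2, Cross Virtual); (1, Cross Virtual); (2, Cap); (0, Cross Virtual)]).
    apply: (@teq_catl _ _ _ [:: b, a, (c, d), (c, ~~ d) & r]
      [:: (2, Cross Virtual); (1, Cross Virtual)]); last exact: cm.
    by rewrite /= ?stepE /= ?stepE.
  apply: (@teq_trans _ _ _ [:: (2, Cross Virtual); (2, Cross Virtual); (1, Cap); (0, Cross Virtual)]).
    apply: (@teq_catl _ _ _ s' [:: (2, Cross Virtual)]); first by rewrite /= ?stepE.
    exact: (teq_catr [:: (0, Cross Virtual)] (sl Virtual)).
  apply: (@teq_catr _ _ _ [:: (2, Cross Virtual); (2, Cross Virtual)] [::]).
  by apply: (@xeq_RII n k 4 2 Virtual).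
apply: teq_sym.
apply: (@teq_trans _ _ _ (cross n (virtual [:: 0; 1]) ++
   [:: (1, Cross Under); (0, Cross Virtual); (2, Cap)])).
  apply: (@teq_catr _ _ _ _ (cross n [:: (0, Virtual); (1, Virtual); (1, Under); (0, Virtual)])).
  by apply: (@xeq_chords n k 4) => //.
apply: (teq_catl r1).
apply: (@teq_trans _ _ _ [:: (1, Cross Under); (2, Cap); (0, Cross Virtual)]).
  apply: (@teq_catl _ _ _ [:: b, a, (c, d), (c, ~~ d) & r] [:: (1, Cross Under)]).
    by rewrite /= ?stepE.
  exact: cm.
exact: (teq_catr [:: (0, Cross Virtual)] (sl Under)).
Qed.


Lemma cross_cons (c0 : chord) u :
  cross n (chords_word (c0 :: u)) = cross n (chord_word c0) ++ cross n (chords_word u).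
Proof. exact: cross_cat. Qed.

(* The relations are found by bending the strand at [2] into a zigzag: a chord
   of the pass relation between two of its legs is a kink and disappears. *)
Lemma bent_right (a b c : 'I_n) d r :
  ceq [:: (a, ~~ d), (b, d), (c, d) & r]
    [:: coarrow 2 0; arrow 2 1; arrow 0 1] [::].
Proof.
set s := (X in ceq X); have hs : 3 <= size s by [].
split; [by []|by []|]; set W := cross n _.
pose s5 := [:: (a, ~~ d), (b, d), (c, d), (c, ~~ d), (c, d) & r].
have c1 : step s (2, Cup c d) = Some s5 by rewrite /s -cat1s !stepE.
have zz (v : word n) : teq s ([:: (2, Cup c d); (3, Cap)] ++ v) v.
  have := @teq_shift n k [:: (a, ~~ d); (b, d)] _ _ _ (teq_lmove (@lm_zigzag_right n k c d r)).
  by move/(teq_catr v).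
apply: teq_trans (zz [::]).
(* The antiparallel pairs are (0, 2) and (3, 1). Strands 2 and 3 are the legs of the new minimum, so
   the first chord is a kink; the second slides from leg 3 to leg 2. *)
have rel : teq s5 (cross n (chords_word [:: arrow 2 3; arrow 0 3; arrow 2 1; arrow 0 1])) [::].
  by have [_ _] : ceq s5 [:: arrow 2 3; arrow 0 3; arrow 2 1; arrow 0 1] [::]
    by apply: (@pass_chords s5 0 2 3 1) => //; rewrite /orient /= ?negbK.
apply: (@teq_trans _ _ _ ((2, Cup c d) :: (W ++ [:: (3, Cap)]))).
  apply: teq_sym; apply: teq_trans (zz W).
  apply: (teq_after_cup' c1).
  have := @interchange_piece n k [:: (a, ~~ d); (b, d); (c, d)] [:: (a, ~~ d); (b, d); (c, d)]
    [:: (c, ~~ d), (c, d) & r] r W 0 Cap.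
  apply; first by rewrite /W run_chords.
  by rewrite step0 /= eqxx; case: (d).
apply: teq_sym.
apply: (@teq_trans _ _ _ ((2, Cup c d) :: (cross n (chords_word [:: arrow 2 3; arrow 0 3; arrow 2 1; arrow 0 1])
   ++ [:: (3, Cap)]))).
  by apply: (teq_after_cup' c1); apply: teq_sym; apply: (teq_catr [:: (3, Cap)] rel).
rewrite -!cat_cons; apply: teq_catr; rewrite /W !cross_cons.
apply: (@teq_trans _ _ _ ([:: (2, Cup c d)] ++ cross n (chord_word (arrow 0 3)) ++
    cross n (chord_word (arrow 2 1)) ++ cross n (chord_word (arrow 0 1)))).
  rewrite -cat_cons cats0.
  by apply: teq_catr; apply: (proj1 (@cup_kink_chord n k s 2 c d Over isT isT)).
rewrite cat1s -!cat_cons cats0; apply: teq_catr.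
exact: (@cup_chord_right n k s 2 c d 0 Over).
Qed.

(** Here the zigzag is bent the other way, so the chord between strands 2 and 3 is the last one and
    is a kink at the maximum. This gives the product of [bent_right] in reverse order. *)
Lemma bent_left (a b c : 'I_n) d r :
  ceq [:: (a, ~~ d), (b, d), (c, d) & r]
    [:: arrow 0 1; arrow 2 1; coarrow 2 0] [::].
Proof.
set s := (X in ceq X); have hs : 3 <= size s by [].
split; [by []|by []|]; set W := cross n _.
pose s5 := [:: (a, ~~ d), (b, d), (c, d), (c, ~~ d), (c, d) & r].
have c1 : step s (3, Cup c (~~ d)) = Some s5 by rewrite /s -cat1s !stepE /= negbK.
have zz : teq s [:: (3, Cup c (~~ d)); (2, Cap)] [::].
  have := @teq_shift n k [:: (a, ~~ d); (b, d)] _ _ _ (teq_lmove (@lm_zigzag_left n k c (~~ d) r)).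
  by rewrite negbK.
have rW : run s W = Some s by rewrite /W run_chords.
apply: teq_trans (zz).
have rel : teq s5 (cross n (chords_word [:: arrow 0 1; arrow 2 1; arrow 0 3; arrow 2 3])) [::].
  by have [_ _] : ceq s5 [:: arrow 0 1; arrow 2 1; arrow 0 3; arrow 2 3] [::]
    by apply: (@pass_chords s5 2 0 1 3) => //; rewrite /orient /= ?negbK.
apply: (@teq_trans _ _ _ (W ++ [:: (3, Cup c (~~ d)); (2, Cap)])).
  rewrite -{1}[W]cats0; apply: (teq_catl rW); exact: teq_sym zz.
apply: (@teq_trans _ _ _ ((3, Cup c (~~ d)) :: (W ++ [:: (2, Cap)]))).
  rewrite -cat_cons -[[:: _; (2, Cap)]]cat1s catA; apply: teq_catr.
  apply: (@interchange_piece n k [:: (a, ~~ d); (b, d); (c, d)] [:: (a, ~~ d); (b, d); (c, d)]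
    r _ W 0 (Cup c (~~ d))); first by rewrite /W run_chords.
  by rewrite step0.
apply: teq_sym.
apply: (@teq_trans _ _ _ ((3, Cup c (~~ d)) :: (cross n (chords_word
   [:: arrow 0 1; arrow 2 1; arrow 0 3; arrow 2 3]) ++ [:: (2, Cap)]))).
  by apply: (teq_after_cup' c1); apply: teq_sym; apply: (teq_catr [:: (2, Cap)] rel).
apply: (teq_after_cup' c1).
pose u := [:: arrow 0 1; arrow 2 1].
have ru : run s5 (cross n (chords_word u)) = Some s5 by rewrite run_chords.
apply: (@teq_trans _ _ _ (cross n (chords_word u) ++ cross n (chords_word [:: arrow 0 3]) ++ [:: (2, Cap)])).
  rewrite -[_ :: _]/(u ++ [:: arrow 0 3] ++ [:: arrow 2 3]) !chords_word_cat !cross_cat -!catA.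
  apply: (teq_catl ru).
  apply: (@teq_catl _ _ _ s5 (cross n (chords_word [:: arrow 0 3]))).
    by rewrite run_chords.
  exact: cap_kink.
rewrite /W -[[:: arrow 0 1; _; _]]/(u ++ [:: coarrow 2 0]) !chords_word_cat !cross_cat -!catA.
apply: (teq_catl ru); exact: cap_slide.
Qed.

Lemma place3 s a b c u : uniq [:: a; b; c] -> all (fun p => p < size s) [:: a; b; c] ->
  orient s b = orient s c -> orient s a = ~~ orient s b -> all (chord_in 3) u ->
  (forall a' b' c' d r, ceq [:: (a', ~~ d), (b', d), (c', d) & r] u [::]) ->
  ceq s (map (relabel [:: a; b; c]) u) [::].
Proof.
move=> hu ha ob oa hcu H.
apply: (@ceq_place n k s [:: a; b; c] u [::]) => // s' hs' ho.
have := ho 0 isT; have := ho 1 isT; have := ho 2 isT.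
rewrite /= oa ob; have : 3 <= size s'.
  by rewrite hs'; move: hu ha => /=; rewrite !inE; lia.
case: s' {hs' ho} => [|[a' d1] [|[b' d2] [|[c' d3] r]]] //= _.
by rewrite /orient /= => <- -> ->; apply: H.
Qed.

(** Bending once more, now applied to [bent_left] on the strands 1, 2, 0: the chord between 1 and 2
    is a kink at the minimum, and the one between 0 and 2 slides to strand 1. The outcome is
    $c_{ba}=c_{ab}^{-1}$ for oppositely oriented strands. *)
Lemma antisymmetry0 (a b : 'I_n) d r :
  ceq [:: (a, ~~ d), (b, d) & r] [:: coarrow 1 0; coarrow 0 1] [::].
Proof.
set s := (X in ceq X); have hs : 2 <= size s by [].
split; [by []|by []|]; set W := cross n _.
pose s4 := [:: (a, ~~ d), (b, d), (b, ~~ d), (b, d) & r].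
have c1 : step s (1, Cup b d) = Some s4 by rewrite /s -cat1s !stepE.
have zz (v : word n) : teq s ([:: (1, Cup b d); (2, Cap)] ++ v) v.
  have := @teq_shift n k [:: (a, ~~ d)] _ _ _ (teq_lmove (@lm_zigzag_right n k b d r)).
  by move/(teq_catr v).
apply: teq_trans (zz [::]).
have rel : teq s4 (cross n (chords_word [:: arrow 1 2; arrow 0 2; coarrow 0 1])) [::].
  by have [_ _] : ceq s4 [:: arrow 1 2; arrow 0 2; coarrow 0 1] [::]
    by apply: (@place3 s4 1 2 0 [:: arrow 0 1; arrow 2 1; coarrow 2 0]) => //;
       rewrite /orient /= ?negbK // => *; apply: bent_left.
apply: (@teq_trans _ _ _ ((1, Cup b d) :: (W ++ [:: (2, Cap)]))).
  apply: teq_sym; apply: teq_trans (zz W).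
  apply: (teq_after_cup' c1).
  have := @interchange_piece n k [:: (a, ~~ d); (b, d)] [:: (a, ~~ d); (b, d)]
    [:: (b, ~~ d), (b, d) & r] r W 0 Cap.
  apply; first by rewrite /W run_chords.
  by rewrite step0 /= eqxx; case: (d).
apply: teq_sym.
apply: (@teq_trans _ _ _ ((1, Cup b d) :: (cross n (chords_word [:: arrow 1 2; arrow 0 2; coarrow 0 1])
   ++ [:: (2, Cap)]))).
  by apply: (teq_after_cup' c1); apply: teq_sym; apply: (teq_catr [:: (2, Cap)] rel).
rewrite -!cat_cons; apply: teq_catr; rewrite /W !cross_cons.
apply: (@teq_trans _ _ _ ([:: (1, Cup b d)] ++ cross n (chord_word (arrow 0 2)) ++
    cross n (chord_word (coarrow 0 1)))).
  rewrite -cat_cons cats0.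
  by apply: teq_catr; apply: (proj1 (@cup_kink_chord n k s 1 b d Over isT isT)).
rewrite cat1s -!cat_cons cats0; apply: teq_catr.
exact: (@cup_chord_right n k s 1 b d 0 Over).
Qed.

Lemma antisymmetry s a b : a != b -> a < size s -> b < size s ->
  orient s b = ~~ orient s a -> ceq s [:: arrow a b] [:: coarrow a b].
Proof.
move=> hab ha hb ob.
have h : ceq s [:: coarrow b a; coarrow a b] [::].
  apply: (@ceq_place n k s [:: a; b] [:: coarrow 1 0; coarrow 0 1] [::]) => //=.
  - by rewrite inE hab.
  - by rewrite ha hb.
  move=> s' hs' ho; have := ho 0 isT; have := ho 1 isT.
  rewrite /= ob; have : 2 <= size s' by rewrite hs'; lia.
  case: s' {hs' ho} => [|[a' d1] [|[b' d2] r]] //= _.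
  by rewrite /orient /= => -> <-; rewrite -{1}[d1]negbK; apply: antisymmetry0.
have ca : chord_in (size s) (arrow a b) by rewrite /chord_in /= hab ha hb.
have cb : chord_in (size s) (coarrow a b) by rewrite /chord_in /= hab ha hb.
apply: (@ceq_trans _ _ _ ([:: arrow a b] ++ [:: coarrow b a; coarrow a b])).
  have := @ceq_mid n k s [::] [:: coarrow b a; coarrow a b] [:: arrow a b] [::].
  by rewrite /= ca => /(_ isT isT); apply; apply: ceq_sym.
apply: (@ceq_mid n k s [:: arrow a b; coarrow b a] [::] [::] [:: coarrow a b]) => //=.
  by rewrite cb.
exact: ceq_invr.
Qed.

(** Bending gives $c_{ba}c_{ca}c_{bc}^{-1}=1$ and the reversed product. Replacing $c_{ba}$ by
    $c_{ab}^{-1}$ and solving for $c_{ca}$ yields the two relations. *)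
Lemma triangle_relation_vpass s : triangle_relation k s.
Proof.
move=> a b c hu ha oc ob.
have /and4P[h1 h2 h3 _] := ha.
have [hab hac hbc] : [/\ a != b, a != c & b != c].
  by move: hu; rewrite /= !inE; case: eqP; case: eqP; case: eqP.
have an : ceq s [:: arrow b a] [:: coarrow b a].
  by apply: antisymmetry; rewrite ?ob ?negbK // eq_sym.
have hu' : uniq [:: b; a; c].
  by rewrite /= !inE eq_sym (negbTE hab) (negbTE hbc) (negbTE hac).
have ha' : all (fun p => p < size s) [:: b; a; c] by rewrite /= h1 h2 h3.
have oc' : orient s a = orient s c by rewrite oc.
have i1 : chord_in (size s) (arrow c a) by rewrite /chord_in /= eq_sym hac h1 h3.
have i2 : chord_in (size s) (coarrow c b) by rewrite /chord_in /= eq_sym hbc h2 h3.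
split; apply: ceq_solve.
  have R := @place3 s b a c [:: arrow 0 1; arrow 2 1; coarrow 2 0] hu' ha' oc' ob isT
    (fun _ _ _ _ _ => bent_left _ _ _ _ _).
  apply: ceq_trans R; apply: (@ceq_cat _ _ _ [:: _] [:: _]); first exact: ceq_sym.
  by apply: ceq_refl; rewrite /= i1 i2.
have R := @place3 s b a c [:: coarrow 2 0; arrow 2 1; arrow 0 1] hu' ha' oc' ob isT
  (fun _ _ _ _ _ => bent_right _ _ _ _ _).
apply: ceq_trans R; apply: (@ceq_cat _ _ _ [:: _; _] [:: _; _]).
  by apply: ceq_refl; rewrite /= i1 i2.
exact: ceq_sym.
Qed.

End PassMoves.

Lemma triangle_relation_holds n k (s : seq (strand n)) : triangle_relation k s.
Proof.
by case: (boolP k) => hk; [apply: triangle_relation_vdelta | apply: triangle_relation_vpass].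
Qed.

(** * All chords commute *)

Section Commutation.

Variables (n : nat) (k : bool) (s : seq (strand n)).
Implicit Types (x y z : chord) (u v w : seq chord).
Notation ceq := (@ceq n k s).
Notation N := (size s).

Lemma disjoint_commute a b c d : uniq [:: a; b; c; d] ->
  all (fun p => p < N) [:: a; b; c; d] ->
  ceq [:: arrow a b; arrow c d] [:: arrow c d; arrow a b].
Proof.
move=> hu ha; apply: (@ceq_place n k s [:: a; b; c; d]
  [:: arrow 0 1; arrow 2 3] [:: arrow 2 3; arrow 0 1]) => // s' hs' _.
have h4 : 4 <= size s' by rewrite hs'; move: hu ha => /=; rewrite !inE; lia.
have in4 x : chord_in 4 x -> chord_in (size s') x.
  by case: x => [[e f] z] /and4P[/= h1 h2 h3 h5]; apply/and4P; split=> //=; lia.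
apply: ceq_xeq; rewrite /= ?in4 //; apply: (xeq_leq h4).
apply: (@xeq_trans _ _ _ ([:: (0, Over); (0, Virtual)] ++ [:: (2, Over); (2, Virtual)])).
  exact: xeq_chords.
apply: (@xeq_trans _ _ _ ([:: (2, Over); (2, Virtual)] ++ [:: (0, Over); (0, Virtual)])); last first.
  exact: xeq_chords.
apply: (@xeq_trans _ _ _ [:: (0, Over); (2, Over); (2, Virtual); (0, Virtual)]).
  apply: (@xeq_catl _ _ _ [:: (0, Over)] [:: (0, Virtual); (2, Over); (2, Virtual)]) => //.
  apply: (@xeq_trans _ _ _ [:: (2, Over); (0, Virtual); (2, Virtual)]).
    apply: (@xeq_catr _ _ _ [:: (0, Virtual); (2, Over)] [:: (2, Over); (0, Virtual)]).
    exact: xeq_far.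
  apply: (@xeq_catl _ _ _ [:: (2, Over)]) => //; exact: xeq_far.
apply: (@xeq_catr _ _ _ [:: (0, Over); (2, Over); (2, Virtual)]
  [:: (2, Over); (2, Virtual); (0, Over)]).
apply: (@xeq_trans _ _ _ [:: (2, Over); (0, Over); (2, Virtual)]).
  apply: (@xeq_catr _ _ _ [:: (0, Over); (2, Over)] [:: (2, Over); (0, Over)]).
  exact: xeq_far.
apply: (@xeq_catl _ _ _ [:: (2, Over)]) => //; exact: xeq_far.
Qed.

Definition commutes x u := ceq (x :: u) (u ++ [:: x]).

Lemma commutes_cat x u v : all (chord_in N) u -> all (chord_in N) v ->
  commutes x u -> commutes x v -> commutes x (u ++ v).
Proof.
move=> hu hv h1 h2; have [/= /andP[hx _] _ _] := h1.
apply: (@ceq_trans _ _ _ ((u ++ [:: x]) ++ v)).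
  by apply: (@ceq_mid _ _ _ (x :: u) (u ++ [:: x]) [::] v).
rewrite -!catA; have := @ceq_mid _ _ _ (x :: v) (v ++ [:: x]) u [::] hu isT h2.
by rewrite !cats0.
Qed.

Lemma commutes_eq x u v : ceq u v -> commutes x u -> commutes x v.
Proof.
move=> h h1; have [/= /andP[hx hu] _ _] := h1; have [_ hv _] := h.
apply: (@ceq_trans _ _ _ (x :: u)).
  have := @ceq_mid _ _ _ v u [:: x] [::] _ isT (ceq_sym h).
  by rewrite /= hx !cats0; apply.
apply: ceq_trans h1 _.
by apply: (@ceq_mid _ _ _ u v [::] [:: x]); rewrite //= hx.
Qed.

Lemma commutes_sym x y : commutes x [:: y] -> commutes y [:: x].
Proof. exact: ceq_sym. Qed.

Lemma commutes_inv x y : commutes x [:: y] -> commutes x [:: inv_chord y].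
Proof.
move=> h; have [/and3P[hx hy _] _ _] := h.
have hy' : chord_in N (inv_chord y) by rewrite chord_in_inv.
apply: (@ceq_trans _ _ _ ([:: inv_chord y; y] ++ [:: x; inv_chord y])).
  apply: (@ceq_mid _ _ _ [::] [:: inv_chord y; y] [::] [:: x; inv_chord y]) => //=.
    by rewrite hx hy'.
  by apply: ceq_sym; apply: ceq_invl.
apply: (@ceq_trans _ _ _ ([:: inv_chord y] ++ [:: x; y] ++ [:: inv_chord y])).
  apply: (@ceq_mid _ _ _ [:: y; x] [:: x; y] [:: inv_chord y] [:: inv_chord y]);
    rewrite /= ?hy' //; exact: ceq_sym.
apply: (@ceq_mid _ _ _ [:: y; inv_chord y] [::] [:: inv_chord y; x] [::]); rewrite //= ?hx ?hy' //.
exact: ceq_invr.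
Qed.

Lemma commutes_inv_l x y : commutes x [:: y] -> commutes (inv_chord x) [:: y].
Proof. by move/commutes_sym/commutes_inv/commutes_sym. Qed.

Lemma commutes_prod2 x y z u : ceq u [:: y; z] -> commutes x [:: y] -> commutes x [:: z] ->
  commutes x u.
Proof.
move=> h hy hz; have [_ /and3P[h1 h2 _] _] := h.
apply: (commutes_eq (ceq_sym h)).
by apply: (@commutes_cat _ [:: y] [:: z]); rewrite //= ?h1 ?h2.
Qed.

Lemma arrow_in a b : a != b -> a < N -> b < N -> chord_in N (arrow a b).
Proof. by move=> h1 h2 h3; rewrite /chord_in /= h1 h2 h3. Qed.

Lemma ceq_divr y z u : chord_in N y -> chord_in N z -> ceq u [:: y; z] ->
  ceq [:: y] (u ++ [:: inv_chord z]).
Proof.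
move=> hy hz h; have hz' : chord_in N (inv_chord z) by rewrite chord_in_inv.
apply: (@ceq_trans _ _ _ ([:: y; z] ++ [:: inv_chord z])); last first.
  apply: (@ceq_mid _ _ _ [:: y; z] u [::] [:: inv_chord z]); rewrite //= ?hz' //.
  exact: ceq_sym.
apply: (@ceq_mid _ _ _ [::] [:: z; inv_chord z] [:: y] [::]); rewrite //= ?hy //.
by apply: ceq_sym; apply: ceq_invr.
Qed.

Lemma ceq_divl y z u : chord_in N y -> chord_in N z -> ceq u [:: z; y] ->
  ceq [:: y] (inv_chord z :: u).
Proof.
move=> hy hz h; have hz' : chord_in N (inv_chord z) by rewrite chord_in_inv.
apply: (@ceq_trans _ _ _ ([:: inv_chord z] ++ [:: z; y])); last first.
  apply: (@ceq_cat _ _ _ [:: inv_chord z] [:: inv_chord z]); last exact: ceq_sym.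
  by apply: ceq_refl; rewrite /= hz'.
apply: (@ceq_mid _ _ _ [::] [:: inv_chord z; z] [::] [:: y]); rewrite //= ?hy //.
by apply: ceq_sym; apply: ceq_invl.
Qed.

Notation o := (orient s).

(** Both products equal $c_{ca}$. *)
Lemma path_commute a b c : a != c -> a < N -> b < N -> c < N ->
  o b = ~~ o a -> o c = ~~ o b -> commutes (arrow a b) [:: arrow b c].
Proof.
move=> hac ha hb hc ob oc.
have hab : a != b by apply: contraTneq isT => e; move: ob; rewrite e; case: (o b).
have hbc : b != c by apply: contraTneq isT => e; move: oc; rewrite e; case: (o c).
have [||||h1 h2] := @triangle_relation_holds n k s a b c.
- by rewrite /= !inE (negbTE hab) (negbTE hac) (negbTE hbc).
- by rewrite /= ha hb hc.
- by rewrite oc ob negbK.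
- exact: ob.
exact: ceq_trans (ceq_sym h1) h2.
Qed.

(** Two strands of each orientation, in the form in which spare strands are requested. *)
Hypothesis enough : forall d a, exists m, [/\ m < N, o m = d & m != a].

(** With a spare strand $m$ oriented like $a$, $c_{ac}=c_{ma}c_{cm}^{-1}$. The chord $c_{ab}$
    commutes with $c_{ma}=c_{ab}c_{bm}$ by [path_commute], and with $c_{cm}$ since the strands are
    disjoint. *)
Lemma fork_commute a b c : b != c -> a < N -> b < N -> c < N ->
  o b = ~~ o a -> o c = ~~ o a -> commutes (arrow a b) [:: arrow a c].
Proof.
move=> hbc ha hb hc ob oc; have [m [hm om hma]] := enough (o a) a.
have hab : a != b by apply: contraTneq isT => e; move: ob; rewrite e; case: (o b).
have hac : a != c by apply: contraTneq isT => e; move: oc; rewrite e; case: (o c).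
have hmb : b != m by apply: contraTneq isT => e; move: ob; rewrite e om; case: (o a).
have hmc : c != m by apply: contraTneq isT => e; move: oc; rewrite e om; case: (o a).
have ham : a != m by rewrite eq_sym.
have tri e : e < N -> a != e -> e != m -> o e = ~~ o a -> ceq [:: arrow m a] [:: arrow a e; arrow e m].
  move=> he hae hem oe; have [||||h1 h2] := @triangle_relation_holds n k s a e m => //.
  - by rewrite /= !inE (negbTE hae) (negbTE ham) (negbTE hem).
  - by rewrite /= ha he hm.
have t1 := tri b hb hab hmb ob; have t2 := tri c hc hac hmc oc.
have := ceq_divr (arrow_in hac ha hc) (arrow_in hmc hc hm) t2.
move/ceq_sym/commutes_eq; apply.
have hcm' : chord_in N (inv_chord (arrow c m)) by rewrite chord_in_inv arrow_in.
have hma' : chord_in N (arrow m a) by apply: arrow_in.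
apply: (@commutes_cat _ [:: arrow m a] [:: inv_chord (arrow c m)]); rewrite /= ?hma' ?hcm' //.
  apply: (commutes_prod2 t1); first by apply: ceq_refl; rewrite /= arrow_in.
  by apply: path_commute; rewrite // ob ?negbK.
apply: commutes_inv; apply: disjoint_commute.
  by rewrite /= !inE (negbTE hab) (negbTE hac) (negbTE ham) (negbTE hbc) (negbTE hmb) (negbTE hmc).
by rewrite /= ha hb hc hm.
Qed.

(** As for [fork_commute] with the chords reversed: $c_{cb}=c_{mc}^{-1}c_{bm}$ and
    $c_{bm}=c_{ma}c_{ab}$, with $m$ oriented like $b$. *)
Lemma merge_commute a b c : a != c -> a < N -> b < N -> c < N ->
  o a = ~~ o b -> o c = ~~ o b -> commutes (arrow a b) [:: arrow c b].
Proof.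
move=> hac ha hb hc oa oc; have [m [hm om hmb]] := enough (o b) b.
have hab : a != b by apply: contraTneq isT => e; move: oa; rewrite e; case: (o b).
have hcb : c != b by apply: contraTneq isT => e; move: oc; rewrite e; case: (o b).
have hma : m != a by apply: contraTneq isT => e; move: oa; rewrite -e om; case: (o b).
have hmc : m != c by apply: contraTneq isT => e; move: oc; rewrite -e om; case: (o b).
have hbm : b != m by rewrite eq_sym.
have tri e : e < N -> m != e -> e != b -> o e = ~~ o b ->
    ceq [:: arrow b m] [:: arrow m e; arrow e b].
  move=> he hme heb oe; have [||||h1 h2] := @triangle_relation_holds n k s m e b => //.
  - by rewrite /= !inE (negbTE hme) (negbTE hmb) (negbTE heb).
  - by rewrite /= hm he hb.
  - by rewrite om oe.
have t1 := tri a ha hma hab oa; have t2 := tri c hc hmc hcb oc.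
have := ceq_divl (arrow_in hcb hc hb) (arrow_in hmc hm hc) t2.
move/ceq_sym/commutes_eq; apply.
have hmc' : chord_in N (inv_chord (arrow m c)) by rewrite chord_in_inv arrow_in.
have hbm' : chord_in N (arrow b m) by apply: arrow_in.
apply: (@commutes_cat _ [:: inv_chord (arrow m c)] [:: arrow b m]); rewrite /= ?hbm' ?hmc' //.
  apply: commutes_inv; apply: disjoint_commute; last by rewrite /= ha hb hc hm.
  rewrite /= !inE (negbTE hab) (negbTE hac) (negbTE hbm) (negbTE hmc) [b == c]eq_sym (negbTE hcb).
  by rewrite [a == m]eq_sym (negbTE hma).
apply: (commutes_prod2 t1); last by apply: ceq_refl; rewrite /= arrow_in.
by apply: commutes_sym; apply: path_commute; rewrite // ?om ?oa ?negbK.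
Qed.

(** Two spare strands are used, $m$ like $a$ and $l$ like $b$: $c_{ab}=c_{ma}c_{bm}^{-1}$ with
    $c_{ma}=c_{al}c_{lm}$. The chord $c_{ba}$ commutes with $c_{al}$ (path), $c_{lm}$ (disjoint) and
    $c_{bm}$ (fork). *)
Lemma opposite_commute a b : a < N -> b < N -> o b = ~~ o a ->
  commutes (arrow b a) [:: arrow a b].
Proof.
move=> ha hb ob; have [m [hm om hma]] := enough (o a) a.
have [l [hl ol hlb]] := enough (o b) b.
have hab : a != b by apply: contraTneq isT => e; move: ob; rewrite e; case: (o b).
have hbm : b != m by apply: contraTneq isT => e; move: ob; rewrite e om; case: (o a).
have hal : a != l by apply: contraTneq isT => e; move: ol; rewrite -e ob; case: (o a).
have hlm : l != m by apply: contraTneq isT => e; move: ol; rewrite e om ob; case: (o a).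
have ham : a != m by rewrite eq_sym.
have tri e : e < N -> a != e -> e != m -> o e = ~~ o a -> ceq [:: arrow m a] [:: arrow a e; arrow e m].
  move=> he hae hem oe; have [||||h1 h2] := @triangle_relation_holds n k s a e m => //.
  - by rewrite /= !inE (negbTE hae) (negbTE ham) (negbTE hem).
  - by rewrite /= ha he hm.
have t1 := tri b hb hab hbm ob; have t2 := tri l hl hal hlm (etrans ol ob).
have := ceq_divr (arrow_in hab ha hb) (arrow_in hbm hb hm) t1.
move/ceq_sym/commutes_eq; apply.
have hbm' : chord_in N (inv_chord (arrow b m)) by rewrite chord_in_inv arrow_in.
have hma' : chord_in N (arrow m a) by apply: arrow_in.
apply: (@commutes_cat _ [:: arrow m a] [:: inv_chord (arrow b m)]); rewrite /= ?hma' ?hbm' //.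
  apply: (commutes_prod2 t2).
    by apply: path_commute; rewrite // ?ol ?ob ?negbK // eq_sym.
  apply: disjoint_commute; last by rewrite /= ha hb hl hm.
  by rewrite /= !inE [b == a]eq_sym (negbTE hab) (negbTE ham) (negbTE hal) [b == l]eq_sym
    (negbTE hlb) (negbTE hbm) (negbTE hlm).
apply: commutes_inv; apply: fork_commute; rewrite // ?om ?ob ?negbK //.
Qed.

Lemma mixed_commute a b c d : a < N -> b < N -> c < N -> d < N ->
  o b = ~~ o a -> o d = ~~ o c -> commutes (arrow a b) [:: arrow c d].
Proof.
move=> ha hb hc hd ob od.
have hab : a != b by apply: contraTneq isT => e; move: ob; rewrite e; case: (o b).
have hcd : c != d by apply: contraTneq isT => e; move: od; rewrite e; case: (o d).
have [eac|nac] := eqVneq a c.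
  subst c; have [ebd|nbd] := eqVneq b d; last exact: fork_commute.
  by subst d; apply: ceq_refl; rewrite /= arrow_in.
have [ebd|nbd] := eqVneq b d.
  by subst d; apply: merge_commute; rewrite //; [rewrite ob negbK | rewrite od negbK].
have [ebc|nbc] := eqVneq b c.
  subst c; have [ead|nad] := eqVneq a d; last exact: path_commute.
  by subst d; apply: opposite_commute.
have [ead|nad] := eqVneq a d.
  by subst d; apply: commutes_sym; apply: path_commute; rewrite // eq_sym.
apply: disjoint_commute; last by rewrite /= ha hb hc hd.
by rewrite /= !inE (negbTE hab) (negbTE nac) (negbTE nad) (negbTE nbc) (negbTE nbd) hcd.
Qed.

(* A chord between strands oriented alike is a product of two chords between
   strands with opposite orientations. *)
Lemma arrow_mixed a b : a != b -> a < N -> b < N -> exists u,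
  ceq [:: arrow a b] u /\ forall c, c \in u -> exists e f,
    [/\ c = arrow e f, e < N, f < N & o f = ~~ o e].
Proof.
move=> hab ha hb; have [oab|noab] := eqVneq (o b) (~~ o a).
  exists [:: arrow a b]; split; first by apply: ceq_refl; rewrite /= arrow_in.
  by move=> c; rewrite inE => /eqP ->; exists a, b.
have oab : o a = o b by move: noab; case: (o a); case: (o b).
have [m [hm om _]] := enough (~~ o a) a.
have hbm : b != m by apply: contraTneq isT => e; move: om; rewrite -e oab; case: (o b).
have hma : m != a by apply: contraTneq isT => e; move: om; rewrite e; case: (o a).
have [||||h1 _] := @triangle_relation_holds n k s b m a => //.
- by rewrite /= !inE (negbTE hbm) (negbTE hma) [b == a]eq_sym hab.
- by rewrite /= ha hb hm.
- by rewrite om oab.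
exists [:: arrow b m; arrow m a]; split=> // c.
rewrite !inE => /orP[] /eqP->; [exists b, m | exists m, a]; split=> //.
  by rewrite om oab.
by rewrite om negbK.
Qed.

Lemma commutes_list x u : all (chord_in N) u -> chord_in N x ->
  (forall y, y \in u -> commutes x [:: y]) -> commutes x u.
Proof.
move=> + hx; elim: u => [_ _|y u IH] /=; first by apply: ceq_refl; rewrite /= hx.
case/andP => hy hu H; apply: (@commutes_cat _ [:: y] u); rewrite //= ?hy //.
  by apply: H; rewrite mem_head.
by apply: IH => // z hz; apply: H; rewrite inE hz orbT.
Qed.

Lemma chords_commute x y : chord_in N x -> chord_in N y -> ceq [:: x; y] [:: y; x].
Proof.
have arrows a b c d : a != b -> c != d -> a < N -> b < N -> c < N -> d < N ->
    commutes (arrow a b) [:: arrow c d].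
  move=> hab hcd ha hb hc hd.
  have [u [eu hu]] := arrow_mixed hab ha hb; have [v [ev hv]] := arrow_mixed hcd hc hd.
  have [_ inu _] := eu; have [_ inv _] := ev.
  apply: (commutes_eq (ceq_sym ev)); apply: commutes_list => //; first exact: arrow_in.
  move=> y' hy; apply: commutes_sym; apply: (commutes_eq (ceq_sym eu)).
  apply: commutes_list => //; first exact: (allP inv).
  move=> z hz; have [e [f [-> he hf oef]]] := hv _ hy.
  by have [e' [f' [-> he' hf' oef']]] := hu _ hz; apply: mixed_commute.
have as_arrow c : chord_in N c -> exists a b, [/\ a != b, a < N, b < N &
    c = arrow a b \/ c = inv_chord (arrow a b)].
  case: c => [[a b] z] /and4P[/= h1 h2 h3 h4]; case: z h4 => // _.
    by exists a, b; split=> //; left.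
  by exists b, a; split=> //; [rewrite eq_sym | right].
move=> /as_arrow[a [b [hab ha hb ex]]] /as_arrow[c [d [hcd hc hd ey]]].
have h := arrows a b c d hab hcd ha hb hc hd.
case: ex => ->; case: ey => ->; [exact: h|exact: commutes_inv|exact: commutes_inv_l|].
exact: commutes_inv (commutes_inv_l h).
Qed.

Lemma ceq_perm u v : all (chord_in N) u -> perm_eq u v -> ceq u v.
Proof.
elim: v u => [|x v IH] u hu hp; first by rewrite (perm_nilP hp); apply: ceq_refl.
have hx : x \in u by rewrite (perm_mem hp) mem_head.
case: (path.splitPr hx) hu hp => u1 u2; rewrite all_cat /= => /and3P[h1 inx h2] hp.
have hp' : perm_eq (u1 ++ u2) v.
  by rewrite -(perm_cons x); apply: perm_trans hp; rewrite -cat1s perm_catCA.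
apply: (@ceq_trans _ _ _ (x :: u1 ++ u2)).
  have cx : commutes x u1.
    apply: commutes_list => // y hy.
    by apply: chords_commute => //; apply: (allP h1).
  have -> : u1 ++ x :: u2 = (u1 ++ [:: x]) ++ u2 by rewrite -catA.
  by apply: (@ceq_mid _ _ _ _ (x :: u1) [::] u2) => //; apply: ceq_sym.
apply: (@ceq_cat _ _ _ [:: x] [:: x]); first by apply: ceq_refl; rewrite /= inx.
by apply: IH => //; rewrite all_cat h1.
Qed.

End Commutation.

(** * Chords at local minima *)

Section MinimaChords.

Variables (n : nat) (k : bool).
Implicit Types (s r t : seq (strand n)) (lab : seq (strand n)) (u v : seq chord).
Notation teq := (@teq n k).
Notation xeq := (xeq n k).

Lemma relabelE (t : seq nat) a b x : relabel t (a, b, x) = (nth 0 t a, nth 0 t b, x).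
Proof. by []. Qed.

Lemma xeq_push N (l : seq nat) c : below N l -> chord_in N c ->
  xeq N (virtual l ++ chord_word c)
    (chord_word (relabel (permute l (iota 0 N)) c) ++ virtual l).
Proof.
move=> hl hc; have hc' : chord_in N (relabel (permute l (iota 0 N)) c).
  by apply: chord_in_relabel => //; apply: perm_permute.
apply: xeq_chords.
- by rewrite positions_cat positions_virtual below_cat hl chord_word_below.
- rewrite (positions_cat _ (virtual l)) positions_virtual below_cat hl andbT.
  exact: chord_word_below.
- rewrite (chords_cat _ (virtual l)) (chords_cat _ _ (virtual l)) !chords_virtual.
  rewrite positions_virtual (chords_chord_word hc') ?size_iota // relabel_iota //.
  by rewrite (chords_chord_word hc) // size_permute size_iota.
rewrite (positions_cat (virtual l)) (positions_cat _ (virtual l)).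
by rewrite !permute_cat !permute_chord_word.
Qed.

Lemma relabel_swap2 N p : p.+2 < N ->
  [/\ nth 0 (permute [:: p; p.+1] (iota 0 N)) p = p.+1,
      nth 0 (permute [:: p; p.+1] (iota 0 N)) p.+1 = p.+2,
      nth 0 (permute [:: p; p.+1] (iota 0 N)) p.+2 = p &
      forall b, p.+2 < b -> b < N -> nth 0 (permute [:: p; p.+1] (iota 0 N)) b = b].
Proof.
move=> hp; have hp1 := ltnW hp; have hp2 := ltnW hp1.
have e1 := ltn_eqF (ltnSn p); have e2 := gtn_eqF (ltnSn p).
have e3 := ltn_eqF (leqnSn p.+1); have e4 := gtn_eqF (leqnSn p.+1).
have e5 := gtn_eqF (ltnSn p.+1).
rewrite -[permute _ _]/(swap p.+1 (swap p _)).
rewrite !nth_swap ?size_swap ?size_iota // ?eqxx ?e1 ?e2 ?e3 ?e4 ?e5 ?eqxx ?e1 ?e2 ?e3 ?e4 ?e5.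
split=> [|||b hb hbN]; rewrite ?nth_iota //.
have f1 := gtn_eqF hb; have f2 := gtn_eqF (ltnW hb).
have f3 := gtn_eqF (ltnW (ltnW hb)).
by rewrite !nth_swap ?size_swap ?size_iota // ?f1 ?f2 ?f3 ?f1 ?f2 ?f3 nth_iota.
Qed.

Lemma cup_right s p c d : p < size s ->
  teq s [:: (p, Cup c d)] [:: (p.+1, Cup c d); (p, Cross Virtual); (p.+1, Cross Virtual)].
Proof.
move=> hp; have hs := step_cup c d (ltnW hp); set t := (X in Some X) in hs.
have st := size_step_cup hs.
apply: teq_trans (teq_sym (teq_catr [:: (p.+1, Cross Virtual)] (slide_cup k c d Virtual hp))).
apply: (@teq_after_cup n k s p c d t [::] [:: (p.+1, Virtual); (p.+1, Virtual)] hs).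
by apply: xeq_sym; apply: xeq_RII; rewrite st; lia.
Qed.

(** If [b] is to the right, the minimum is moved virtually past the strands between them and past
    [b], by induction on their number; then [b] is to its left. *)
Lemma cup_chord s p c d b y : b != p -> b != p.+1 -> b < (size s).+2 -> p <= size s -> is_real y ->
  teq s ((p, Cup c d) :: cross n (chord_word (b, p, y)))
        ((p, Cup c d) :: cross n (chord_word (p.+1, b, flip y))) /\
  teq s ((p, Cup c d) :: cross n (chord_word (b, p.+1, y)))
        ((p, Cup c d) :: cross n (chord_word (p, b, flip y))).
Proof.
move=> h1 h2 hb hp hy.
have [hbp|hpb] := ltnP b p.
  by split; [apply: cup_chord_left|apply: cup_chord_right].
have {h1 h2} : p.+1 < b by lia.
clear hpb; move E: (b - p.+2) => m; elim: m b p E hb hp => [|m IH] b p E hb hp hpb.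
  have {E} eb : b = p.+2 by lia.
  subst b; have hps : p < size s by lia.
  have hs := step_cup c d hps; set t := (X in Some X) in hs.
  have st := size_step_cup hs; have hN : p.+2 < size t by rewrite st; lia.
  have hl : below (size t) [:: p; p.+1] by rewrite /= hN (ltnW hN).
  have [n1 n2 n3 _] := relabel_swap2 hN.
  have push c0 : chord_in (size t) c0 -> teq s ((p, Cup c d) :: cross n (chord_word c0))
      (((p.+1, Cup c d) :: cross n (chord_word (relabel (permute [:: p; p.+1] (iota 0 (size t))) c0)))
        ++ cross n (virtual [:: p; p.+1])).
    move=> h0; apply: teq_trans (teq_catr _ (cup_right c d hps)) _.
    rewrite !cat_cons -(cross_cat n _ (virtual [:: p; p.+1])).
    exact: (teq_after_cup hs (xeq_push hl h0)).
  have i1 a b' z : is_real z -> a != b' -> a <= p.+2 -> b' <= p.+2 -> chord_in (size t) (a, b', z).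
    by move=> hz hab ha hb'; apply/and4P; split=> //=; apply: leq_ltn_trans hN.
  have ne : (p.+2 != p) * (p.+2 != p.+1) * (p != p.+2) * (p.+1 != p.+2).
    by repeat split; lia.
  split.
    apply: teq_trans (push _ _) _; first by (apply: i1; rewrite ?ne //; lia).
    apply: teq_trans (teq_sym (push _ _)); last by (apply: i1; rewrite ?ne ?is_real_flip //; lia).
    by rewrite !relabelE n1 n2 n3; apply: teq_catr; apply: cup_chord_left.
  apply: teq_trans (push _ _) _; first by (apply: i1; rewrite ?ne //; lia).
  apply: teq_trans (teq_sym (push _ _)); last by (apply: i1; rewrite ?ne ?is_real_flip //; lia).
  by rewrite !relabelE n1 n2 n3; apply: teq_catr; apply: cup_chord_right.
have hps : p < size s by lia.
have hs := step_cup c d hps; set t := (X in Some X) in hs.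
have st := size_step_cup hs; have hN : p.+2 < size t by rewrite st; lia.
have hl : below (size t) [:: p; p.+1] by rewrite /= hN (ltnW hN).
have [n1 n2 n3 n4] := relabel_swap2 hN.
have push c0 : chord_in (size t) c0 -> teq s ((p, Cup c d) :: cross n (chord_word c0))
    (((p.+1, Cup c d) :: cross n (chord_word (relabel (permute [:: p; p.+1] (iota 0 (size t))) c0)))
      ++ cross n (virtual [:: p; p.+1])).
  move=> h0; apply: teq_trans (teq_catr _ (cup_right c d hps)) _.
  rewrite !cat_cons -(cross_cat n _ (virtual [:: p; p.+1])).
  exact: (teq_after_cup hs (xeq_push hl h0)).
have hbt : b < size t by rewrite st.
have i1 a b' z : is_real z -> a != b' -> a < size t -> b' < size t -> chord_in (size t) (a, b', z).
  by move=> hz hab ha hb'; apply/and4P; split.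
have [||||IH1 IH2] := IH b p.+1; try lia.
have hb2 : p.+2 < b by lia.
have ne : (b != p) * (b != p.+1) * (p != b) * (p.+1 != b) by repeat split; lia.
have [q1 q2] : p < size t /\ p.+1 < size t by split; lia.
split.
  apply: teq_trans (push _ _) _; first by (apply: i1; rewrite ?ne //; lia).
  apply: teq_trans (teq_sym (push _ _)); last by (apply: i1; rewrite ?ne ?is_real_flip //; lia).
  by rewrite !relabelE n1 n2 n4 //; apply: teq_catr.
apply: teq_trans (push _ _) _; first by (apply: i1; rewrite ?ne //; lia).
apply: teq_trans (teq_sym (push _ _)); last by (apply: i1; rewrite ?ne ?is_real_flip //; lia).
by rewrite !relabelE n1 n2 n4 //; apply: teq_catr.
Qed.

Definition legs lab : seq (strand n) :=
  flatten [seq [:: a; (a.1, ~~ a.2)] | a <- lab].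

Fixpoint cups p lab : word n :=
  if lab is a :: lab' then (p, Cup a.1 a.2) :: cups p.+2 lab' else [::].

Lemma size_legs lab : size (legs lab) = (size lab).*2.
Proof. by elim: lab => //= a lab; rewrite /legs /= => ->. Qed.

Lemma legs_cat l1 l2 : legs (l1 ++ l2) = legs l1 ++ legs l2.
Proof. by rewrite /legs map_cat flatten_cat. Qed.

Lemma cups_cat p l1 l2 : cups p (l1 ++ l2) = cups p l1 ++ cups (p + (size l1).*2) l2.
Proof.
elim: l1 p => [|a l1 IH] p /=; first by rewrite addn0.
by rewrite IH doubleS !addSnnS.
Qed.

Lemma run_cups l lab : run l (cups (size l) lab) = Some (l ++ legs lab).
Proof.
elim: lab l => [|a lab IH] l /=; first by rewrite cats0.
rewrite step_cup // take_size drop_size /=.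
have := IH (l ++ [:: a; (a.1, ~~ a.2)]); rewrite size_cat addn2.
by rewrite -catA -surjective_pairing => ->.
Qed.

Lemma run_cups0 lab : run [::] (cups 0 lab) = Some (legs lab).
Proof. exact: (run_cups [::]). Qed.

Lemma shift_cups j p lab : shift j (cups p lab) = cups (j + p) lab.
Proof. by elim: lab p => //= a lab IH p; rewrite IH !addnS. Qed.

(** Any minimum may be taken as the highest one, so that facts about one minimum on an arbitrary
    level apply to it. *)
Lemma cups_last l1 a l2 :
  teq [::] (cups 0 (l1 ++ a :: l2))
    (cups 0 (l1 ++ l2) ++ [:: ((size l1).*2, Cup a.1 a.2)]).
Proof.
rewrite !cups_cat !add0n -catA; apply: (teq_catl (run_cups0 l1)).
rewrite -(size_legs l1); set l := legs l1.
have := @interchange_words n k l (l ++ legs [:: a]) [::] (legs l2) [:: (size l, Cup a.1 a.2)] (cups 0 l2).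
have -> : size (l ++ legs [:: a]) = (size l).+2 by rewrite size_cat addn2.
rewrite cats0 !shift_cups !addn0; apply; last exact: run_cups0.
by have := run_cups l [:: a].
Qed.

End MinimaChords.

Definition partner p := if odd p then p.-1 else p.+1.

Lemma partner_double j : partner j.*2 = j.*2.+1.
Proof. by rewrite /partner odd_double. Qed.

Lemma partner_doubleS j : partner j.*2.+1 = j.*2.
Proof. by rewrite /partner /= odd_double. Qed.

Definition partnerE := (add1n, add0n, partner_double, partner_doubleS).

Lemma partnerK : involutive partner.
Proof.
by move=> p; rewrite -(odd_double_half p); case: (odd p); rewrite ?partnerE.
Qed.

Lemma partner_lt p m : (partner p < m.*2) = (p < m.*2).
Proof.
rewrite -(odd_double_half p); case: (odd p); rewrite ?partnerE;
  by apply/idP/idP; lia.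
Qed.

Lemma partner_ne p : partner p != p.
Proof.
by rewrite -(odd_double_half p); case: (odd p); rewrite ?partnerE; lia.
Qed.

(** * Products of chords modulo the minima *)

Section MinimaCosets.

Variables (n : nat) (k : bool) (lab : seq (strand n)).
Implicit Types (u v w : seq chord).
Notation teq := (@teq n k).
Notation s := (legs lab).
Notation N := (size s).

(** A coset relation: it is visibly stable under further chords at the end of the product
    ([cup_eq_catr]), but not at its beginning. *)
Definition cup_eq u v : Prop :=
  [/\ all (chord_in N) u, all (chord_in N) v
    & teq [::] (cups 0 lab ++ cross n (chords_word u))
               (cups 0 lab ++ cross n (chords_word v))].

Lemma cup_eq_sym u v : cup_eq u v -> cup_eq v u.
Proof. by case=> h1 h2 h3; split=> //; apply: teq_sym. Qed.
Lemma cup_eq_trans v u w : cup_eq u v -> cup_eq v w -> cup_eq u w.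
Proof. by case=> h1 h2 h3 [h4 h5 h6]; split=> //; apply: teq_trans h3 h6. Qed.

Lemma ceq_cup_eq u v : ceq k s u v -> cup_eq u v.
Proof. by case=> h1 h2 h3; split=> //; apply: teq_catl h3; apply: run_cups0. Qed.

Lemma cup_eq_refl u : all (chord_in N) u -> cup_eq u u.
Proof. by move=> h; apply: ceq_cup_eq; apply: ceq_refl. Qed.

Lemma cup_eq_catr u v w : all (chord_in N) w -> cup_eq u v -> cup_eq (u ++ w) (v ++ w).
Proof.
move=> hw [h1 h2 h3]; split; rewrite ?all_cat ?h1 ?h2 //.
by rewrite !chords_word_cat !cross_cat !catA; apply: teq_catr.
Qed.

Lemma cup_split a : a < N -> exists l1 e l2,
  [/\ lab = l1 ++ e :: l2, size l1 = a./2 & N = (size (legs (l1 ++ l2))).+2].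
Proof.
rewrite size_legs => ha; have h : a./2 < size lab by lia.
case E: (drop a./2 lab) => [|e l2].
  by have := congr1 size E; rewrite size_drop /=; lia.
exists (take a./2 lab), e, l2; rewrite -E cat_take_drop size_takel; last exact: ltnW.
split=> //; rewrite size_legs size_cat size_takel; last exact: ltnW.
by rewrite -{1}(cat_take_drop a./2 lab) E size_cat /= size_takel ?addnS // ltnW.
Qed.

Lemma chord_in_sym b c x y : is_real y -> chord_in N (b, c, x) -> chord_in N (c, b, y).
Proof. by move=> hy /and4P[/= h1 h2 h3 _]; apply/and4P; split; rewrite //= eq_sym. Qed.

Lemma cup_eq_via l1 e l2 c d : lab = l1 ++ e :: l2 ->
  all (chord_in N) c -> all (chord_in N) d ->
  teq (legs (l1 ++ l2)) (((size l1).*2, Cup e.1 e.2) :: cross n (chords_word c))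
    (((size l1).*2, Cup e.1 e.2) :: cross n (chords_word d)) -> cup_eq c d.
Proof.
move=> E hc hd h; split=> //; rewrite [in cups 0 lab]E.
apply: teq_trans (teq_catr _ (cups_last k l1 e l2)) _.
apply: teq_trans (teq_sym (teq_catr _ (cups_last k l1 e l2))).
by rewrite -!catA; apply: teq_catl h; apply: run_cups0.
Qed.

Lemma cup_move a b x : b != partner a -> chord_in N (b, a, x) ->
  cup_eq [:: (b, a, x)] [:: (partner a, b, flip x)] /\
  cup_eq [:: (a, b, x)] [:: (b, partner a, flip x)].
Proof.
move=> hbp hc; have /and4P[/= hba hb ha hx] := hc.
have [l1 [e [l2 [El hl1 hN]]]] := cup_split ha.
have hx' : is_real (flip x) by rewrite is_real_flip.
have hp : partner a < N by rewrite size_legs partner_lt -size_legs.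
have i1 : chord_in N (partner a, b, flip x) by apply/and4P; split; rewrite //= eq_sym.
have i2 : chord_in N (a, b, x) by apply: chord_in_sym hc.
have i3 : chord_in N (b, partner a, flip x) by apply: chord_in_sym i1.
have hj : (size l1).*2 <= size (legs (l1 ++ l2)).
  by rewrite size_legs size_cat leq_double leq_addr.
have hb2 : b < (size (legs (l1 ++ l2))).+2 by rewrite -hN.
have ea : a = odd a + (size l1).*2 by rewrite hl1 odd_double_half.
set j := size l1 in ea hj *.
have cc y := @cup_chord n k (legs (l1 ++ l2)) j.*2 e.1 e.2 b y.
split; apply: (cup_eq_via El); rewrite /= ?andbT // /chords_word /= !cats0;
  move: hbp hba; rewrite ea; case: (odd a) => /=;
  rewrite ?add1n ?add0n ?partner_double ?partner_doubleS => h1 h2.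
- by case: (cc x _ _ _ _ _).
- by case: (cc x _ _ _ _ _).
- by apply: teq_sym; rewrite -{2}[x]flipK; case: (cc (flip x) _ _ _ _ _).
- by apply: teq_sym; rewrite -{2}[x]flipK; case: (cc (flip x) _ _ _ _ _).
Qed.

Lemma cup_kink a x : a < N -> is_real x -> cup_eq [:: (a, partner a, x)] [::].
Proof.
move=> ha hx; have [l1 [e [l2 [El hl1 hN]]]] := cup_split ha.
have hp : partner a < N by rewrite size_legs partner_lt -size_legs.
apply: (cup_eq_via El) => //=.
  by rewrite andbT; apply/and4P; split; rewrite //= eq_sym partner_ne.
have hj : (size l1).*2 <= size (legs (l1 ++ l2)).
  by rewrite size_legs size_cat leq_double leq_addr.
have [h1 h2] := @cup_kink_chord n k (legs (l1 ++ l2)) (size l1).*2 e.1 e.2 x hj hx.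
rewrite /chords_word /= !cats0.
have ea : a = odd a + (size l1).*2 by rewrite hl1 odd_double_half.
rewrite ea; case: (odd a); rewrite ?add1n ?add0n ?partner_double ?partner_doubleS.
  exact: h2.
exact: h1.
Qed.

Hypothesis two_minima : 1 < size lab.

(** Each minimum has one leg of each orientation, and one of the first two minima does not contain
    [a]. *)
Lemma enough_legs d a : exists m, [/\ m < N, orient s m = d & m != a].
Proof.
have : 4 <= N by rewrite size_legs; lia.
case: lab two_minima => [|[c1 d1] [|[c2 d2] l]] //= _ h4.
exists (if a <= 1 then if d == d2 then 2 else 3 else if d == d1 then 0 else 1).
case: (leqP a 1) => ha; case: eqP => hd; split.
all: try by apply: leq_trans h4.
all: try by rewrite /orient /= hd.
all: try by move: hd; rewrite /orient /=; case: (d); case: (d1); case: (d2).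
all: lia.
Qed.

Lemma cup_eq_perm u v : all (chord_in N) u -> perm_eq u v -> cup_eq u v.
Proof. by move=> h1 h2; apply: ceq_cup_eq; apply: ceq_perm enough_legs _ _ _ _. Qed.

(** Commutativity moves [c] to the end, away from the minima. From here on the cosets behave as a
    group. *)
Lemma cup_eq_cons c u v : chord_in N c -> cup_eq u v -> cup_eq (c :: u) (c :: v).
Proof.
move=> hc h; have [hu hv _] := h.
apply: (@cup_eq_trans (u ++ [:: c])).
  by apply: cup_eq_perm; rewrite /= ?hc // -cat1s perm_catC.
apply: (@cup_eq_trans (v ++ [:: c])); first by apply: cup_eq_catr; rewrite //= hc.
by apply: cup_eq_perm; rewrite ?all_cat ?hv /= ?hc // -[X in perm_eq _ X]cat1s perm_catC.
Qed.

Lemma cup_eq_catl u v w : all (chord_in N) w -> cup_eq u v -> cup_eq (w ++ u) (w ++ v).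
Proof. by elim: w => //= c w IH /andP[hc /IH h] /h; apply: cup_eq_cons. Qed.

Lemma cup_eq_cat u u' v v' : cup_eq u u' -> cup_eq v v' -> cup_eq (u ++ v) (u' ++ v').
Proof.
move=> h1 h2; have [_ hu' _] := h1; have [hv _ _] := h2.
by apply: cup_eq_trans (cup_eq_catr hv h1) _; apply: cup_eq_catl.
Qed.

Lemma cup_eq_each (P : chord -> Prop) :
  (forall c, chord_in N c -> exists v, cup_eq [:: c] v /\ forall d, d \in v -> P d) ->
  forall u, all (chord_in N) u -> exists v, cup_eq u v /\ forall d, d \in v -> P d.
Proof.
move=> H; elim=> [_|c u IH] /=; first by exists [::]; split=> //; apply: cup_eq_refl.
case/andP => hc /IH[v [h1 h2]]; have [w [h3 h4]] := H c hc.
exists (w ++ v); split; first by apply: (@cup_eq_cat [:: c]).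
by move=> d; rewrite mem_cat => /orP[/h4|/h2].
Qed.

(* Sliding along the minima, chords leave the legs that are not allowed. *)
Lemma cup_eq_allowed (allowed : pred nat) :
  (forall p, p < N -> allowed p || allowed (partner p)) ->
  forall u, all (chord_in N) u -> exists v, cup_eq u v /\
    forall d, d \in v -> allowed d.1.1 && allowed d.1.2.
Proof.
move=> hall; apply: cup_eq_each => -[[a b] x] hc.
have [ebp|nbp] := eqVneq b (partner a).
  exists [::]; split=> //; rewrite ebp; apply: cup_kink.
    by case/and4P: hc.
  by case/and4P: hc.
have /and4P[/= hab ha hb hx] := hc.
case Aa: (allowed a).
  case Ab: (allowed b).
    exists [:: (a, b, x)]; split; first by apply: cup_eq_refl; rewrite /= hc.
    by move=> d; rewrite inE => /eqP-> /=; rewrite Aa Ab.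
  exists [:: (partner b, a, flip x)]; split.
    have nab : a != partner b by apply: contraNneq nbp => ->; rewrite partnerK.
    exact: (proj1 (cup_move nab hc)).
  move=> d; rewrite inE => /eqP-> /=; rewrite Aa.
  by have := hall b hb; rewrite Ab /= => ->.
have pa : allowed (partner a) by have := hall a ha; rewrite Aa.
have h1 := proj2 (cup_move nbp (chord_in_sym hx hc)).
have [_ /= /andP[hc1 _] _] := h1.
case Ab: (allowed b).
  exists [:: (b, partner a, flip x)]; split=> // d.
  by rewrite inE => /eqP-> /=; rewrite pa Ab.
have pb : allowed (partner b) by have := hall b hb; rewrite Ab.
exists [:: (partner a, partner b, flip (flip x))]; split; last first.
  by move=> d; rewrite inE => /eqP-> /=; rewrite pa pb.
apply: cup_eq_trans h1 _.
have np : partner a != partner b by rewrite (inj_eq (inv_inj partnerK)).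
by apply: (proj2 (cup_move np (chord_in_sym _ hc1))); rewrite is_real_flip.
Qed.

End MinimaCosets.

(** * Reduction to chords at the first left leg *)

Section StarChords.

Variables (n : nat) (k : bool) (lab : seq (strand n)).
Hypothesis two_minima : 1 < size lab.
Implicit Types (u v w : seq chord).
Notation teq := (@teq n k).
Notation s := (legs lab).
Notation N := (size (legs lab)).
Notation cup_eq := (@cup_eq n k lab).

Lemma cup_eq_inv u v : cup_eq u v -> cup_eq (inv_chords u) (inv_chords v).
Proof.
move=> h; have [hu hv _] := h.
have hu' : all (chord_in N) (inv_chords u) by rewrite chord_in_inv_chords.
have hv' : all (chord_in N) (inv_chords v) by rewrite chord_in_inv_chords.
apply: (@cup_eq_trans _ _ _ (v ++ inv_chords v ++ inv_chords u)).
  have := @cup_eq_catr n k lab [::] (v ++ inv_chords v) _ hu'.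
  rewrite -catA; apply; apply: cup_eq_sym; apply: ceq_cup_eq; exact: ceq_invs_r.
apply: (@cup_eq_trans _ _ _ (u ++ inv_chords v ++ inv_chords u)).
  by apply: cup_eq_catr; [rewrite all_cat hv' | apply: cup_eq_sym].
apply: (@cup_eq_trans _ _ _ ((u ++ inv_chords u) ++ inv_chords v)).
  apply: cup_eq_perm => //; first by rewrite !all_cat hu hv'.
  by rewrite -catA perm_cat2l perm_catC.
apply: (@cup_eq_catr n k lab _ [::]) => //; apply: ceq_cup_eq; exact: ceq_invs_r.
Qed.

Lemma inv_chord_ne c : chord_in N c -> inv_chord c != c.
Proof.
by case: c => [[a b] x] /and4P[/= h _ _ _]; apply: contraNneq h => -[-> _ _].
Qed.

Lemma balanced_trivial v : all (chord_in N) v ->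
  (forall c, count_mem c v = count_mem (inv_chord c) v) -> cup_eq v [::].
Proof.
have [m] := ubnP (size v); elim: m v => // m IH [|c v] /= hm hv hb.
  exact: cup_eq_refl.
have /andP[hc hv'] := hv; have nc := inv_chord_ne hc.
have hin : inv_chord c \in v.
  have := hb c; rewrite eqxx (negbTE (_ : c != inv_chord c)); last by rewrite eq_sym.
  by rewrite -has_pred1 has_count add0n => <-.
have hp : perm_eq (c :: v) ([:: c; inv_chord c] ++ rem (inv_chord c) v).
  by rewrite /= perm_cons; apply: perm_to_rem.
have hcv : all (chord_in N) (c :: v) by [].
apply: (cup_eq_trans (cup_eq_perm k two_minima hcv hp)).
set w := rem _ v; have hw : all (chord_in N) w.
  by apply/allP => d /mem_rem; apply: (allP hv').
have h1 : cup_eq ([:: c; inv_chord c] ++ w) ([::] ++ w).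
  by apply: cup_eq_catr => //; apply: ceq_cup_eq; apply: ceq_invr.
apply: (cup_eq_trans h1); apply: IH => //=.
  by rewrite /w size_rem //; move: hm; case: (v) hin => //=; lia.
move=> d; have /permP hp' := hp.
have e1 : (inv_chord c == inv_chord d) = (c == d) by rewrite (inj_eq (inv_inj inv_chordK)).
have e2 : (inv_chord c == d) = (c == inv_chord d).
  by rewrite -{1}[d]inv_chordK (inj_eq (inv_inj inv_chordK)).
have := hb d; have := hp' (pred1 d); have := hp' (pred1 (inv_chord d)).
rewrite /= e1 e2; move: (count_mem d w) (count_mem (inv_chord d) w).
move: (count_mem d v) (count_mem (inv_chord d) v).
by case: (c == d); case: (c == inv_chord d) => /=; lia.
Qed.

(** The counting condition says that every chord has the same exponent sum in [u] and in [v]; this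
    decides equality because all chords commute. *)
Lemma balanced_cup_eq u v : all (chord_in N) u -> all (chord_in N) v ->
  (forall c, count_mem c u + count_mem (inv_chord c) v =
             count_mem (inv_chord c) u + count_mem c v) -> cup_eq u v.
Proof.
move=> hu hv hb; have hv' : all (chord_in N) (inv_chords v) by rewrite chord_in_inv_chords.
have cinv c w : count_mem c (inv_chords w) = count_mem (inv_chord c) w.
  rewrite /inv_chords count_rev count_map; apply: eq_count => d /=.
  by rewrite -{1}[c]inv_chordK (inj_eq (inv_inj inv_chordK)).
apply: (@cup_eq_trans _ _ _ (u ++ inv_chords v ++ v)).
  rewrite -{1}[u]cats0; apply: cup_eq_catl => //; apply: cup_eq_sym; apply: ceq_cup_eq.
  exact: ceq_invs_l.
rewrite catA; apply: (@cup_eq_catr n k lab _ [::]) => //.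
apply: balanced_trivial; first by rewrite all_cat hu.
by move=> c; rewrite !count_cat !cinv inv_chordK.
Qed.

Hypothesis upward : all snd lab.

Lemma orient_legs p : p < N -> orient s p = ~~ odd p.
Proof.
elim: lab upward p => //= -[c d] l IH /= /andP[-> hl] [|[|p]] //= hp.
by rewrite negbK -(IH hl).
Qed.

(** The second alternative is the inverse of the first; [0] and [i.*2] are left legs. *)
Definition star c : Prop := exists2 i, 0 < i &
  c = arrow 0 i.*2 \/ c = coarrow i.*2 0.

Lemma star_inv c : star c -> star (inv_chord c).
Proof. by case=> i hi [->|->]; exists i => //; [right|left]. Qed.

Lemma odd_leg_right i : i < size lab -> exists v,
  cup_eq [:: arrow 1 i.*2] v /\ forall c, c \in v -> star c.
Proof.
move=> hi; have h2 : 1 < N by rewrite size_legs; lia.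
case: i hi => [|i] hi.
  exists [::]; split=> //.
  by have := @cup_kink n k lab 1 Over h2 isT; rewrite (partner_doubleS 0).
exists [:: coarrow i.+1.*2 0]; split; last first.
  by move=> c; rewrite inE => /eqP->; exists i.+1 => //; right.
have hc : chord_in N (i.+1.*2, 1, Over) by rewrite /chord_in /= size_legs; lia.
by have := proj2 (cup_move k (_ : i.+1.*2 != partner 1) hc); apply.
Qed.

(** Sliding the end at leg 1 gives $c_{2i,0}^{-1}$, which points the wrong way. By the triangle
    relation $c_{2i,0}=c_{01}c_{1,2i}$, where $c_{01}$ is a kink and $c_{1,2i}$ slides to
    $c_{0,2i}^{-1}$; hence $c_{2i,0}^{-1}=c_{0,2i}$ modulo the minima. *)
Lemma odd_leg_left i : i < size lab -> exists v,
  cup_eq [:: arrow i.*2 1] v /\ forall c, c \in v -> star c.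
Proof.
move=> hi; have h2 : 1 < N by rewrite size_legs; lia.
case: i hi => [|i] hi.
  exists [::]; split=> //.
  exact: (@cup_kink n k lab 0 Over (ltnW h2) isT).
exists [:: arrow 0 i.+1.*2]; split; last first.
  by move=> c; rewrite inE => /eqP->; exists i.+1 => //; left.
have hc : chord_in N (i.+1.*2, 1, Over) by rewrite /chord_in /= size_legs; lia.
apply: (cup_eq_trans (proj1 (cup_move k (_ : i.+1.*2 != partner 1) hc))) => //.
rewrite [partner 1]/= -[flip Over]/Under.
have tri : cup_eq [:: arrow i.+1.*2 0] [:: arrow 0 1; arrow 1 i.+1.*2].
  apply: ceq_cup_eq; apply: (proj1 (@triangle_relation_holds n k s 0 1 i.+1.*2 _ _ _ _)) => //.
  - by rewrite /= size_legs; lia.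
  - by rewrite !orient_legs ?size_legs //=; lia.
  - by rewrite !orient_legs ?size_legs //=; lia.
have h : cup_eq [:: arrow i.+1.*2 0] [:: coarrow i.+1.*2 0].
  apply: (cup_eq_trans tri); apply: (@cup_eq_cat n k lab two_minima [:: _] [::] [:: _] [:: _]).
    exact: (@cup_kink n k lab 0 Over (ltnW h2) isT).
  by have := proj2 (cup_move k (_ : i.+1.*2 != partner 1) hc); apply.
exact: (cup_eq_inv h).
Qed.

(** The triangle relation with leg 1, oriented downwards, in the middle:
    $c_{2j,2i}=c_{2i,1}c_{1,2j}$. *)
Lemma even_arrow_star i j : i != j -> i < size lab -> j < size lab -> exists v,
  cup_eq [:: arrow j.*2 i.*2] v /\ forall c, c \in v -> star c.
Proof.
move=> hij hi hj; have [v [h1 h2]] := odd_leg_left hi; have [w [h3 h4]] := odd_leg_right hj.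
exists (v ++ w); split; last by move=> c; rewrite mem_cat => /orP[/h2|/h4].
apply: cup_eq_trans (cup_eq_cat two_minima h1 h3).
apply: ceq_cup_eq; apply: (proj1 (@triangle_relation_holds n k s i.*2 1 j.*2 _ _ _ _)).
- rewrite /= !inE; lia.
- by rewrite /= size_legs; lia.
- by rewrite !orient_legs ?odd_double // size_legs; lia.
- by rewrite !orient_legs ?odd_double // size_legs; lia.
Qed.

Lemma star_form u : all (chord_in N) u -> exists v,
  cup_eq u v /\ forall c, c \in v -> star c.
Proof.
(* All chords are first moved to left legs, which are the even ones. *)
move=> hu; have [|v [h1 h2]] := cup_eq_allowed k two_minima (allowed := fun p => ~~ odd p) _ hu.
  by move=> p hp; rewrite -(odd_double_half p); case: (odd p); rewrite ?partnerE /= odd_double ?orbT.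
have [_ hv _] := h1.
suff [w [h3 h4]] : exists w, cup_eq v w /\ forall c, c \in w -> star c.
  by exists w; split=> //; apply: cup_eq_trans h3.
elim: v hv h2 {h1} => [_ _|c v IH /= /andP[hc hv] hev].
  by exists [::]; split=> //; apply: cup_eq_refl.
have [|w [h3 h4]] := IH hv; first by move=> d hd; apply: hev; rewrite inE hd orbT.
suff [w' [h5 h6]] : exists w, cup_eq [:: c] w /\ forall c, c \in w -> star c.
  exists (w' ++ w); split; first by apply: (@cup_eq_cat n k lab two_minima [:: c]).
  by move=> d; rewrite mem_cat => /orP[/h6|/h4].
have := hev c (mem_head _ _); case: c hc {hev} => [[a b] x] /and4P[/= hab ha hb hx] /andP[oa ob].
have ea : a = a./2.*2 by move: (odd_double_half a); rewrite (negbTE oa).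
have eb : b = b./2.*2 by move: (odd_double_half b); rewrite (negbTE ob).
have [ha2 hb2] : a./2 < size lab /\ b./2 < size lab.
  by move: ha hb; rewrite size_legs; lia.
have nab : a./2 != b./2 by apply: contraNneq hab => e; rewrite ea e -eb.
case: x hx => // _.
  have := @even_arrow_star b./2 a./2; rewrite eq_sym -ea -eb; exact.
have [w' [h5 h6]] := @even_arrow_star a./2 b./2 nab ha2 hb2.
rewrite -ea -eb in h5; exists (inv_chords w'); split; first exact: (cup_eq_inv h5).
move=> c; rewrite mem_rev => /mapP[d hd ->]; apply: star_inv; exact: h6.
Qed.

End StarChords.

(** * Intersection numbers of products of chords *)

Section ChordIndex.

Import GRing.Theory.
Local Open Scope ring_scope.

Variables (n : nat) (i : 'I_n).
Implicit Types (s : seq (strand n)) (u v w : seq chord).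

Lemma index_virtual s (l : seq nat) : word_index i s (cross n (virtual l)) = 0.
Proof.
elim: l s => //= p l IH s; rewrite IH addr0 /piece_index /=.
by case: (drop p s) => [|a [|b r]].
Qed.

Lemma index_chord_word z s (c : chord) : chord_in (size s) c ->
  word_index i s (cross n (chord_word c)) =
  crossing_index i c.2 (nth z s c.1.1) (nth z s c.1.2).
Proof.
case: c => [[a b] x] /and4P[h1 h2 h3 hx]; rewrite /= in h1 h2 h3.
rewrite chord_wordE; have [hb [r Er]] := chord_path_spec h1 h2 h3.
have Es := nth_permute_gen z (chord_path a b) (erefl (size s)).
rewrite Er in Es; move: (chord_path a b) hb Es => P hb /= Es.
have N1 : (1 < size s)%N by move: h1 h2 h3; lia.
rewrite !cross_cat.
have r1 : run s (cross n (virtual P)) = Some (permute P s).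
  by rewrite run_cross ?positions_virtual.
rewrite (word_index_cat _ _ r1) index_virtual add0r.
have r2 : run (permute P s) (cross n [:: (0%N, x); (0%N, Virtual)]) = Some (permute P s).
  by rewrite run_cross; [congr Some; exact: swapK | rewrite /= size_permute N1].
rewrite (word_index_cat _ _ r2) index_virtual addr0 Es /= addr0.
by rewrite !piece_index0 stepE /= addr0.
Qed.

Lemma index_chords_word z s u : all (chord_in (size s)) u ->
  word_index i s (cross n (chords_word u)) =
  \sum_(c <- u) crossing_index i c.2 (nth z s c.1.1) (nth z s c.1.2).
Proof.
elim: u => [|c u IH] /=; first by rewrite big_nil.
case/andP => hc /IH h; rewrite big_cons -h -(index_chord_word z hc) cross_cat.
apply: word_index_cat; rewrite run_cross ?permute_chord_word //; exact: chord_word_below.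
Qed.

End ChordIndex.

(** * Plat form *)

Section Plat.

Variables (n : nat) (k : bool).
Implicit Types (s r t : seq (strand n)) (lab : seq (strand n)) (w u v : word n) (l : xword).
Notation teq := (@teq n k).
Notation xeq := (xeq n k).

Definition caps m : word n := nseq m (0, Cap).

Lemma run_caps_split m t s : run t (caps m) = Some s ->
  exists t1, [/\ t = t1 ++ s, size t1 = m.*2 & run t1 (caps m) = Some [::]].
Proof.
elim: m t => [|m IH] t /=; first by case=> ->; exists [::].
rewrite step0; case: t => [|a [|b t]] //=; case: ifP => // hab /IH[t1 [-> h1 h2]].
by exists [:: a, b & t1]; rewrite /= step0 hab h1.
Qed.

Lemma caps_shift m t s v s' : run t (caps m) = Some s -> run s v = Some s' ->
  teq t (caps m ++ v) (shift m.*2 v ++ caps m).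
Proof.
move=> /run_caps_split[t1 [-> h1 h2]] hv.
by have := interchange_words k h2 hv; rewrite shift0 h1.
Qed.

(** The last clause gives the permutation of the virtual word, which [snake] needs in order to
    follow the strands. *)
Lemma cup_to_end s p c d : p <= size s -> exists l : seq nat,
  [/\ below (size s).+2 l,
      teq s [:: (p, Cup c d)] ((size s, Cup c d) :: cross n (virtual l)) &
      forall (u : seq nat) x y, size u = size s ->
        permute l (u ++ [:: x; y]) = take p u ++ [:: x, y & drop p u]].
Proof.
move=> hp; have [m E] : exists m, m = size s - p by eexists.
elim: m p hp E => [|m IH] p hp E.
  have -> : p = size s by lia.
  exists [::]; split=> //; first exact: teq_refl.
  by move=> u x y hu; rewrite -hu take_size drop_size.
have hps : p < size s by lia.
have [|l [hl h hperm]] := IH p.+1 hps; first by lia.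
exists (l ++ [:: p; p.+1]); split; first by rewrite below_cat hl /=; lia.
  apply: teq_trans (cup_right k c d hps) _.
  rewrite virtual_cat cross_cat -cat_cons.
  exact: (teq_catr [:: (p, Cross Virtual); (p.+1, Cross Virtual)] h).
move=> u x y hu; have hpu : p < size u by rewrite hu.
rewrite permute_cat hperm // (take_nth 0) // (drop_nth 0 hpu) cat_rcons.
have := @permute_shift _ p [:: 0; 1] (take p u) [:: nth 0 u p, x, y & drop p.+1 u].
by rewrite /= addn0 addn1; apply; rewrite size_takel // ltnW.
Qed.

Lemma cup_to_end_upward s p c d : p <= size s -> exists l : seq nat,
  below (size s).+2 l /\ teq s [:: (p, Cup c d)] ((size s, Cup c true) :: cross n (virtual l)).
Proof.
move=> hp; have [l [hl h _]] := cup_to_end c d hp.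
case: d h => h; first by exists l.
exists (size s :: l); split; first by rewrite /= ltnSn.
apply: (teq_trans h).
exact: (teq_catr (cross n (virtual l)) (teq_sym (kink_cup k c true Virtual (leqnn _)))).
Qed.

Lemma cap_left s p t : step s (p.+1, Cap) = Some t ->
  teq s [:: (p.+1, Cap)] (cross n (virtual [:: p; p.+1]) ++ [:: (p, Cap)]).
Proof.
case/step_some => l0 [x [y [r [-> _ hl hx]]]].
case: x hx => [|[c d] [|[c' d'] []]] //=; case: ifP => // /andP[/eqP<- hd] _.
rewrite (partner_orientation hd) {d' hd}.
elim/last_ind: l0 hl => // l0 b _; rewrite size_rcons => -[hl]; rewrite cat_rcons.
have H : teq [:: b, (c, d), (c, ~~ d) & r] [:: (1, Cap)]
    [:: (0, Cross Virtual); (1, Cross Virtual); (0, Cap)].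
  apply: (@teq_trans _ _ _ [:: (0, Cross Virtual); (0, Cross Virtual); (1, Cap)]).
    apply: (@teq_catr _ _ _ [::] [:: (0, Cross Virtual); (0, Cross Virtual)]).
    by apply: teq_sym; apply: (@xeq_RII n k 2 0 Virtual).
  apply: (@teq_catl _ _ _ [:: (c, d), b, (c, ~~ d) & r] [:: (0, Cross Virtual)]).
    by rewrite /= ?stepE.
  exact: (teq_lmove (@lm_slide_cap n k c d b Virtual r)).
by have := teq_shift l0 H; rewrite /shift /= hl addn0 addn1.
Qed.

Lemma cap_to_front s p t : step s (p, Cap) = Some t -> exists l : seq nat,
  [/\ below (size s) l,
      teq s [:: (p, Cap)] (cross n (virtual l) ++ [:: (0, Cap)]) &
      forall (T : Type) (u v : seq T) x y, size u = p ->
        permute l (u ++ [:: x, y & v]) = [:: x, y & u ++ v]].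
Proof.
elim: p s t => [|p IH] s t hs.
  exists [::]; split=> //; first exact: teq_refl.
  by move=> T [|? ?].
have h := cap_left hs.
have hps : p.+2 < size s.
  have [l0 [x [y [r [-> _ hl /act_size[hx _]]]]]] := step_some hs.
  by rewrite !size_cat hl hx /=; lia.
have hb : below (size s) [:: p; p.+1] by rewrite /= hps ltnW.
have hr : run s (cross n (virtual [:: p; p.+1]) ++ [:: (p, Cap)]) = Some t.
  by rewrite -(teq_run h) /= hs.
move: hr; rewrite run_cat.
rewrite run_cross ?positions_virtual //; set s' := permute _ s => /=.
case E: (step s' (p, Cap)) => [t'|] //= _.
have [l [hl h' hperm]] := IH _ _ E.
exists ([:: p; p.+1] ++ l); split.
- by rewrite below_cat hb; move: hl; rewrite size_permute.
- apply: teq_trans h _; rewrite virtual_cat cross_cat -catA.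
  by apply: teq_catl h'; rewrite run_cross ?positions_virtual.
move=> T u v x y; elim/last_ind: u => // u z _; rewrite size_rcons => -[hu].
have E3 : permute [:: p; p.+1] (u ++ [:: z, x, y & v]) = u ++ [:: x, y, z & v].
  have := @permute_shift _ p [:: 0; 1] u [:: z, x, y & v] hu.
  by rewrite /= addn0 addn1.
by rewrite permute_cat cat_rcons E3 hperm // cat_rcons.
Qed.

(** A piece added on top first slides below the maxima. A minimum is then moved to the right end,
    beyond all crossings, and sinks to the other minima; a maximum is moved to the left end of what
    the others leave and becomes the last of them. Virtual twists make all left legs point
    upwards. *)
Lemma plat w s : run [::] w = Some s -> exists lab l m,
  [/\ all snd lab, below (size lab).*2 (positions l) &
      teq [::] w (cups 0 lab ++ cross n l ++ caps m)].
Proof.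
elim/last_ind: w s => [|w [p e] IH] s.
  by move=> _; exists [::], [::], 0; split=> //; apply: teq_refl.
rewrite -cats1 run_cat; case hw: (run [::] w) => [s0|] //=.
case he: (step s0 (p, e)) => [s1|] //= _.
have [lab [l [m [hup hl h]]]] := IH _ hw.
have hN : size (legs lab) = (size lab).*2 by apply: size_legs.
set t := permute (positions l) (legs lab).
have rl : run (legs lab) (cross n l) = Some t by rewrite run_cross // hN.
have rc : run [::] (cups 0 lab ++ cross n l) = Some t.
  by rewrite run_cat run_cups0 /= rl.
have rm : run t (caps m) = Some s0.
  by have := teq_run h; rewrite hw catA run_cat rc /= => ->.
have st : size t = (size lab).*2 by rewrite size_permute.
have ss0 : m.*2 + size s0 = (size lab).*2.
  by have [t1 [Et h1 _]] := run_caps_split rm; rewrite -st Et size_cat h1.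
have main : teq [::] (w ++ [:: (p, e)])
    ((cups 0 lab ++ cross n l) ++ [:: (m.*2 + p, e)] ++ caps m).
  apply: teq_trans (teq_catr _ h) _; rewrite (catA (cups 0 lab)) -catA.
  apply: (teq_catl rc).
  by have := @caps_shift m t s0 [:: (p, e)] s1 rm; rewrite /= he; apply.
case: e he main => [c d| |x] he main.
- have hp := step_le he; have hq : m.*2 + p <= size t by rewrite st -ss0 leq_add2l.
  have [l' [hl' h']] := cup_to_end_upward c d hq.
  exists (rcons lab (c, true)), (l ++ virtual l'), m; split.
  + by rewrite all_rcons.
  + rewrite positions_cat positions_virtual below_cat size_rcons doubleS.
    rewrite (below_leq _ hl) ?leqW //=; by rewrite st in hl'.
  apply: (teq_trans main).
  apply: (@teq_trans _ _ _ ((cups 0 lab ++ cross n l) ++ ((size t, Cup c true) :: cross n (virtual l')) ++ caps m)).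
    by apply: (teq_catl rc); apply: teq_catr.
  rewrite -cats1 cups_cat add0n cross_cat /= -!catA; apply: (teq_catl (run_cups0 lab)).
  apply: (@teq_trans _ _ _ ((cross n l ++ [:: (size t, Cup c true)]) ++ (cross n (virtual l') ++ caps m))).
    by rewrite -catA; apply: teq_refl.
  have := @interchange_piece n k (legs lab) t [::] _ (cross n l) 0 (Cup c true) rl (step0 _ _).
  rewrite cats0 !addn0 hN => H.
  exact: (teq_catr (cross n (virtual l') ++ caps m) H).
- have [l' [hl' h' _]] := cap_to_front he.
  have hp : teq s0 [:: (p, Cap)] (cross n (virtual l') ++ [:: (0, Cap)]) by [].
  exists lab, (l ++ virtual (map (addn m.*2) l')), m.+1; split=> //.
    rewrite positions_cat positions_virtual below_cat hl /=.
    by rewrite -ss0 below_shift.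
  apply: teq_trans (teq_catr _ h) _; rewrite (catA (cups 0 lab)) -catA.
  apply: (@teq_trans _ _ _ ((cups 0 lab ++ cross n l) ++
     (cross n (virtual (map (addn m.*2) l')) ++ caps m.+1))); last first.
    by rewrite cross_cat -!catA; apply: teq_refl.
  apply: (teq_catl rc); apply: teq_trans (teq_catl rm hp) _.
  have rl' : run s0 (cross n (virtual l')) = Some (permute l' s0).
    by rewrite run_cross ?positions_virtual.
  have := caps_shift rm rl'; rewrite -cross_xshift xshift_virtual => H.
  rewrite catA; apply: teq_trans (teq_catr [:: (0, Cap)] H) _.
  rewrite -catA /caps -(addn1 m) nseqD; exact: teq_refl.
- have hps : p.+1 < size s0.
    have [l0 [x0 [y [r [-> _ hl0 /act_size[hx _]]]]]] := step_some he.
    by rewrite !size_cat hl0 hx /=; lia.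
  exists lab, (l ++ [:: (m.*2 + p, x)]), m; split=> //.
    by rewrite positions_cat below_cat hl /= -ss0 -addnS ltn_add2l hps.
  by rewrite cross_cat -!catA; rewrite -!catA in main.
Qed.

(* The pairs of strands [(2 j, 2 j + 1)] and [(2 j + 2, 2 j + 3)] are exchanged. *)
Definition swap_pairs j := [:: j.*2.+1; j.*2; j.*2.+2; j.*2.+1].

Lemma caps_cat i j : caps (i + j) = caps i ++ caps j.
Proof. exact: nseqD. Qed.

Lemma caps_under m j v t s : run t (caps j) = Some s ->
  (exists s', run s v = Some s') ->
  teq s (v ++ caps m) (caps m) -> teq t (shift j.*2 v ++ caps (j + m)) (caps (j + m)).
Proof.
move=> ht [s' hv] h; rewrite caps_cat catA.
apply: teq_trans (teq_catr _ (teq_sym (caps_shift ht hv))) _.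
by rewrite -catA; apply: teq_catl h.
Qed.

Lemma run_caps_cat i j t s : run t (caps (i + j)) = Some s ->
  exists2 s', run t (caps i) = Some s' & run s' (caps j) = Some s.
Proof.
rewrite caps_cat run_cat; case: (run t (caps i)) => [s'|] //= h; by exists s'.
Qed.

Lemma caps_flip m t s j : run t (caps m) = Some s -> j < m ->
  teq t (cross n (virtual [:: j.*2]) ++ caps m) (caps m).
Proof.
move=> ht hj; have em : m = j + (m - j.+1).+1 by lia.
move: ht; rewrite em; move: (m - j.+1) => m' /run_caps_cat[s' hs h].
have := @caps_under m'.+1 j [:: (0, Cross Virtual)] t s' hs.
rewrite /shift /= addn0; apply.
  have [t1 [Et h1 _]] := run_caps_split h; exists (swap 0 s').
  by rewrite /= step_cross // Et size_cat h1.
move: h; rewrite /= step0; case: s' {hs} => [|[c d] [|[c' d'] s']] //=.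
case: ifP => // /andP[/eqP<- hd] _; rewrite (partner_orientation hd).
exact: (teq_catr (caps m') (@kink_cap0 n k c d Virtual s')).
Qed.

(** Two uses of [cap_left], read backwards, carry the first maximum to the right of the second;
    exchanging their heights gives back two maxima at the left end. *)
Lemma caps_swap_pairs m t s j : run t (caps m) = Some s -> j.+1 < m ->
  teq t (cross n (virtual (swap_pairs j)) ++ caps m) (caps m).
Proof.
move=> ht hj; have em : m = j + (m - j.+2).+2 by lia.
move: ht; rewrite em; move: (m - j.+2) => m' /run_caps_cat[s' hs h].
have := @caps_under m'.+2 j (cross n (virtual [:: 1; 0; 2; 1])) t s' hs.
rewrite /shift /= addn0 addn1 addn2; apply.
  have [t1 [Et h1 _]] := run_caps_split h; exists (permute [:: 1; 0; 2; 1] s').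
  apply: (@run_cross n s' (virtual [:: 1; 0; 2; 1])).
  by rewrite Et size_cat h1.
move: h; rewrite /= step0; case: s' {hs} => [|[c d] [|[c' d'] s']] //=.
case: ifP => // /andP[/eqP<- hd]; rewrite /= ?step0.
case: s' => [|[e f] [|[e' f'] s']] //=; case: ifP => // /andP[/eqP<- hf] _.
rewrite (partner_orientation hd) (partner_orientation hf) {c' d' e' f' hd hf}.
apply: (@teq_catr n k _ (cross n (virtual [:: 1; 0; 2; 1]) ++ [:: (0, Cap); (0, Cap)]) [:: (0, Cap); (0, Cap)] (caps m')).
set r := [:: (c, d), _ & _]; have hr : 4 <= size r by [].
have neq := partner_neq.
apply: (@teq_trans _ _ _ (cross n (virtual [:: 1; 2; 0; 1]) ++ [:: (0, Cap); (0, Cap)])).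
  by apply: teq_catr; apply: (@xeq_virtual n k 4 [:: 1; 0; 2; 1] [:: 1; 2; 0; 1] isT isT erefl r hr).
apply: (@teq_trans _ _ _ (cross n (virtual [:: 1; 2]) ++ [:: (1, Cap); (0, Cap)])).
  apply: (@teq_catl _ _ _ [:: (c, d), (e, f), (e, ~~ f), (c, ~~ d) & s'] (cross n (virtual [:: 1; 2]))).
    by rewrite run_cross.
  apply: (@teq_catr _ _ _ (cross n (virtual [:: 0; 1]) ++ [:: (0, Cap)]) [:: (1, Cap)] [:: (0, Cap)]).
  apply: teq_sym; apply: cap_left; rewrite stepS step0 /= eqxx neq //=.
apply: (@teq_trans _ _ _ [:: (2, Cap); (0, Cap)]).
  apply: (@teq_catr _ _ _ (cross n (virtual [:: 1; 2]) ++ [:: (1, Cap)]) [:: (2, Cap)] [:: (0, Cap)]).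
  apply: teq_sym; apply: cap_left; rewrite !stepS step0 /= eqxx neq //=.
apply: teq_sym; apply: teq_lmove.
apply: (@lm_exchange n k [:: (c, d); (c, ~~ d)] [::] [:: (e, f), (e, ~~ f) & s'] s' 0 Cap Cap).
  by rewrite /= eqxx neq.
by rewrite step0 /= eqxx neq.
Qed.

Lemma cups_swap_pairs (l1 : seq (strand n)) a b (l2 : seq (strand n)) :
  teq [::] (cups 0 (l1 ++ a :: b :: l2))
    (cups 0 (l1 ++ b :: a :: l2) ++ cross n (virtual (swap_pairs (size l1)))).
Proof.
rewrite !cups_cat !add0n -catA; apply: (teq_catl (run_cups0 l1)).
set P := (size l1).*2; set L := legs l1; have hL : size L = P by apply: size_legs.
pose V := swap_pairs (size l1).
pose t := L ++ legs [:: b; a].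
have rt : run L (cups P [:: b; a]) = Some t by rewrite -hL run_cups.
have st : size t = P.+4 by rewrite /t size_cat hL addn4.
have hV : below (size t) V by rewrite st /V /swap_pairs /below /= -/P; lia.
have stV : size (permute V t) = P.+4 by rewrite size_permute.
have H := interchange_words k (run_cross (l := virtual V) (s := t) _) (run_cups0 l2).
rewrite positions_virtual in H; move: (H hV) => {}H.
rewrite !shift_cups !addn0 stV st cats0 in H.
have loc : teq L (cups P [:: a; b]) (cups P [:: b; a] ++ cross n (virtual V)).
  have r1 : run L [:: (P, Cup a.1 a.2)] = Some (L ++ legs [:: a]).
    by rewrite -hL; apply: (run_cups L [:: a]).
  have s1 : size (L ++ legs [:: a]) = P.+2 by rewrite size_cat hL addn2.
  have q0 : P < size (L ++ legs [:: a]) by rewrite s1.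
  have q1 : P.+1 < size (L ++ legs [:: a]) by rewrite s1.
  apply: teq_sym; apply: (@teq_trans n k _ ([:: (P, Cup a.1 a.2); (P, Cup b.1 b.2)] ++ cross n (virtual V))).
    apply: teq_catr.
    have := @teq_shift n k L _ _ _ (teq_lmove (@lm_exchange n k [::] _ [::] _ 0 (Cup b.1 b.2)
      (Cup a.1 a.2) erefl (step0 _ _))).
    by rewrite !cats0 /shift /= hL !addn0 addn2.
  apply: (@teq_trans n k _ ([:: (P, Cup a.1 a.2)] ++ [:: (P.+2, Cup b.1 b.2)] ++
      cross n (virtual (rev V ++ V)))).
    apply: (teq_catl r1).
    apply: (@teq_trans n k _ ([:: (P.+1, Cup b.1 b.2); (P, Cross Virtual); (P.+1, Cross Virtual)]
      ++ cross n (virtual V))).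
      exact: (teq_catr (cross n (virtual V)) (cup_right k b.1 b.2 q0)).
    exact: (teq_catr ([:: (P, Cross Virtual); (P.+1, Cross Virtual)] ++ cross n (virtual V))
      (cup_right k b.1 b.2 q1)).
  have r2 : run L (cups P [:: a; b]) = Some (L ++ legs [:: a; b]) by rewrite -hL run_cups.
  have s2 : size (L ++ legs [:: a; b]) = size t by rewrite !size_cat.
  have := teq_catl r2 (@xeq_virtual n k (size t) (rev V ++ V) [::] _ isT _ _ _).
  rewrite cats0 => H'; apply: H' => //; last by rewrite s2.
    by rewrite below_cat below_rev hV.
  by rewrite permute_cat permuteVK.
apply: (@teq_trans n k _ ((cups P [:: b; a] ++ cross n (virtual V)) ++ cups P.+4 l2)).
  exact: (teq_catr (cups P.+4 l2) loc).
rewrite -catA -[cups _ (b :: a :: l2)]/(cups P [:: b; a] ++ cups P.+4 l2) -catA.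
apply: (teq_catl rt); exact: H.
Qed.

End Plat.

(** * Cancelling minima *)

Lemma swap_left (T : Type) p (u v : seq T) : p.+1 < size u -> swap p (u ++ v) = swap p u ++ v.
Proof.
elim: p u => [|p IH] [|a u] //=; first by case: u.
by rewrite ltnS => /IH->.
Qed.

Lemma permute_left (T : Type) (l : seq nat) (u v : seq T) : below (size u) l ->
  permute l (u ++ v) = permute l u ++ v.
Proof.
elim: l u => //= p l IH u /andP[hp hl].
by rewrite swap_left // IH // size_swap.
Qed.

Section MergingMinima.

Variables (n : nat) (k : bool).
Implicit Types (s r t : seq (strand n)) (lab : seq (strand n)) (w u v : word n) (l : xword).
Notation teq := (@teq n k).
Notation xeq := (xeq n k).

(* The last minimum is cancelled by the first maximum when the latter joins one
   of its legs to another strand. *)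
Lemma snake_last s c d (W : seq nat) a (rest : seq nat) t : below (size s).+2 W ->
  permute W (iota 0 (size s).+2) = [:: a, size s & rest] -> a < size s ->
  run s ((size s, Cup c d) :: cross n (virtual W) ++ [:: (0, Cap)]) = Some t ->
  exists2 W' : seq nat, below (size s) W' &
    teq s ((size s, Cup c d) :: cross n (virtual W) ++ [:: (0, Cap)]) (cross n (virtual W')).
Proof.
set M := size s => hW EW haM hr.
have hc : step s (M, Cup c d) = Some (s ++ [:: (c, d); (c, ~~ d)]).
  by rewrite step_cup // take_size drop_size.
set s2 := s ++ _ in hc; have hs2 : size s2 = M.+2 by rewrite size_cat addn2.
have hrW : run s2 (cross n (virtual W)) = Some (permute W s2).
  by rewrite run_cross ?positions_virtual ?hs2.
pose z := (c, d); pose x := nth z s a.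
have EWs : permute W s2 = [:: x, (c, d) & map (nth z s2) rest].
  rewrite (nth_permute_gen z W hs2) EW /= !nth_cat haM ltnn subnn //.
have Ex : x = (c, ~~ d).
  move: hr; rewrite [run _ _]/= hc /= run_cat hrW /= EWs step0 /=.
  case: (x) => [c' d'] /=; case: ifP => // /andP[/eqP-> hd] _.
  by move: hd; case: (d); case: (d').
(* Strand [a] is brought next to the minimum, to form a zigzag with it. *)
pose J := take a (iota 0 M) ++ drop a.+1 (iota 0 M).
have Ei : iota 0 M = take a (iota 0 M) ++ a :: drop a.+1 (iota 0 M).
  by rewrite -{1}(cat_take_drop a (iota 0 M)) (drop_nth 0) ?size_iota // nth_iota.
have hJ : perm_eq (rcons J a) (iota 0 M).
  by rewrite Ei perm_rcons /J -cat1s perm_catCA.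
have sJ : size J = M.-1 by have := perm_size hJ; rewrite size_rcons size_iota => <-.
have hM : M = M.-1.+1 by lia.
have [R hR ER] := permute_exists hJ; rewrite size_iota in hR.
have hrR : run s (cross n (virtual R)) = Some (permute R s).
  by rewrite run_cross ?positions_virtual.
pose s0 := map (nth z s) J.
have ERs : permute R s = s0 ++ [:: x].
  by rewrite (nth_permute_gen z R (erefl (size s))) -/M ER map_rcons -cats1.
have ss0 : size s0 = M.-1 by rewrite size_map.
pose s3 := s0 ++ [:: (c, ~~ d), (c, d) & [:: (c, ~~ d)]].
have ss3 : size s3 = M.+2 by rewrite size_cat ss0 /=; lia.
have hcap : step s3 (M.-1, Cap) = Some (s0 ++ [:: (c, ~~ d)]).
  rewrite -ss0; apply: (@step_act n s0 [:: (c, ~~ d); (c, d)] [::] [:: (c, ~~ d)] Cap).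
  by rewrite /= eqxx partner_neq.
have [C [hC hC1 hC2]] := cap_to_front k hcap; rewrite ss3 in hC.
have hrest : perm_eq rest (rcons J M.+1).
  have h1 : perm_eq [:: a, M & rest] (iota 0 M.+2).
    by rewrite -EW perm_permute.
  apply/permP => q; move/permP/(_ q): h1; move/permP/(_ q): hJ.
  by rewrite -(addn2 M) iotaD count_cat -!cats1 !count_cat /= add0n; lia.
have [U hU EU] := permute_exists hrest; rewrite size_rcons sJ -hM in hU.
exists (R ++ U); first by rewrite below_cat hR.
have hRb : below M.+2 R by apply: below_leq hR; lia.
have hUb : below M.+2 (map (addn 2) U) by rewrite (below_shift 2).
(* [R] brings strand [a] next to the minimum, [C] moves the resulting pair to the front where the
   maximum sits, and [U] arranges the other strands as [W] does. *)
have WE : xeq M.+2 (virtual W) (virtual (R ++ C ++ map (addn 2) U)).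
  apply: xeq_virtual => //; first by rewrite !below_cat hRb hC.
  rewrite EW !permute_cat.
  have -> : iota 0 M.+2 = iota 0 M ++ [:: M; M.+1] by rewrite -addn2 iotaD.
  have pR : permute R (iota 0 M ++ [:: M; M.+1]) = J ++ [:: a, M & [:: M.+1]].
    by rewrite permute_left ?size_iota // ER -cats1 -catA.
  rewrite pR hC2 // (@permute_shift _ 2 U [:: a; M]) //.
  by rewrite cats1 EU.
apply: (@teq_trans _ _ _ ((M, Cup c d) :: cross n (virtual (R ++ C ++ map (addn 2) U)) ++ [:: (0, Cap)])).
  apply: (@teq_after_cup' n k s M c d s2 _ _ hc); apply: teq_catr; apply: WE.
  by rewrite hs2.
rewrite virtual_cat virtual_cat !cross_cat -[virtual (map _ U)](xshift_virtual 2) cross_xshift -!catA.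
have hrC : run s3 (cross n (virtual C)) = Some [:: (c, ~~ d), (c, d) & s0 ++ [:: (c, ~~ d)]].
  by rewrite run_cross ?positions_virtual ?ss3 // hC2.
have hrRs2 : run s2 (cross n (virtual R)) = Some s3.
  rewrite run_cross ?positions_virtual ?hs2 // permute_left // ERs Ex.
  by rewrite -catA.
apply: (@teq_trans _ _ _ ((M, Cup c d) :: cross n (virtual R) ++ (cross n (virtual C) ++ [:: (0, Cap)]) ++ cross n (virtual U))).
  apply: (@teq_after_cup' n k s M c d s2 _ _ hc); apply: (teq_catl hrRs2).
  rewrite -catA; apply: (teq_catl hrC); apply: teq_sym.
  have hU' : run (s0 ++ [:: (c, ~~ d)]) (cross n (virtual U)) =
      Some (permute U (s0 ++ [:: (c, ~~ d)])).
    by rewrite run_cross ?positions_virtual // size_cat ss0 addn1 -hM.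
  have h0 : run [:: (c, ~~ d); (c, d)] [:: (0, Cap)] = Some [::].
    by rewrite /= step0 /= eqxx partner_neq.
  by have := interchange_words k h0 hU'; rewrite shift0.
apply: (@teq_trans _ _ _ ((M, Cup c d) :: cross n (virtual R) ++ [:: (M.-1, Cap)] ++ cross n (virtual U))).
  apply: (@teq_after_cup' n k s M c d s2 _ _ hc); apply: (teq_catl hrRs2).
  by apply: teq_catr; apply: teq_sym.
apply: (@teq_trans _ _ _ ((cross n (virtual R) ++ [:: (M, Cup c d)]) ++ [:: (M.-1, Cap)] ++ cross n (virtual U))).
  have := @interchange_piece n k s _ [::] _ _ 0 (Cup c d) hrR (step0 _ _).
  rewrite cats0 !addn0 size_permute -/M => h.
  apply: teq_sym; exact: (teq_catr ((M.-1, Cap) :: cross n (virtual U)) h).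
rewrite -catA (virtual_cat R U) cross_cat; apply: (teq_catl hrR); rewrite ERs Ex.
have := teq_shift s0 (teq_lmove (@lm_zigzag_left n k c d [::])).
rewrite /shift /= ss0 addn0 addn1 -hM => h.
exact: (teq_catr (cross n (virtual U)) h).
Qed.

(** The minimum is moved to the right end, where [snake_last] applies. *)
Lemma snake s p c d (W : seq nat) a b (rest : seq nat) t : p <= size s ->
  below (size s).+2 W -> permute W (iota 0 (size s).+2) = [:: a, b & rest] ->
  p <= b <= p.+1 -> ~~ (p <= a <= p.+1) -> a < (size s).+2 ->
  run s ((p, Cup c d) :: cross n (virtual W) ++ [:: (0, Cap)]) = Some t ->
  exists2 W' : seq nat, below (size s) W' &
    teq s ((p, Cup c d) :: cross n (virtual W) ++ [:: (0, Cap)]) (cross n (virtual W')).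
Proof.
set M := size s => hp hW EW hb ha haM hr.
have [l [hl hl1 hl2]] := cup_to_end k c d hp; rewrite -/M in hl.
have T1 : teq s ((p, Cup c d) :: cross n (virtual W) ++ [:: (0, Cap)])
    ((M, Cup c d) :: cross n (virtual (l ++ W)) ++ [:: (0, Cap)]).
  rewrite virtual_cat cross_cat -catA.
  exact: (teq_catr (cross n (virtual W) ++ [:: (0, Cap)]) hl1).
have hlW : below M.+2 (l ++ W) by rewrite below_cat hl.
pose t0 := take p (iota 0 M) ++ [:: M, M.+1 & drop p (iota 0 M)].
have st0 : size t0 = M.+2.
  by rewrite size_cat /= addnS addnS -size_cat cat_take_drop size_iota.
have stk : size (take p (iota 0 M)) = p by rewrite size_takel // size_iota.
have Et0 : permute (l ++ W) (iota 0 M.+2) = [:: nth 0 t0 a, nth 0 t0 b & map (nth 0 t0) rest].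
  rewrite permute_cat -{1}(addn2 M) iotaD add0n [iota M 2]/= hl2 ?size_iota // -/t0.
  by rewrite (nth_permute W st0) EW.
have na : nth 0 t0 a < M.
  rewrite nth_cat stk; case: (ltnP a p) => hap.
    by rewrite nth_take // nth_iota //; lia.
  have -> : a - p = (a - p.+2).+2 by lia.
  by rewrite /= nth_drop nth_iota; lia.
have nb : nth 0 t0 b = M \/ nth 0 t0 b = M.+1.
  rewrite nth_cat stk ltnNge; case/andP: hb => -> hb /=.
  have : b - p <= 1 by lia.
  by case: (b - p) => [|[|?]] //= _; [left|right].
rewrite (teq_run T1) in hr.
move: (nth 0 t0 a) (nth 0 t0 b) (map _ rest) Et0 na nb => a' b' rest' Et0 na nb.
case: nb => eb; subst b'.
  have [W' h1 h2] := snake_last hlW Et0 na hr.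
  by exists W' => //; apply: teq_trans T1 h2.
(* The maximum uses the right leg here; a virtual twist turns it into the left one. *)
have T2 : teq s ((M, Cup c d) :: cross n (virtual (l ++ W)) ++ [:: (0, Cap)])
    ((M, Cup c (~~ d)) :: cross n (virtual (M :: (l ++ W))) ++ [:: (0, Cap)]).
  have := kink_cup k c (~~ d) Virtual (leqnn (size s)); rewrite negbK => h.
  exact: (teq_catr (cross n (virtual (l ++ W)) ++ [:: (0, Cap)]) (teq_sym h)).
rewrite (teq_run T2) in hr.
have hlW' : below M.+2 (M :: l ++ W) by rewrite /= ltnSn.
pose t1 := iota 0 M ++ [:: M.+1; M].
have Et1 : permute (M :: l ++ W) (iota 0 M.+2) = [:: a', M & map (nth 0 t1) rest'].
  rewrite -[LHS]/(permute (l ++ W) (swap M (iota 0 M.+2))).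
  have -> : swap M (iota 0 M.+2) = t1.
    rewrite -(addn2 M) iotaD add0n /t1 -[swap _ _]/(permute [:: M] _) -{1}[M]addn0.
    by rewrite -[[:: M + 0]]/(map (addn M) [:: 0]) permute_shift ?size_iota.
  rewrite (@nth_permute t1 _ M.+2) ?size_cat ?size_iota ?addn2 // Et0 /=.
  by rewrite !nth_cat size_iota na nth_iota // ltnNge leqnSn /= subSnn.
have [W' h1 h2] := snake_last hlW' Et1 na hr.
by exists W' => //; apply: teq_trans T1 (teq_trans T2 h2).
Qed.

End MergingMinima.

Definition raise (c : chord) : chord := (c.1.1.+2, c.1.2.+2, c.2).

Lemma chords_xshift (u t : seq nat) (l : xword) :
  chords (u ++ t) (xshift (size u) l) = chords t l.
Proof.
elim: l t => //= -[p x] l IH t /=.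
have -> : swap (size u + p) (u ++ t) = u ++ swap p t.
  exact: (@permute_shift nat (size u) [:: p] u t).
rewrite IH; congr (_ ++ _); rewrite !nth_cat !ltnNge leq_addr.
by rewrite -addnS leq_addr /= !addKn.
Qed.

(** * Removing a minimum from a plat *)

Section MergingForm.

Variables (n : nat) (k : bool).
Implicit Types (s r t : seq (strand n)) (lab : seq (strand n)) (w v : word n) (l : xword).
Implicit Types (u : seq chord).
Notation teq := (@teq n k).
Notation xeq := (xeq n k).

Lemma xeq_raise N u : all (chord_in N) u ->
  xeq N.+2 (chords_word (map raise u)) (xshift 2 (chords_word u)).
Proof.
move=> hu; have hu' : all (chord_in N.+2) (map raise u) by rewrite all_map.
have hb := chords_word_below hu.
have hpos : positions (xshift 2 (chords_word u)) = map (addn 2) (positions (chords_word u)).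
  exact: positions_xshift.
have hb' : below N.+2 (positions (xshift 2 (chords_word u))).
  by rewrite hpos (below_shift 2).
have Ei : iota 0 N.+2 = iota 0 2 ++ iota 2 N by [].
apply: xeq_chords => //; first exact: chords_word_below.
  rewrite (chords_chords_word hu') ?size_iota // Ei.
  rewrite (chords_xshift (iota 0 2)) (chords_chords_word hu) ?size_iota // -map_comp.
  apply/eq_in_map => c hc; have := allP hu c hc.
  case: c {hc} => [[a b] x] /and4P[/= h1 h2 h3 h4].
  by rewrite /relabel /raise /= !nth_iota.
rewrite permute_chords_word hpos Ei (@permute_shift _ 2 _ (iota 0 2)) //.
by rewrite permute_chords_word.
Qed.

Lemma xeq_push_chords N (l : seq nat) u : below N l -> all (chord_in N) u ->
  xeq N (virtual l ++ chords_word u)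
    (chords_word (map (relabel (permute l (iota 0 N))) u) ++ virtual l).
Proof.
move=> hl hu; have hb := chords_word_below hu.
apply: xeq_trans (@xeq_factor n k N l _ hl hb) _.
rewrite (chords_chords_word hu) ?size_permute ?size_iota //.
apply: xeq_catl.
  apply: chords_word_below; rewrite all_map; apply/allP => c hc /=.
  by apply: chord_in_relabel; [exact: perm_permute | exact: (allP hu)].
apply: xeq_virtual => //; first by rewrite below_cat hl.
by rewrite permute_cat permute_chords_word.
Qed.

(** The first maximum joins legs of two different minima. Chords are moved off these two legs, pass
    above the maximum on the remaining strands, and leave a purely virtual zigzag, which removes the
    minimum of [b]. *)
Lemma merge_minima lab u (V : seq nat) a b (rest : seq nat) :
  all snd lab -> all (chord_in (size lab).*2) u -> below (size lab).*2 V ->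
  permute V (iota 0 (size lab).*2) = [:: a, b & rest] -> b != partner a ->
  run [::] (cups 0 lab ++ cross n (chords_word u ++ virtual V) ++ caps n (size lab)) = Some [::] ->
  exists lab' l, [/\ size lab' < size lab, all snd lab',
    below (size lab').*2 (positions l) &
    teq [::] (cups 0 lab ++ cross n (chords_word u ++ virtual V) ++ caps n (size lab))
      (cups 0 lab' ++ cross n l ++ caps n (size lab'))].
Proof.
move=> hup hu hV EV hab hrun.
set M := size lab in hu hV EV hrun *.
have ht : perm_eq [:: a, b & rest] (iota 0 M.*2) by rewrite -EV perm_permute.
have huniq : uniq [:: a, b & rest] by rewrite (perm_uniq ht) iota_uniq.
have hsz : size [:: a, b & rest] = M.*2 by rewrite (perm_size ht) size_iota.
have hlt i : (i \in [:: a, b & rest]) = (i < M.*2).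
  by rewrite (perm_mem ht) mem_iota.
have ha : a < M.*2 by rewrite -hlt mem_head.
have hb : b < M.*2 by rewrite -hlt !inE eqxx orbT.
have nab : b != a by apply: contraTneq huniq => ->; rewrite /= inE eqxx.
have hM : 1 < M.
  have h0 : 0 < M by rewrite -double_gt0; apply: leq_ltn_trans ha.
  rewrite ltn_neqAle h0 andbT; apply/eqP => hM1.
  by move: ha hb nab hab; rewrite -hM1; case: a b {EV ht huniq hsz hlt} => [|[|?]] [|[|?]].
have hN : size (legs lab) = M.*2 by apply: size_legs.
(* Since [b] is not the partner of [a], both partners are allowed, so every chord can be moved off
   [a] and [b]. *)
pose allowed p := (p != a) && (p != b).
have hallow p : p < size (legs lab) -> allowed p || allowed (partner p).
  move=> _; rewrite /allowed.
  have [->|_] := eqVneq p a; first by rewrite partner_ne /= eq_sym.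
  have [->|//] := eqVneq p b; rewrite partner_ne andbT /=.
  by apply: contraNneq hab => <-; rewrite partnerK.
have [|v [[_ hv hv1] hv2]] := cup_eq_allowed k hM hallow (u := u); first by rewrite hN.
rewrite hN in hv.
(* The places of the strands after the virtual word [V] and the first maximum. *)
pose lower (c : chord) : chord := (index c.1.1 rest, index c.1.2 rest, c.2).
have hres : size rest = M.*2 - 2 by move: hsz => /=; lia.
have hM2 : M.*2 = (M.*2 - 2).+2 by lia.
have in_rest i : i < M.*2 -> allowed i -> i \in rest.
  by rewrite -hlt !inE => /or3P[/eqP->|/eqP->|//] /andP[]; rewrite eqxx.
have vin c : c \in v -> [/\ c.1.1 \in rest, c.1.2 \in rest & chord_in M.*2 c].
  move=> hc; have hci := allP hv c hc; have /and4P[_ h1 h2 _] := hci.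
  by have /andP[h3 h4] := hv2 c hc; split=> //; apply: in_rest.
pose v' := map lower v.
have hv' : all (chord_in (M.*2 - 2)) v'.
  rewrite all_map; apply/allP => c hc; have [h1 h2 /and4P[h3 _ _ h4]] := vin c hc.
  apply/and4P; split; rewrite //= -?hres ?index_mem //.
  by apply: contra h3 => /eqP h; rewrite -(nth_index 0 h1) h nth_index.
have Ev : map (relabel [:: a, b & rest]) (map raise v') = v.
  rewrite -!map_comp -[RHS]map_id; apply/eq_in_map => c hc.
  have [h1 h2 _] := vin c hc; case: c {hc} h1 h2 => [[x y] z] /= h1 h2.
  by rewrite /relabel /= !nth_index.
have hrv' : all (chord_in M.*2) (map raise v') by rewrite hM2 all_map.
have rl : run [::] (cups 0 lab) = Some (legs lab) by apply: run_cups0.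
have T1 : teq [::] (cups 0 lab ++ cross n (chords_word u ++ virtual V) ++ caps n M)
    (cups 0 lab ++ cross n (virtual V) ++ shift 2 (cross n (chords_word v')) ++ caps n M).
  rewrite cross_cat -!catA catA.
  apply: (teq_trans (teq_catr _ hv1)); rewrite -catA; apply: (teq_catl rl).
  rewrite !catA; apply: teq_catr; rewrite -cross_cat -cross_xshift -cross_cat.
  have X : xeq M.*2 (chords_word v ++ virtual V) (virtual V ++ xshift 2 (chords_word v')).
    apply: (@xeq_trans _ _ _ (virtual V ++ chords_word (map raise v'))).
      by apply: xeq_sym; have := xeq_push_chords hV hrv'; rewrite EV Ev.
    by apply: xeq_catl; rewrite ?positions_virtual // hM2; apply: xeq_raise.
  by apply: X; rewrite hN.
rewrite (teq_run T1) in hrun.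
have rV : run (legs lab) (cross n (virtual V)) = Some (permute V (legs lab)).
  by rewrite run_cross ?positions_virtual ?hN.
have sV : size (permute V (legs lab)) = M.*2 by rewrite size_permute hN.
move ErV : (permute V (legs lab)) rV sV => tV rV sV.
case: tV ErV rV sV => [|x [|y r]] ErV rV sV; [by move: sV => /=; lia|by move: sV => /=; lia|].
have sr : size r = M.*2 - 2 by move: sV => /=; lia.
have hX : run r (cross n (chords_word v')) = Some r.
  by rewrite run_cross ?permute_chords_word // sr chords_word_below.
have hX2 : run [:: x, y & r] (shift 2 (cross n (chords_word v'))) = Some [:: x, y & r].
  by have := run_shift [:: x; y] r (cross n (chords_word v')); rewrite hX.
have Ecaps : caps n M = (0, Cap) :: caps n M.-1 by rewrite -{1}(prednK (ltnW hM)).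
have hcap : run [:: x, y & r] [:: (0, Cap)] = Some r /\ run [:: x; y] [:: (0, Cap)] = Some [::].
  move: hrun; rewrite run_cat rl /= run_cat rV /= run_cat hX2 /= Ecaps /= !step0.
  by case: (x) (y) => [c d] [c' d'] /=; case: ifP.
case: hcap => hcap hcap2.
have T2 : teq [:: x, y & r] (shift 2 (cross n (chords_word v')) ++ caps n M)
    ([:: (0, Cap)] ++ cross n (chords_word v') ++ caps n M.-1).
  rewrite Ecaps; have := interchange_words k hcap2 hX; rewrite shift0 => h.
  by have := teq_catr (caps n M.-1) (teq_sym h); rewrite -!catA.
have hbN : b < size (legs lab) by rewrite hN.
have [l1 [e [l2 [El sl1 sl]]]] := cup_split hbN.
set s := legs (l1 ++ l2) in sl.
have hs2 : (size s).+2 = M.*2 by rewrite -sl.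
have CL := cups_last k l1 e l2; rewrite -El in CL.
have rs : run [::] (cups 0 (l1 ++ l2)) = Some s by apply: run_cups0.
have rcup : run s [:: ((size l1).*2, Cup e.1 e.2)] = Some (legs lab).
  by move: (teq_run CL); rewrite rl run_cat rs /=.
have hp : (size l1).*2 <= size s by rewrite size_legs size_cat leq_double leq_addr.
have := @snake n k s (size l1).*2 e.1 e.2 V a b rest r hp; rewrite hs2 => /(_ hV EV).
case=> //.
- by rewrite sl1 -{2 3}(odd_double_half b); case: (odd b) => /=; lia.
- rewrite sl1; apply/negP => hab'; case/negP: hab; apply/eqP.
  have eh : a./2 = b./2 by lia.
  move: nab; rewrite -(odd_double_half b) -(odd_double_half a) eh.
  by case: (odd a); case: (odd b); rewrite ?partnerE ?eqxx.
- by rewrite -cat1s run_cat rcup /= run_cat rV.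
move=> W' hW' T3; exists (l1 ++ l2), (virtual W' ++ chords_word v').
have sM : size (l1 ++ l2) = M.-1.
  by move: hs2; rewrite size_legs; lia.
split.
- by rewrite sM; lia.
- by move: hup; rewrite El !all_cat /= => /and3P[-> _ ->].
- have -> : (size (l1 ++ l2)).*2 = M.*2 - 2 by rewrite sM; lia.
  rewrite positions_cat positions_virtual below_cat chords_word_below // andbT.
  by move: hW'; have -> : size s = M.*2 - 2 by rewrite -hs2 subSS subSS subn0.
apply: (teq_trans T1); apply: (@teq_trans _ _ _ (cups 0 lab ++ cross n (virtual V) ++
    [:: (0, Cap)] ++ cross n (chords_word v') ++ caps n M.-1)).
  by apply: (teq_catl rl); apply: (teq_catl rV).
apply: (teq_trans (teq_catr _ CL)); rewrite -catA; apply: (teq_catl rs).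
rewrite sM cross_cat -catA; have := teq_catr (cross n (chords_word v') ++ caps n M.-1) T3.
by rewrite cat_cons -catA.
Qed.

End MergingForm.

Lemma permute_swap_pairs (T : Type) j (u v : seq T) x y z w : size u = j.*2 ->
  permute (swap_pairs j) (u ++ [:: x, y, z, w & v]) = u ++ [:: z, w, x, y & v].
Proof.
move=> hu; have := @permute_shift T j.*2 [:: 1; 0; 2; 1] u [:: x, y, z, w & v] hu.
by rewrite /= addn0 addn1 addn2 => <-.
Qed.

Lemma nth_swap_pairs (T : Type) (x0 : T) (t : seq T) j : j.*2.+3 < size t ->
  nth x0 (permute (swap_pairs j) t) j.*2 = nth x0 t j.*2.+2 /\
  nth x0 (permute (swap_pairs j) t) j.*2.+1 = nth x0 t j.*2.+3.
Proof.
move=> hj; rewrite -(cat_take_drop j.*2 t).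
have stk : size (take j.*2 t) = j.*2 by rewrite size_takel //; lia.
have : 3 < size (drop j.*2 t) by rewrite size_drop; lia.
have E (v : seq T) i : nth x0 (take j.*2 t ++ v) (j.*2 + i) = nth x0 v i.
  by rewrite nth_cat stk ltnNge leq_addr addKn.
move: (take _ _) stk E => u su E.
case: (drop _ _) => [|x [|y [|z [|w v]]]] // _; rewrite permute_swap_pairs //.
split; first by rewrite -{1}[j.*2]addn0 -addn2 !E.
by rewrite -addn3 -addn1 !E.
Qed.

Lemma below_swap_pairs m j : j.+1 < m -> below m.*2 (swap_pairs j).
Proof. by move=> h; rewrite /swap_pairs /below /=; lia. Qed.

Lemma partnerSS p : partner p.+2 = (partner p).+2.
Proof. by rewrite /partner /= negbK; case: p => //= p; case: ifP. Qed.

(** * Plats in which every maximum closes a minimum *)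

Section Closed.

Variables (n : nat) (k : bool).
Implicit Types (s r t : seq (strand n)) (lab : seq (strand n)) (w v : word n) (l : xword).
Implicit Types (u : seq chord).
Notation teq := (@teq n k).
Notation xeq := (xeq n k).

Lemma nth_legs_partner z lab p : p < size (legs lab) ->
  nth z (legs lab) (partner p) = ((nth z (legs lab) p).1, ~~ (nth z (legs lab) p).2).
Proof.
elim: lab p => // -[c d] lab IH [|[|p]]; rewrite ?partnerSS //=; last exact: IH.
by rewrite negbK.
Qed.

Definition matched m (t : seq nat) : bool :=
  [forall q : 'I_m, nth 0 t q.*2.+1 == partner (nth 0 t q.*2)].

Lemma run_matched_caps z lab m (t : seq nat) : size t = m.*2 ->
  all (fun p => p < size (legs lab)) t -> matched m t ->
  run (map (nth z (legs lab)) t) (caps n m) = Some [::].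
Proof.
elim: m t => [|m IH] [|x [|y t]] //= [st] /and3P[hx hy ht] /forallP hm.
have /eqP /= -> := hm ord0; rewrite nth_legs_partner // step0.
case: (nth z _ x) => c d /=; rewrite eqxx partner_neq /=; apply: IH => //.
by apply/forallP => q; have := hm (lift ord0 q).
Qed.

(** Exchanges of adjacent maxima are absorbed, so the pair of strands under any maximum can be
    brought under the first one. *)
Lemma cap_first m s q (V : seq nat) : size s = m.*2 -> below m.*2 V ->
  run (permute V s) (caps n m) = Some [::] -> q < m -> exists V' : seq nat,
  [/\ below m.*2 V', teq s (cross n (virtual V) ++ caps n m) (cross n (virtual V') ++ caps n m),
      nth 0 (permute V' (iota 0 m.*2)) 0 = nth 0 (permute V (iota 0 m.*2)) q.*2
    & nth 0 (permute V' (iota 0 m.*2)) 1 = nth 0 (permute V (iota 0 m.*2)) q.*2.+1].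
Proof.
move=> hs; elim: q V => [|q IH] V hV hr hq; first by exists V; split=> //; apply: teq_refl.
have rV : run s (cross n (virtual V)) = Some (permute V s).
  by rewrite run_cross ?positions_virtual ?hs.
have h := caps_swap_pairs k hr hq.
have hb := below_swap_pairs hq.
have hr' : run (permute (V ++ swap_pairs q) s) (caps n m) = Some [::].
  move: (teq_run h); rewrite hr run_cat run_cross; last first.
    by rewrite positions_virtual size_permute hs.
  by rewrite positions_virtual permute_cat.
have hV' : below m.*2 (V ++ swap_pairs q) by rewrite below_cat hV.
have [V' [h1 h2 h3 h4]] := IH _ hV' hr' (ltnW hq).
exists V'; split=> //.
  apply: teq_trans h2; rewrite virtual_cat cross_cat -catA.
  by apply: (teq_catl rV); apply: teq_sym.
all: rewrite ?h3 ?h4 permute_cat; set t := permute V _.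
all: have st : q.*2.+3 < size t by rewrite size_permute size_iota; lia.
all: by case: (nth_swap_pairs 0 st).
Qed.

Lemma labels_cups p lab : labels (cups p lab) = map fst lab.
Proof. by elim: lab p => //= a lab IH p; rewrite /labels /= -/(labels _) IH. Qed.

Lemma labels_cross l : labels (cross n l) = [::].
Proof. by elim: l. Qed.

Lemma labels_caps m : labels (caps n m) = [::].
Proof. by elim: m. Qed.

End Closed.

Lemma map_cups m n (g : 'I_m -> 'I_n) p (lab : seq (strand m)) :
  map_word g (cups p lab) = cups p (map_level g lab).
Proof. by elim: lab p => //= a lab IH p; rewrite -IH. Qed.

Lemma map_cross m n (g : 'I_m -> 'I_n) l : map_word g (cross m l) = cross n l.
Proof. by elim: l => //= a l IH; rewrite -IH. Qed.

Lemma map_caps m n (g : 'I_m -> 'I_n) j : map_word g (caps m j) = caps n j.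
Proof. by elim: j => //= j IH; rewrite -/(caps n j) -IH. Qed.

Section NormalForm.

Variables (n : nat) (k : bool).
Implicit Types (s r t : seq (strand n)) (lab : seq (strand n)) (w v : word n) (l : xword).
Implicit Types (u : seq chord).
Notation teq := (@teq n k).
Notation xeq := (xeq n k).

(** When every maximum joins the legs of one minimum, each minimum lies on a circle of its own, and
    distinct labels for the minima are consistent. By [conn] this refinement is injective, so the
    given labels were already distinct. *)
Lemma matched_uniq lab l : all snd lab -> below (size lab).*2 (positions l) ->
  conn (cups 0 lab ++ cross n l ++ caps n (size lab)) ->
  matched (size lab) (permute (positions l) (iota 0 (size lab).*2)) ->
  uniq (map fst lab).
Proof.
move=> hup hl hc hm; set M := size lab in hl hc hm.
(* The finest labelling, in which each minimum has its own label. *)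
pose lab' : seq (strand M) := [seq (i, true) | i <- enum 'I_M].
pose g (i : 'I_M) := (tnth (in_tuple lab) i).1.
have sl : size lab' = M by rewrite size_map size_enum_ord.
have sL : size (legs lab') = M.*2 by rewrite size_legs sl.
have El : map_level g lab' = lab.
  rewrite /map_level -map_comp -[RHS](map_tnth_enum (in_tuple lab)).
  apply: eq_map => i /=; rewrite /g.
  have : snd (tnth (in_tuple lab) i) by apply: (allP hup); apply: mem_tnth.
  by case: (tnth _ i) => c [].
have Eg : map g (enum 'I_M) = map fst lab.
  by rewrite -El /map_level -!map_comp; apply: eq_map.
pose w' := cups 0 lab' ++ cross M l ++ caps M M.
have Ew : map_word g w' = cups 0 lab ++ cross n l ++ caps n M.
  by rewrite !map_word_cat map_cups map_cross map_caps El.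
have hr : run [::] w' = Some [::].
  rewrite /w' run_cat run_cups0 /= run_cat run_cross ?sL //=.
  case E: (legs lab') => [|z L]; last first.
    rewrite -E (nth_permute_gen z _ sL); apply: run_matched_caps => //.
      by rewrite size_permute size_iota.
    by apply/allP => p; rewrite (perm_mem (perm_permute _ _)) mem_iota sL.
  have M0 : M = 0 by move: sL; rewrite E /=; lia.
  have caps0 j : j = 0 -> run [::] (caps M j) = Some [::] by move->.
  by rewrite (size0nil (size_permute _ [::])) caps0.
have := hc _ _ _ Ew hr; rewrite /w' !labels_cat labels_cups labels_cross labels_caps !cats0.
have -> : map fst lab' = enum 'I_M by rewrite -map_comp map_id.
by move=> hinj; rewrite -Eg map_inj_in_uniq ?enum_uniq.
Qed.

Lemma plat_minimal w : is_diagram w -> exists lab l,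
  [/\ all snd lab, below (size lab).*2 (positions l), perm_eq (map fst lab) (enum 'I_n) &
      teq [::] w (cups 0 lab ++ cross n l ++ caps n (size lab))].
Proof.
move=> hw; have [hr _ _] := proj1 (is_diagramP w) hw.
have [lab [l [m [hup hl h]]]] := plat k hr.
have em : m = size lab.
  move: (teq_run h); rewrite hr run_cat run_cups0 /= run_cat run_cross ?size_legs //=.
  move/esym/run_caps_split => [t1 [Et st1 _]].
  have := congr1 size Et; rewrite size_permute size_cat st1 size_legs /= addn0.
  by lia.
subst m; have [M hM] := ubnP (size lab).
elim: M lab l hM hup hl h => // M IH lab l hM hup hl h.
have hd := proj1 (proj1 (teq_diagram h)) hw.
have [hr' hlab hc] := proj1 (is_diagramP _) hd.
case hm : (matched (size lab) (permute (positions l) (iota 0 (size lab).*2))).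
  exists lab, l; split=> //; apply: uniq_perm; rewrite ?enum_uniq //.
    exact: matched_uniq hc hm.
  move=> i; rewrite mem_enum; have := hlab i.
  by rewrite !labels_cat labels_cups labels_cross labels_caps !cats0 => ->.
have [q hq] : exists q : 'I_(size lab), nth 0 (permute (positions l) (iota 0 (size lab).*2)) q.*2.+1
    != partner (nth 0 (permute (positions l) (iota 0 (size lab).*2)) q.*2).
  by move/negbT: hm; rewrite negb_forall => /existsP.
set m := size lab in hl h hr' q hq *.
have hN : size (legs lab) = m.*2 by apply: size_legs.
have rl : run [::] (cups 0 lab) = Some (legs lab) by apply: run_cups0.
have hcap : run (permute (positions l) (legs lab)) (caps n m) = Some [::].
  by move: hr'; rewrite run_cat rl /= run_cat run_cross ?hN.
have [V [hV hV1 hV2 hV3]] := cap_first k hN hl hcap (ltn_ord q).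
pose u := chords (iota 0 m.*2) l.
have hu : all (chord_in m.*2) u by apply: chords_in.
have T1 : teq [::] w (cups 0 lab ++ cross n (chords_word u ++ virtual V) ++ caps n m).
  apply: (teq_trans h); apply: (teq_catl rl).
  have X := @xeq_factor n k m.*2 [::] l isT hl; have {}X := X (legs lab).
  apply: (teq_trans (teq_catr _ (X _))); first by rewrite hN.
  rewrite !cross_cat -!catA; apply: teq_catl hV1.
  rewrite run_cross ?permute_chords_word // hN; exact: chords_word_below.
have hr2 : run [::] (cups 0 lab ++ cross n (chords_word u ++ virtual V) ++ caps n m) = Some [::].
  by rewrite -(teq_run T1).
have hm0 : 0 < m by apply: leq_ltn_trans (ltn_ord q).
have [a [b [rest Et]]] : exists a b (rest : seq nat), permute V (iota 0 m.*2) = [:: a, b & rest].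
  have : 1 < size (permute V (iota 0 m.*2)) by rewrite size_permute size_iota; lia.
  by case: (permute _ _) => [|a [|b r]] // _; exists a, b, r.
have hab : b != partner a by move: hq; rewrite -hV2 -hV3 Et.
have [lab' [l' [hm' hup' hl' T2]]] := merge_minima k hup hu hV Et hab hr2.
apply: (IH lab' l') => //; first by apply: leq_trans hm' _; rewrite -ltnS.
exact: teq_trans T1 T2.
Qed.

End NormalForm.

(** * Standard form *)

Lemma swap_split (T : Type) p (t : seq T) : p.+1 < size t -> exists l1 a b l2,
  [/\ size l1 = p, t = l1 ++ [:: a, b & l2] & swap p t = l1 ++ [:: b, a & l2]].
Proof.
elim: p t => [|p IH] [|a t] //=.
  by case: t => // b t _; exists [::], a, b, t.
rewrite ltnS => /IH[l1 [b [c [l2 [h1 h2 h3]]]]]; exists (a :: l1), b, c, l2.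
by split; rewrite /= ?h1 ?h3 ?{1}h2.
Qed.

Lemma permute_fixed (T : eqType) (l : seq nat) (t : seq T) : uniq t -> permute l t = t ->
  permute l (iota 0 (size t)) = iota 0 (size t).
Proof.
move=> ht h; have <- : map (index^~ t) t = iota 0 (size t).
  case: t ht {h} => // x t ht; apply: (@eq_from_nth _ 0).
    by rewrite size_map size_iota.
  move=> i; rewrite size_map => hi.
  by rewrite (nth_map x) // nth_iota // index_uniq.
by rewrite -map_permute h.
Qed.

Section StandardForm.

Variables (n : nat) (k : bool).
Implicit Types (s r t : seq (strand n)) (lab h : seq (strand n)) (w v : word n) (l : xword).
Implicit Types (u : seq chord) (L V : seq nat).
Notation teq := (@teq n k).
Notation xeq := (xeq n k).

Lemma cups_permute L lab : below (size lab) L -> exists V, below (size lab).*2 V /\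
  teq [::] (cups 0 (permute L lab)) (cups 0 lab ++ cross n (virtual V)).
Proof.
elim: L lab => [|p L IH] lab /=; first by exists [::]; rewrite cats0; split=> //; apply: teq_refl.
case/andP => hp hL; have [|V [hV1 hV2]] := IH (swap p lab); first by rewrite size_swap.
rewrite size_swap in hV1; exists (swap_pairs p ++ V); split.
  by rewrite below_cat hV1 below_swap_pairs.
apply: (teq_trans hV2); rewrite virtual_cat cross_cat catA; apply: teq_catr.
have [l1 [a [b [l2 [<- -> ->]]]]] := swap_split hp; exact: cups_swap_pairs.
Qed.

Lemma run_caps_legs m t : run t (caps n m) = Some [::] -> exists2 h, t = legs h & size h = m.
Proof.
elim: m t => [|m IH] t /=; first by case=> ->; exists [::].
rewrite step0; case: t => [|[c d] [|[c' d'] t]] //=; case: ifP => // /andP[/eqP<- hd].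
rewrite (partner_orientation hd) => /IH[h -> <-].
by exists ((c, d) :: h).
Qed.

(** Absorption is asked at every level that the maxima can close; this makes it stable under
    concatenation, which changes the level in between. *)
Definition absorbed m V := below m.*2 V /\
  forall t, size t = m.*2 -> run t (caps n m) = Some [::] -> teq t (cross n (virtual V) ++ caps n m) (caps n m).

Lemma absorbed_nil m : absorbed m [::].
Proof. by split=> // t _ _; apply: teq_refl. Qed.

Lemma absorbed_cat m V V' : absorbed m V -> absorbed m V' -> absorbed m (V ++ V').
Proof.
move=> [h1 h2] [h3 h4]; split=> [|t st ht]; first by rewrite below_cat h1.
have h := h2 t st ht.
have rV : run t (cross n (virtual V)) = Some (permute V t).
  by rewrite run_cross ?positions_virtual ?st.
apply: teq_trans h; rewrite virtual_cat cross_cat -catA; apply: (teq_catl rV).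
apply: h4; first by rewrite size_permute.
by move: (teq_run (h2 t st ht)); rewrite ht run_cat rV.
Qed.

Definition upward (a : strand n) : strand n := (a.1, true).

Lemma absorbed_flips h : exists2 V, absorbed (size h) V &
  permute V (legs h) = legs (map upward h).
Proof.
suff [V hV E] : exists2 V, absorbed (size ([::] ++ h)) V &
    permute V (legs ([::] ++ h)) = legs ([::] ++ map upward h) by exists V.
elim: h [::] => [|a h IH] l1; first by exists [::] => //; apply: absorbed_nil.
have [V hV E] := IH (rcons l1 (upward a)); rewrite !cat_rcons in hV.
have E' : permute V (legs (l1 ++ upward a :: h)) = legs (l1 ++ map upward (a :: h)).
  by rewrite -cat_rcons E cat_rcons.
have hs : size (l1 ++ upward a :: h) = size (l1 ++ a :: h) by rewrite !size_cat.
rewrite hs in hV; case Ea: a.2.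
  by exists V => //; rewrite -E' /upward -Ea -surjective_pairing.
exists ((size l1).*2 :: V).
  apply: (@absorbed_cat _ [:: (size l1).*2]) => //; split=> [|t st ht].
    by rewrite /= size_cat /=; lia.
  by apply: caps_flip ht _; rewrite size_cat /=; lia.
rewrite -E' -[LHS]/(permute V (swap (size l1).*2 _)) !legs_cat; congr permute.
have := @permute_shift _ _ [:: 0] (legs l1) (legs (a :: h)) (size_legs l1).
rewrite /= addn0 => ->; congr (_ ++ _).
by case: (a) Ea => c d /= ->.
Qed.

Lemma absorbed_permute L h : below (size h) L -> exists2 V, absorbed (size h) V &
  permute V (legs h) = legs (permute L h).
Proof.
elim: L h => [|p L IH] h /=; first by exists [::] => //; apply: absorbed_nil.
case/andP => hp hL; have [|V hV E] := IH (swap p h); first by rewrite size_swap.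
rewrite size_swap in hV; exists (swap_pairs p ++ V).
  apply: absorbed_cat => //; split=> [|t st ht]; first exact: below_swap_pairs.
  exact: caps_swap_pairs ht hp.
rewrite permute_cat -E; congr permute.
have [l1 [a [b [l2 [hl1 -> ->]]]]] := swap_split hp.
rewrite !legs_cat; apply: permute_swap_pairs; by rewrite size_legs hl1.
Qed.

Definition std : seq (strand n) := [seq (i, true) | i <- enum 'I_n].

Lemma size_std : size std = n.
Proof. by rewrite size_map size_enum_ord. Qed.

Lemma count_legs i h : count_mem i (map fst (legs h)) = (count_mem i (map fst h)).*2.
Proof. by elim: h => //= a h ->; rewrite addnA addnn -doubleD. Qed.

Lemma mem_legs a h : a \in legs h -> a.1 \in map fst h.
Proof.
by elim: h => //= b h IH; rewrite !inE => /or3P[/eqP->|/eqP->|/IH->]; rewrite ?eqxx ?orbT.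
Qed.

Lemma uniq_legs_std : uniq (legs std).
Proof.
rewrite /std; elim: (enum 'I_n) (enum_uniq 'I_n) => //= i e IH /andP[hi /IH he].
have hni b : (i, b) \notin legs [seq (j, true) | j <- e].
  by apply: contra hi => /mem_legs; rewrite -map_comp map_id.
change (uniq [:: (i, true), (i, false) & legs [seq (j, true) | j <- e]]).
by rewrite /= inE xpair_eqE andbF !hni he.
Qed.

(** A level closed by the maxima has the form [legs h]. Turning pairs over and permuting pairs, both
    absorbed by the maxima, bring it back to [legs std]. As these legs are pairwise distinct, the
    total permutation is trivial and the virtual word cancels. *)
Lemma absorbed_std V : below n.*2 V ->
  run (permute V (legs std)) (caps n n) = Some [::] ->
  teq (legs std) (cross n (virtual V) ++ caps n n) (caps n n).
Proof.
move=> hV hr; have hN : size (legs std) = n.*2 by rewrite size_legs size_std.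
have [h Eh sh] := run_caps_legs hr.
have [V1 hV1 E1] := absorbed_flips h.
(* Each label occurs twice among the legs, hence exactly once in [h]. *)
have hp : perm_eq (map fst h) (enum 'I_n).
  apply/allP => i _ /=; apply/eqP/double_inj; rewrite -count_legs -Eh map_permute.
  have -> : count_mem i (permute V (map fst (legs std))) = count_mem i (map fst (legs std)).
    by apply/permP; apply: perm_permute.
  by rewrite count_legs -map_comp map_id.
have hp2 : perm_eq std (map upward h).
  rewrite perm_sym (_ : map upward h = map (fun i => (i, true)) (map fst h)).
    exact: perm_map.
  by rewrite -map_comp.
have [L hL EL] := permute_exists hp2.
have [V2 hV2 E2] := absorbed_permute hL.
rewrite size_map in hV2; have [hb hV12] := absorbed_cat hV1 hV2.
rewrite sh in hb hV12.
have rV : run (legs std) (cross n (virtual V)) = Some (permute V (legs std)).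
  by rewrite run_cross ?positions_virtual ?hN.
apply: (@teq_trans _ _ _ (cross n (virtual V) ++ cross n (virtual (V1 ++ V2)) ++ caps n n)).
  apply: (teq_catl rV); apply: teq_sym; apply: hV12 => //.
  by rewrite size_permute.
rewrite catA -cross_cat -virtual_cat.
apply: (@teq_catr _ _ _ _ [::]).
have X : xeq n.*2 (virtual (V ++ V1 ++ V2)) (virtual [::]).
  apply: xeq_virtual => //; first by rewrite below_cat hV.
  rewrite -hN; apply: permute_fixed uniq_legs_std _.
  by rewrite !permute_cat Eh E1 E2 EL.
by apply: X; rewrite hN.
Qed.

(** Once the minima are sorted, [xeq_factor] puts the chords before a virtual word, and the maxima
    absorb that word. *)
Theorem standard_form w : is_diagram w -> exists u,
  all (chord_in n.*2) u /\ teq [::] w (cups 0 std ++ cross n (chords_word u) ++ caps n n).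
Proof.
move=> hw; have [lab [l [hup hl hp h]]] := plat_minimal k hw.
have slab : size lab = n by have := perm_size hp; rewrite size_map size_enum_ord.
rewrite slab in hl h.
have hp2 : perm_eq lab std.
  rewrite (_ : lab = map (fun i => (i, true)) (map fst lab)); first exact: perm_map.
  rewrite -map_comp -[LHS]map_id; apply/eq_in_map => -[c d] /(allP hup) /= hd.
  by rewrite /= -hd.
have [L hL EL] := permute_exists hp2.
have [V [hV1 hV2]] := cups_permute hL; rewrite EL in hV2.
rewrite size_std in hV1.
have hN : size (legs std) = n.*2 by rewrite size_legs size_std.
have rl : run [::] (cups 0 std) = Some (legs std) by apply: run_cups0.
pose m := virtual V ++ l.
have hm : below n.*2 (positions m) by rewrite positions_cat positions_virtual below_cat hV1.
pose u := chords (iota 0 n.*2) m.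
have hu : all (chord_in n.*2) u by apply: chords_in.
have T1 : teq [::] w (cups 0 std ++ cross n (chords_word u) ++ cross n (virtual (positions m)) ++ caps n n).
  apply: (teq_trans h); apply: (teq_trans (teq_catr _ hV2)); rewrite -catA.
  apply: (teq_catl rl); rewrite !catA -!cross_cat; apply: teq_catr.
  have X := @xeq_factor n k n.*2 [::] m isT hm; apply: X; by rewrite hN.
exists u; split=> //; apply: (teq_trans T1); apply: (teq_catl rl).
have ru : run (legs std) (cross n (chords_word u)) = Some (legs std).
  by rewrite run_cross ?permute_chords_word // hN; apply: chords_word_below.
apply: (teq_catl ru); apply: absorbed_std => //.
have [hr _ _] := proj1 (is_diagramP w) hw.
move: (teq_run T1); rewrite hr run_cat rl /= run_cat ru /= run_cat run_cross; last first.
  by rewrite positions_virtual hN.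
by rewrite positions_virtual.
Qed.

End StandardForm.

(** * Intersection numbers of star chords *)

Section Classification.

Import GRing.Theory.
Local Open Scope ring_scope.

Variable n : nat.
Implicit Types (s lab : seq (strand n)) (u v : seq chord) (i : 'I_n).

Lemma nth_legs_double z lab j : (j < size lab)%N -> nth z (legs lab) j.*2 = nth z lab j.
Proof. by elim: lab j => // -[c d] lab IH [|j] //=; apply: IH. Qed.

Lemma nth_legs_std z i : nth z (legs (std n)) i.*2 = (i, true).
Proof.
rewrite nth_legs_double ?size_std //.
by rewrite (nth_map i) ?size_enum_ord // nth_ord_enum.
Qed.

Lemma index_cups i p lab s (v : word n) : word_index i s (cups p lab ++ v) =
  word_index i (odflt [::] (run s (cups p lab))) v \/ run s (cups p lab) = None.
Proof.
elim: lab p s => [|a lab IH] p s; first by left.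
rewrite cat_cons [cups _ _]/= [run s _]/= [word_index _ _ _]/= add0r.
by case: (step s _) => [t|]; [exact: IH | right].
Qed.

Lemma index_caps i m s : word_index i s (caps n m) = 0.
Proof. by elim: m s => //= m IH s; rewrite IH addr0 /piece_index. Qed.

(** All left legs are upward, so the sign factor is 1; as [i] is not the first component, only the
    end at leg [i.*2] counts. *)
Lemma index_star_chord z i c : (0 < i)%N -> chord_in n.*2 c -> star c ->
  crossing_index i c.2 (nth z (legs (std n)) c.1.1) (nth z (legs (std n)) c.1.2) =
  (c == arrow 0 i.*2)%:Z - (c == coarrow i.*2 0)%:Z.
Proof.
move=> hi hc [j hj hcj].
have hjn : (j < n)%N by case: hcj hc => -> /and4P[/= _]; rewrite /= ?ltn_double.
have n0 : (0 < n)%N by apply: leq_ltn_trans hjn.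
have e0 : nth z (legs (std n)) 0 = (Ordinal n0, true) := nth_legs_std z (Ordinal n0).
have ej : nth z (legs (std n)) j.*2 = (Ordinal hjn, true) := nth_legs_std z (Ordinal hjn).
have i0 : (Ordinal n0 == i) = false by apply/negbTE; rewrite -val_eqE /= eq_sym -lt0n.
have ij : (Ordinal hjn == i) = (j == i :> nat) by rewrite -val_eqE.
case: hcj => ->; rewrite /arrow /coarrow /crossing_index /= e0 ej /= i0 ij !xpair_eqE /=.
  by rewrite (inj_eq double_inj); case: eqP; rewrite ?andbF.
by rewrite (inj_eq double_inj); case: eqP; rewrite ?andbF.
Qed.

Lemma index_stars i v : (0 < i)%N -> all (chord_in n.*2) v -> (forall c, c \in v -> star c) ->
  word_index i [::] (cups 0 (std n) ++ cross n (chords_word v) ++ caps n n) =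
  (count_mem (arrow 0 i.*2) v)%:Z - (count_mem (coarrow i.*2 0) v)%:Z.
Proof.
move=> hi hv hs; have hN : size (legs (std n)) = n.*2 by rewrite size_legs size_std.
have [->|] := index_cups i 0 (std n) [::] (cross n (chords_word v) ++ caps n n); last first.
  by rewrite run_cups0.
have rv : run (legs (std n)) (cross n (chords_word v)) = Some (legs (std n)).
  by rewrite run_cross ?permute_chords_word // hN chords_word_below.
rewrite run_cups0 /= (word_index_cat _ _ rv) index_caps addr0.
rewrite (@index_chords_word n i (i, true)) ?hN //.
elim: v hv hs {rv} => [|c v IH] /=; first by rewrite big_nil.
case/andP=> hc hv hs; rewrite big_cons IH //; last first.
  by move=> d hd; apply: hs; rewrite inE hd orbT.
rewrite index_star_chord //; last by apply: hs; rewrite mem_head.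
by rewrite !PoszD; ring.
Qed.

End Classification.

(** * Intersection numbers determine the equivalence class *)

Section Comparison.

Variables (n : nat) (k : bool).
Hypothesis hn : 1 < n.

Lemma star_standard_form (w : word n) : is_diagram w -> exists v,
  [/\ all (chord_in n.*2) v, forall c, c \in v -> star c &
      teq k [::] w (cups 0 (std n) ++ cross n (chords_word v) ++ caps n n)].
Proof.
move=> hw; have [u [hu h]] := standard_form k hw.
have hs : 1 < size (std n) by rewrite size_std.
have hN : size (legs (std n)) = n.*2 by rewrite size_legs size_std.
have hup : all snd (std n) by apply/allP => a /mapP[i _ ->].
have [|v [[_ hv h1] h2]] := @star_form n k (std n) hs hup u; first by rewrite hN.
rewrite hN in hv; exists v; split=> //; apply: (teq_trans h).
by rewrite !catA; apply: teq_catr.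
Qed.

(** The intersection number of component $i>0$ is the exponent of $c_{0,2i}$ in the star form, so
    both star forms have the same exponents and [balanced_cup_eq] applies. *)
Lemma equal_index_teq (w w' : word n) : is_diagram w -> is_diagram w' ->
  (forall i, word_index i [::] w = word_index i [::] w') -> teq k [::] w w'.
Proof.
move=> /star_standard_form[u [hu su hu']] /star_standard_form[v [hv sv hv']] hi.
have hs : 1 < size (std n) by rewrite size_std.
have hN : size (legs (std n)) = n.*2 by rewrite size_legs size_std.
have hcount j : 0 < j -> count_mem (arrow 0 j.*2) u + count_mem (coarrow j.*2 0) v =
    count_mem (coarrow j.*2 0) u + count_mem (arrow 0 j.*2) v.
  move=> hj; have [hjn|hnj] := ltnP j n.
    have := hi (Ordinal hjn); rewrite (teq_index _ hu') (teq_index _ hv').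
    by rewrite !index_stars //=; lia.
  (* For [j >= n] leg [j.*2] does not exist, so all four counts vanish. *)
  have out w0 c : all (chord_in n.*2) w0 -> ~~ chord_in n.*2 c -> count_mem c w0 = 0.
    by move=> hw hc; apply/count_memPn; apply: contra hc; apply: (allP hw).
  by rewrite !out // /chord_in /=; apply/negP => /and4P[/= _]; rewrite ?ltn_double; lia.
have nin c : ~ star c -> count_mem c u = 0 /\ count_mem c v = 0.
  by move=> hc; split; apply/count_memPn/negP => h; apply: hc; first [exact: su | exact: sv].
apply: (teq_trans hu'); apply: teq_trans (teq_sym hv').
have [|||_ _ h] := @balanced_cup_eq n k (std n) hs u v; rewrite ?hN //; last first.
  by rewrite !catA; apply: teq_catr.
move=> c; have [[j hj [->|->]]|hc] := Classical_Prop.classic (star c).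
- exact: hcount.
- by have := hcount _ hj; rewrite /inv_chord /= -/(arrow 0 j.*2); lia.
have hc' : ~ star (inv_chord c) by move/star_inv; rewrite inv_chordK.
by have [-> ->] := nin _ hc; have [-> ->] := nin _ hc'.
Qed.

End Comparison.

Lemma equivalent_byE n (k : bool) (hn : 1 < n) (L L' : vlink n) :
  equivalent_by (extra_move k) L L' <->
  forall i, intersection_number L i = intersection_number L' i.
Proof.
split=> [[D [D' [hD hD' h]]] i|h].
  by rewrite (intersection_number_index _ hD) (intersection_number_index _ hD'); apply: diagram_moves_index h.
have [D hD] := vlink_inhabited L; have [D' hD'] := vlink_inhabited L'.
exists D, D'; split=> //.
apply: (proj2 (teq_diagram (equal_index_teq k hn (diagramP D) (diagramP D') _))) => // i.
by rewrite -(intersection_number_index _ hD) -(intersection_number_index _ hD').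
Qed.


Theorem theorem1p2 (n : nat) (hn : (2 <= n)%N) (L L' : vlink n) :
  (vdelta_equivalent L L' <-> vp_equivalent L L') /\
  (vp_equivalent L L' <->
   forall i : 'I_n, intersection_number L i = intersection_number L' i).
Proof.
have hv := equivalent_byE true hn L L'; have hp := equivalent_byE false hn L L'.
by split=> //; apply: (iff_trans hv); apply: iff_sym.
Qed.
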